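(* Let $c,d,r\in\mathbb{N}$ with $c,d<r$, and let $x>0$. Then $\mathbb{W}_{c,d}(z,x)$, defined for $\mathrm{Re}(z)>1$ by $$\mathbb{W}_{c,d}(z,x):=\sum_{n=1}^{\infty}\sum_{m=1}^{\infty}\frac{e^{2\pi i mc/r}\,e^{2\pi i nd/r}}{mn(n+mx)^{z-1}},$$ has an analytic continuation in $z$ to the whole complex plane. Further, for any $z\in\mathbb{C}$ and any $\delta$ such that $0<\delta<\min\left(\frac{2\pi}{r},\frac{2\pi}{rx}\right)$, $$\begin{aligned}\mathbb{W}_{c,d}(z,x)&=\frac{1}{\Gamma(z-1)}\sum_{n=1}^{\infty}\sum_{m=1}^{\infty}\frac{e^{2\pi i mc/r}\,e^{2\pi i nd/r}}{mn(n+mx)^{z-1}}\,\Gamma(z-1,(n+mx)\delta)\\&\quad+\frac{1}{\Gamma(z-1)}\sum_{u=0}^{\infty}\sum_{v=0}^{\infty}(-1)^{u+v}\frac{\mathscr{L}\left(1-u,\frac cr\right)\mathscr{L}\left(1-v,\frac dr\right)x^u\delta^{u+v+z-1}}{u!\,v!\,(u+v+z-1)}.\end{aligned}$$ In particular, $$\mathbb{W}_{c,d}(1,x)=\mathscr{L}\left(1,\frac cr\right)\mathscr{L}\left(1,\frac dr\right).$$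
   Context: $\Gamma(s,y)=\int_y^\infty t^{s-1}e^{-t}\,dt$ ($y>0$) is the (upper) incomplete Gamma function. $\mathscr{L}(s,\alpha)$ is the periodic zeta function $\mathscr{L}(s,\alpha)=\sum_{n=1}^{\infty}\frac{e^{2\pi i n\alpha}}{n^s}$ (for real non-integer $\alpha$ it converges for $\mathrm{Re}(s)>0$), extended by analytic continuation to all $s\in\mathbb{C}$. At $z\in\{1,0,-1,-2,\dots\}$, where $1/\Gamma(z-1)$ vanishes and some denominators $u+v+z-1$ vanish, the right-hand side is understood as its limiting value. *)

(* Defs.v *)
From Stdlib Require Import Reals Factorial ClassicalEpsilon.
From Coquelicot Require Import Coquelicot.

Open Scope R_scope.

Definition Cexp (z : C) : C := (exp (Re z) * cos (Im z), exp (Re z) * sin (Im z)).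

(* Principal value of t^s; only meaningful for t > 0. *)
Definition cpow (t : R) (s : C) : C := Cexp (s * RtoC (ln t))%C.

Definition e2pi (a : R) : C := Cexp (RtoC (2 * PI * a) * Ci)%C.

Definition entire (f : C -> C) : Prop :=
  forall z : C, ex_derive (K := C_AbsRing) (V := C_NormedModule) f z.

Definition is_Cseries (a : nat -> C) (l : C) : Prop :=
  is_series (K := C_AbsRing) (V := C_NormedModule) a l.

(* Iterated sum: the outer summation is over the first index. *)
Definition is_double_series (a : nat -> nat -> C) (l : C) : Prop :=
  exists b : nat -> C, (forall i, is_Cseries (a i) (b i)) /\ is_Cseries b l.

Definition ex_double_series (a : nat -> nat -> C) : Prop :=
  exists l : C, is_double_series a l.

(* The sum when [ex_double_series a] holds, unspecified otherwise. *)
Definition double_series (a : nat -> nat -> C) : C :=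
  iota (T := C_CompleteNormedModule) (is_double_series a).

Definition Gamma_integral (s : C) : C :=
  RInt_gen (V := C_R_CompleteNormedModule)
    (fun t => cpow t (s - 1) * RtoC (exp (- t)))%C
    (at_right 0) (Rbar_locally p_infty).

Fixpoint rising (s : C) (n : nat) : C :=
  match n with
  | O => RtoC 1
  | S k => (rising s k * (s + RtoC (INR k)))%C
  end.

(* Euler's integral for Re s > 0 (then the shift is 0), continued to the left by
   Gamma(s) = Gamma(s + N) / (s (s + 1) ... (s + N - 1)), where N is the least
   natural number with Re s + N > 0. Meaningless at the poles 0, -1, -2, ... *)
Definition Gamma (s : C) : C :=
  let N := Z.to_nat (up (- Re s)) in
  (Gamma_integral (s + RtoC (INR N)) / rising s N)%C.

Definition upper_Gamma (s : C) (y : R) : C :=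
  RInt_gen (V := C_R_CompleteNormedModule)
    (fun t => cpow t (s - 1) * RtoC (exp (- t)))%C
    (at_point y) (Rbar_locally p_infty).

Definition is_periodic_zeta (a : R) (L : C -> C) : Prop :=
  entire L /\
  forall s : C, 0 < Re s ->
    is_Cseries (fun n => e2pi (INR (S n) * a) / cpow (INR (S n)) s)%C (L s).

(* The analytic continuation, unique for non-integer a by the identity theorem.
   For integer a there is no such entire function and the value is junk. *)
Definition periodic_zeta (a : R) : C -> C :=
  epsilon (inhabits (fun _ : C => RtoC 0)) (is_periodic_zeta a).

Definition W_term (c d r : nat) (x : R) (z : C) (n m : nat) : C :=
  (e2pi (INR m * INR c / INR r) * e2pi (INR n * INR d / INR r)
   / (RtoC (INR m) * RtoC (INR n) * cpow (INR n + INR m * x) (z - 1)))%C.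

Definition is_W (c d r : nat) (x : R) (W : C -> C) : Prop :=
  entire W /\
  forall z : C, 1 < Re z ->
    is_double_series (fun n m => W_term c d r x z (S n) (S m)) (W z).

Definition rhs_term1 (c d r : nat) (x delta : R) (z : C) (n m : nat) : C :=
  (W_term c d r x z n m * upper_Gamma (z - 1) ((INR n + INR m * x) * delta))%C.

Definition rhs_term2 (c d r : nat) (x delta : R) (z : C) (u v : nat) : C :=
  (RtoC ((-1) ^ (u + v))
   * (periodic_zeta (INR c / INR r) (RtoC (1 - INR u))
      * periodic_zeta (INR d / INR r) (RtoC (1 - INR v))
      * RtoC (x ^ u) * cpow delta (RtoC (INR u + INR v) + z - 1))
   / (RtoC (INR (fact u)) * RtoC (INR (fact v)) * (RtoC (INR u + INR v) + z - 1)))%C.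

Definition rhs (c d r : nat) (x delta : R) (z : C) : C :=
  (1 / Gamma (z - 1) * double_series (fun n m => rhs_term1 c d r x delta z (S n) (S m))
   + 1 / Gamma (z - 1) * double_series (rhs_term2 c d r x delta z))%C.

(* z in {1, 0, -1, -2, ...}. *)
Definition exceptional (z : C) : Prop := exists k : nat, z = RtoC (1 - INR k).

Definition is_limiting_value (f : C -> C) (z w : C) : Prop :=
  filterlim (T := C) (U := C) f
    (locally' (T := C_UniformSpace) z) (locally (T := C_UniformSpace) w).

(* Main.v *)
(* Write s = z - 1. With phi_a(t) = sum_n e(na) exp(-nt) and
   A_a(t) = sum_n e(na) exp(-nt) / n = -log (1 - e(a) exp(-t)), where e(a) = exp(2 pi i a),
   integrating term by term gives, for Re s > 0,
     Gamma(s) L(s, a) = int_0^oo t^(s-1) phi_a(t) dt,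
     Gamma(s) W(z, x) = int_0^oo t^(s-1) A_{c/r}(xt) A_{d/r}(t) dt.
   If f decays exponentially and has Taylor coefficients p_k at 0, its Mellin transform divided by
   Gamma extends to an entire function with value (-1)^k k! p_k at s = -k: on Re s > -N, subtract
   the Taylor polynomial of order N on (0, delta) and clear the poles with
   1/Gamma(s) = s(s+1)...(s+N-1) / Gamma(s+N). Applied to phi_a this identifies the Taylor
   coefficients of A_a as (-1)^u L(1-u, a) / u!. Splitting the integral for W at delta, the part
   beyond delta sums to the incomplete Gamma series and the part before delta to the series in
   u, v; the bound on delta keeps both factors inside the discs of convergence of their Taylor
   series, whose radii are at least 2 pi / r because 1 - e(a) exp(-t) has no zero closer to 0.

   Uniqueness of continuations is obtained from Goursat's lemma on rectangles, by integrating
   against a Gaussian kernel that concentrates at a point of the left side. *)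
Require Import Defs.
From Stdlib Require Import ZArith Reals Lra Lia Psatz Factorial ClassicalEpsilon.
From Coquelicot Require Import Coquelicot.

Open Scope R_scope.

(** Dividing by Gamma presupposes that it has no zeros for [Re s > 0]. For large real part this
    comes from concentration of the density [t^(a-1) exp(-t)], and the functional equation would
    carry any zero to such a place. The function [periodic_zeta] is picked by [epsilon], so its
    values outside [Re s > 0] are reached only through uniqueness of continuations. Uniqueness has
    to cover functions known merely to be complex differentiable at each point, with no continuity
    of the derivative; hence Goursat. The generating function is explicit, so its Taylor series
    needs less: with a uniform second-order bound, contracting a circle to a point yields Cauchy's
    formula. For [Re s <= 0] low monomials are not integrable on (0, delta), so the series in [u, v]
    cannot be integrated termwise. What is summed termwise is the Hadamard finite part, a linear
    functional which is a genuine integral, hence small, on functions vanishing to order [N] at 0.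
    At exceptional points the formula is never evaluated: it agrees with an entire function nearby,
    and continuity gives the limit. *)

Notation is_Cderive f z l := (is_derive (K := C_AbsRing) (V := C_NormedModule) f z l).
Notation Cderivable f z := (ex_derive (K := C_AbsRing) (V := C_NormedModule) f z).
Notation curve_continuous f t :=
  (continuous (T := R_UniformSpace) (U := NormedModule.UniformSpace _ C_R_NormedModule) f t).
Notation is_CRInt f a b l := (is_RInt (V := C_R_NormedModule) f a b l).
Notation is_CRInt_gen f Fa Fb l := (is_RInt_gen (V := C_R_NormedModule) f Fa Fb l).
Notation is_curve_derive f t l := (is_derive (K := R_AbsRing) (V := C_R_NormedModule) f t l).

(** * Complex differentiability and continuous curves *)

Lemma Cmod_ReIm (z : C) : Cmod z <= Rabs (Re z) + Rabs (Im z).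
Proof.
unfold Cmod, Re, Im.
rewrite <- (sqrt_Rsqr (Rabs (fst z) + Rabs (snd z))).
- apply sqrt_le_1_alt. unfold Rsqr.
  pose proof (Rabs_pos (fst z)). pose proof (Rabs_pos (snd z)).
  rewrite <- (pow2_abs (fst z)), <- (pow2_abs (snd z)). nra.
- pose proof (Rabs_pos (fst z)). pose proof (Rabs_pos (snd z)). lra.
Qed.

Lemma im_le_Cmod (z : C) : Rabs (Im z) <= Cmod z.
Proof. eapply Rle_trans; [apply Rmax_r | apply Rmax_Cmod]. Qed.

Lemma Cmod_sub_le (a b : C) : Cmod (a - b) <= Cmod a + Cmod b.
Proof. unfold Cminus. rewrite <- (Cmod_opp b). apply Cmod_triangle. Qed.

Lemma Cmod_ge_sub (a b : C) : Cmod a - Cmod b <= Cmod (a + b).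
Proof.
replace a with ((a + b) - b)%C at 1 by ring.
pose proof (Cmod_sub_le (a + b) b). lra.
Qed.

Lemma Cplus_minus_l (z h : C) : (z + h + - z)%C = h.
Proof. ring. Qed.

Lemma norm_C_R (z : C) : norm (V := C_R_NormedModule) z = Cmod z.
Proof.
destruct z as [a b]. unfold norm, Cmod; simpl. unfold prod_norm; simpl.
f_equal. unfold norm; simpl. unfold abs; simpl.
rewrite !Rmult_1_r, <- !Rabs_mult, !Rabs_pos_eq by nra. reflexivity.
Qed.

(** Derivatives over [C_AbsRing] and curves in [C_R_NormedModule] live in different uniform
    structures on [C]; estimates in [Cmod] make the two composable. *)
Lemma is_Cderive_eps (f : C -> C) (z l : C) :
  is_Cderive f z l <->
  (forall eps : R, 0 < eps -> exists del : R, 0 < del /\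
    forall h : C, Cmod h < del -> Cmod (f (z + h)%C - f z - h * l)%C <= eps * Cmod h).
Proof.
split.
- intros [_ H] eps Heps.
  destruct (H z (fun P HP => HP) (mkposreal eps Heps)) as [del Hd].
  exists del. split; [apply cond_pos |].
  intros h Hh. specialize (Hd (z + h)%C). simpl in Hd.
  assert (Hb : ball (M := AbsRing_UniformSpace C_AbsRing) z del (z + h)%C).
  { unfold ball; simpl; unfold AbsRing_ball; simpl.
    unfold abs; simpl. unfold minus, plus, opp; simpl.
    rewrite Cplus_minus_l. exact Hh. }
  specialize (Hd Hb).
  unfold norm, minus, plus, opp, scal in Hd; simpl in Hd.
  unfold mult in Hd; simpl in Hd. unfold abs in Hd; simpl in Hd.
  rewrite Cplus_minus_l in Hd.
  exact Hd.
- intros H. split.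
  + apply is_linear_scal_l.
  + intros x Hx.
    assert (Hzx : z = x).
    { apply (is_filter_lim_locally_unique (V := AbsRing_NormedModule C_AbsRing)). exact Hx. }
    subst x. intros eps.
    destruct (H eps (cond_pos eps)) as [del [Hdel Hd]].
    exists (mkposreal del Hdel). intros y Hy.
    unfold ball in Hy; simpl in Hy; unfold AbsRing_ball in Hy; simpl in Hy.
    unfold abs in Hy; simpl in Hy. unfold minus, plus, opp in Hy; simpl in Hy.
    specialize (Hd (y + - z)%C Hy).
    unfold norm, minus, plus, opp, scal; simpl.
    unfold mult; simpl. unfold abs; simpl.
    assert (E : forall a b : C, (a + (b + - a))%C = b) by (intros; ring). rewrite E in Hd.
    exact Hd.
Qed.

Lemma curve_continuous_eps (f : R -> C) (t : R) :
  curve_continuous f t <->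
  (forall eps : R, 0 < eps -> exists del : R, 0 < del /\
    forall u : R, Rabs (u - t) < del -> Cmod (f u - f t)%C < eps).
Proof.
split.
- intros H eps Heps.
  assert (Hl : locally (T := C_R_NormedModule) (f t) (fun y => Cmod (y - f t)%C < eps)).
  { apply (locally_le_locally_norm (V := C_R_NormedModule)).
    exists (mkposreal eps Heps). intros y Hy.
    rewrite <- norm_C_R. exact Hy. }
  destruct (H _ Hl) as [del Hd].
  exists del. split; [apply cond_pos |].
  intros u Hu. apply Hd. exact Hu.
- intros H P HP.
  apply (locally_norm_le_locally (V := C_R_NormedModule)) in HP.
  destruct HP as [eps He].
  destruct (H eps (cond_pos eps)) as [del [Hdel Hd]].
  exists (mkposreal del Hdel). intros u Hu. apply He. unfold ball_norm. rewrite norm_C_R. apply Hd. exact Hu.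
Qed.

(** Tolerance 1 in the definition of the derivative [l] gives the constant [1 + |l|]. This
    quantitative continuity drives the product and chain rules and the limit at exceptional
    points. *)
Lemma Cderive_lipschitz (f : C -> C) (z : C) :
  Cderivable f z -> exists del M : R, 0 < del /\ 0 < M /\
    forall w : C, Cmod (w - z)%C < del -> Cmod (f w - f z)%C <= M * Cmod (w - z)%C.
Proof.
intros [l Hl]. apply is_Cderive_eps with (eps := 1) in Hl; [|lra].
destruct Hl as [del [Hdel Hd]].
exists del, (1 + Cmod l). split; [exact Hdel|]. split; [pose proof (Cmod_ge_0 l); lra|].
intros w Hw. specialize (Hd _ Hw).
replace (z + (w - z))%C with w in Hd by ring.
replace (f w - f z)%C with ((f w - f z - (w - z) * l) + (w - z) * l)%C by ring.
eapply Rle_trans; [apply Cmod_triangle|]. rewrite Cmod_mult. lra.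
Qed.

Lemma curve_continuous_comp (g : C -> C) (f : R -> C) (t : R) :
  Cderivable g (f t) -> curve_continuous f t -> curve_continuous (fun u => g (f u)) t.
Proof.
intros Hg Hf. apply curve_continuous_eps. intros eps Heps.
destruct (Cderive_lipschitz _ _ Hg) as (del & M & Hdel & HM & H).
assert (Hm : 0 < Rmin del (eps / M)).
{ apply Rmin_pos; [exact Hdel|]. apply Rdiv_lt_0_compat; assumption. }
destruct (proj1 (curve_continuous_eps _ _) Hf _ Hm) as [d [Hd Hu]].
exists d. split; [exact Hd|]. intros u Hu1. specialize (Hu u Hu1).
assert (H1 := Rlt_le_trans _ _ _ Hu (Rmin_l _ _)).
assert (H2 := Rlt_le_trans _ _ _ Hu (Rmin_r _ _)).
eapply Rle_lt_trans; [apply H; exact H1|].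
apply Rlt_le_trans with (M * (eps / M)).
- apply Rmult_lt_compat_l; assumption.
- right. field. lra.
Qed.

Lemma curve_continuous_pair (f : R -> C) (t : R) :
  continuous (fun u => Re (f u)) t -> continuous (fun u => Im (f u)) t -> curve_continuous f t.
Proof.
intros H1 H2. apply curve_continuous_eps. intros eps Heps.
assert (He : 0 < eps / 2) by lra.
destruct (proj1 (filterlim_locally _ _) H1 (mkposreal _ He)) as [d1 Hd1].
destruct (proj1 (filterlim_locally _ _) H2 (mkposreal _ He)) as [d2 Hd2].
exists (Rmin d1 d2). split; [apply Rmin_pos; apply cond_pos|].
intros u Hu.
assert (Hu1 : Rabs (Re (f u) - Re (f t)) < eps / 2).
{ apply Hd1. eapply Rlt_le_trans; [exact Hu|apply Rmin_l]. }
assert (Hu2 : Rabs (Im (f u) - Im (f t)) < eps / 2).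
{ apply Hd2. eapply Rlt_le_trans; [exact Hu|apply Rmin_r]. }
eapply Rle_lt_trans; [apply Cmod_ReIm|].
unfold Cminus. rewrite re_plus, im_plus, re_opp, im_opp.
unfold Rminus in Hu1, Hu2. lra.
Qed.

Lemma curve_continuous_Re (f : R -> C) (t : R) :
  curve_continuous f t -> continuous (fun u => Re (f u)) t.
Proof.
intros H. apply filterlim_locally. intros eps.
destruct (proj1 (curve_continuous_eps _ _) H eps (cond_pos eps)) as [d [Hd Hu]].
exists (mkposreal d Hd). intros u Hu1. specialize (Hu u Hu1).
change (Rabs (Re (f u) - Re (f t)) < eps).
eapply Rle_lt_trans; [|exact Hu].
replace (Re (f u) - Re (f t)) with (Re (f u - f t)%C) by
  (unfold Cminus; rewrite re_plus, re_opp; ring).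
apply re_le_Cmod.
Qed.

Lemma curve_continuous_Im (f : R -> C) (t : R) :
  curve_continuous f t -> continuous (fun u => Im (f u)) t.
Proof.
intros H. apply filterlim_locally. intros eps.
destruct (proj1 (curve_continuous_eps _ _) H eps (cond_pos eps)) as [d [Hd Hu]].
exists (mkposreal d Hd). intros u Hu1. specialize (Hu u Hu1).
change (Rabs (Im (f u) - Im (f t)) < eps).
eapply Rle_lt_trans; [|exact Hu].
replace (Im (f u) - Im (f t)) with (Im (f u - f t)%C) by
  (unfold Cminus; rewrite im_plus, im_opp; ring).
apply im_le_Cmod.
Qed.

Lemma curve_continuous_const (c : C) (t : R) : curve_continuous (fun _ => c) t.
Proof. apply continuous_const. Qed.

Lemma curve_continuous_RtoC (f : R -> R) (t : R) :
  continuous f t -> curve_continuous (fun u => RtoC (f u)) t.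
Proof.
intros H. apply curve_continuous_pair; simpl; [exact H|apply continuous_const].
Qed.

Lemma curve_continuous_plus (f g : R -> C) (t : R) :
  curve_continuous f t -> curve_continuous g t -> curve_continuous (fun u => f u + g u)%C t.
Proof. apply (continuous_plus (V := C_R_NormedModule)). Qed.

Lemma curve_continuous_opp (f : R -> C) (t : R) :
  curve_continuous f t -> curve_continuous (fun u => - f u)%C t.
Proof. apply (continuous_opp (V := C_R_NormedModule)). Qed.

Lemma curve_continuous_minus (f g : R -> C) (t : R) :
  curve_continuous f t -> curve_continuous g t -> curve_continuous (fun u => f u - g u)%C t.
Proof. apply (continuous_minus (V := C_R_NormedModule)). Qed.

Lemma curve_continuous_mult (f g : R -> C) (t : R) :
  curve_continuous f t -> curve_continuous g t -> curve_continuous (fun u => f u * g u)%C t.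
Proof.
intros Hf Hg.
pose proof (curve_continuous_Re _ _ Hf). pose proof (curve_continuous_Im _ _ Hf).
pose proof (curve_continuous_Re _ _ Hg). pose proof (curve_continuous_Im _ _ Hg).
apply curve_continuous_pair.
- apply (continuous_minus (V := R_NormedModule)
    (fun u => Re (f u) * Re (g u)) (fun u => Im (f u) * Im (g u)));
  apply (continuous_mult (K := R_AbsRing)); assumption.
- apply (continuous_plus (V := R_NormedModule)
    (fun u => Re (f u) * Im (g u)) (fun u => Im (f u) * Re (g u)));
  apply (continuous_mult (K := R_AbsRing)); assumption.
Qed.

Lemma is_Cderive_inv (z : C) : z <> RtoC 0 -> is_Cderive Cinv z (- / (z * z))%C.
Proof.
intros Hz. apply is_Cderive_eps. intros eps Heps.
assert (Hm : 0 < Cmod z) by (apply Cmod_gt_0; exact Hz).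
(* The first bound keeps [|z + h| >= |z| / 2]; the error is then at most [|h|^2 / (|z|^3 / 2)], and
   the second bound turns this into [eps |h|]. *)
exists (Rmin (Cmod z / 2) (eps * (Cmod z ^ 3 / 2))).
split. { apply Rmin_pos; [lra|]. apply Rmult_lt_0_compat; [lra|].
  assert (0 < Cmod z ^ 3) by (apply pow_lt; lra). lra. }
intros h Hh.
assert (H1 := Rlt_le_trans _ _ _ Hh (Rmin_l _ _)).
assert (H2 := Rlt_le_trans _ _ _ Hh (Rmin_r _ _)).
assert (H3 : Cmod z / 2 <= Cmod (z + h)%C) by (pose proof (Cmod_ge_sub z h); lra).
assert (Hzh : (z + h)%C <> RtoC 0).
{ apply Cmod_gt_0. lra. }
replace (/ (z + h) - / z - h * - / (z * z))%C with (h * h / ((z + h) * (z * z)))%C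
  by (field; split; assumption).
assert (Hden : ((z + h) * (z * z))%C <> RtoC 0).
{ repeat apply Cmult_neq_0; assumption. }
rewrite Cmod_div by exact Hden.
rewrite !Cmod_mult.
apply Rle_trans with (Cmod h * Cmod h / ((Cmod z / 2) * (Cmod z * Cmod z))).
- apply Rmult_le_compat_l. { pose proof (Cmod_ge_0 h). nra. }
  assert (0 < Cmod z * Cmod z) by nra.
  apply Rinv_le_contravar; [apply Rmult_lt_0_compat; lra|]. apply Rmult_le_compat_r; lra.
- replace (Cmod h * Cmod h / (Cmod z / 2 * (Cmod z * Cmod z)))
    with ((Cmod h / (Cmod z ^ 3 / 2)) * Cmod h) by (field; lra).
  apply Rmult_le_compat_r; [apply Cmod_ge_0|].
  assert (Hc : 0 < Cmod z ^ 3 / 2) by (assert (0 < Cmod z ^ 3) by (apply pow_lt; lra); lra).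
  apply Rmult_le_reg_r with (Cmod z ^ 3 / 2); [exact Hc|].
  unfold Rdiv at 1. rewrite Rmult_assoc, Rinv_l by lra. lra.
Qed.

Lemma curve_continuous_inv (f : R -> C) (t : R) :
  f t <> RtoC 0 -> curve_continuous f t -> curve_continuous (fun u => / f u)%C t.
Proof.
intros H. apply curve_continuous_comp. eexists. apply is_Cderive_inv. exact H.
Qed.

Lemma is_Cderive_mult (f g : C -> C) (z df dg : C) :
  is_Cderive f z df -> is_Cderive g z dg ->
  is_Cderive (fun w => f w * g w)%C z (df * g z + f z * dg)%C.
Proof.
intros Hf Hg.
assert (Hgl : exists del M : R, 0 < del /\ 0 < M /\
    forall w : C, Cmod (w - z)%C < del -> Cmod (g w - g z)%C <= M * Cmod (w - z)%C)
  by (apply Cderive_lipschitz; now exists dg).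
rewrite is_Cderive_eps in Hf, Hg |- *. intros eps Heps.
destruct Hgl as (d0 & M & Hd0 & HM & Hl).
set (A := Cmod (g z) + M * d0 + 1). set (B := Cmod (f z) + 1).
assert (HA : 0 < A) by (unfold A; pose proof (Cmod_ge_0 (g z)); nra).
assert (HB : 0 < B) by (unfold B; pose proof (Cmod_ge_0 (f z)); lra).
set (D := Cmod df + 1). assert (HD : 0 < D) by (unfold D; pose proof (Cmod_ge_0 df); lra).
destruct (Hf (eps / 3 / A)) as (d1 & Hd1 & H1).
{ repeat apply Rdiv_lt_0_compat; lra. }
destruct (Hg (eps / 3 / B)) as (d2 & Hd2 & H2).
{ repeat apply Rdiv_lt_0_compat; lra. }
exists (Rmin (Rmin d0 (eps / 3 / (D * M))) (Rmin d1 d2)).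
assert (Hdm : 0 < eps / 3 / (D * M)).
{ apply Rdiv_lt_0_compat; [lra|]. apply Rmult_lt_0_compat; lra. }
split. { repeat apply Rmin_pos; lra. }
intros h Hh.
assert (Ha := Rlt_le_trans _ _ _ Hh (Rmin_l _ _)).
assert (Hb := Rlt_le_trans _ _ _ Hh (Rmin_r _ _)).
assert (Ha1 := Rlt_le_trans _ _ _ Ha (Rmin_l _ _)).
assert (Ha2 := Rlt_le_trans _ _ _ Ha (Rmin_r _ _)).
assert (Hb1 := Rlt_le_trans _ _ _ Hb (Rmin_l _ _)).
assert (Hb2 := Rlt_le_trans _ _ _ Hb (Rmin_r _ _)).
specialize (H1 h Hb1). specialize (H2 h Hb2).
assert (Hg1 : Cmod (g (z + h) - g z)%C <= M * Cmod h).
{ specialize (Hl (z + h)%C). replace (z + h - z)%C with h in Hl by ring. apply Hl; exact Ha1. }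
assert (Hg2 : Cmod (g (z + h)%C) <= A).
{ replace (g (z + h)%C) with (g z + (g (z + h)%C - g z))%C by ring.
  eapply Rle_trans; [apply Cmod_triangle|]. unfold A.
  pose proof (Cmod_ge_0 h). nra. }
replace (f (z + h) * g (z + h) - f z * g z - h * (df * g z + f z * dg))%C
 with ((f (z + h) - f z - h * df) * g (z + h) + f z * (g (z + h) - g z - h * dg)
       + h * df * (g (z + h) - g z))%C by ring.
eapply Rle_trans; [apply Cmod_triangle|].
eapply Rle_trans; [apply Rplus_le_compat_r, Cmod_triangle|].
rewrite !Cmod_mult.
assert (P1 : Cmod (f (z + h) - f z - h * df)%C * Cmod (g (z + h)%C) <= eps / 3 * Cmod h).
{ apply Rle_trans with (eps / 3 / A * Cmod h * A).
  - apply Rmult_le_compat; try apply Cmod_ge_0; assumption.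
  - right. field. lra. }
assert (P2 : Cmod (f z) * Cmod (g (z + h) - g z - h * dg)%C <= eps / 3 * Cmod h).
{ apply Rle_trans with (B * (eps / 3 / B * Cmod h)).
  - apply Rmult_le_compat; try apply Cmod_ge_0; try assumption. unfold B; lra.
  - right. field. lra. }
assert (P3 : Cmod h * Cmod df * Cmod (g (z + h) - g z)%C <= eps / 3 * Cmod h).
{ apply Rle_trans with (Cmod h * D * (M * (eps / 3 / (D * M)))).
  - apply Rmult_le_compat; try apply Cmod_ge_0.
    + apply Rmult_le_pos; apply Cmod_ge_0.
    + apply Rmult_le_compat_l; [apply Cmod_ge_0|unfold D; lra].
    + eapply Rle_trans; [exact Hg1|]. apply Rmult_le_compat_l; lra.
  - right. field. lra. }
lra.
Qed.

Lemma is_Cderive_plus (f g : C -> C) (z df dg : C) :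
  is_Cderive f z df -> is_Cderive g z dg -> is_Cderive (fun w => f w + g w)%C z (df + dg)%C.
Proof. apply (is_derive_plus (K := C_AbsRing) (V := C_NormedModule)). Qed.

Lemma is_Cderive_minus (f g : C -> C) (z df dg : C) :
  is_Cderive f z df -> is_Cderive g z dg -> is_Cderive (fun w => f w - g w)%C z (df - dg)%C.
Proof. apply (is_derive_minus (K := C_AbsRing) (V := C_NormedModule)). Qed.

Lemma is_Cderive_const (c z : C) : is_Cderive (fun _ => c) z (RtoC 0).
Proof. apply (is_derive_const (K := C_AbsRing) (V := C_NormedModule)). Qed.

Lemma is_Cderive_id (z : C) : is_Cderive (fun w => w) z (RtoC 1).
Proof.
apply is_Cderive_eps. intros eps Heps. exists 1. split; [lra|].
intros h _. replace (z + h - z - h * 1)%C with (RtoC 0) by ring.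
rewrite Cmod_0. pose proof (Cmod_ge_0 h). nra.
Qed.

Lemma is_Cderive_comp (f g : C -> C) (z df dg : C) :
  is_Cderive f (g z) df -> is_Cderive g z dg -> is_Cderive (fun w => f (g w)) z (dg * df)%C.
Proof.
intros Hf Hg.
assert (Hgl : exists del M : R, 0 < del /\ 0 < M /\
    forall w : C, Cmod (w - z)%C < del -> Cmod (g w - g z)%C <= M * Cmod (w - z)%C)
  by (apply Cderive_lipschitz; now exists dg).
rewrite is_Cderive_eps in Hf, Hg |- *. intros eps Heps.
destruct Hgl as (d0 & M & Hd0 & HM & Hl).
set (D := Cmod df + 1). assert (HD : 0 < D) by (unfold D; pose proof (Cmod_ge_0 df); lra).
destruct (Hf (eps / 2 / M)) as (d1 & Hd1 & H1).
{ repeat apply Rdiv_lt_0_compat; lra. }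
destruct (Hg (eps / 2 / D)) as (d2 & Hd2 & H2).
{ repeat apply Rdiv_lt_0_compat; lra. }
exists (Rmin (Rmin d0 (d1 / M)) d2).
assert (Hdm : 0 < d1 / M) by (apply Rdiv_lt_0_compat; lra).
split. { repeat apply Rmin_pos; lra. }
intros h Hh.
assert (Ha := Rlt_le_trans _ _ _ Hh (Rmin_l _ _)).
assert (Hb := Rlt_le_trans _ _ _ Hh (Rmin_r _ _)).
assert (Ha1 := Rlt_le_trans _ _ _ Ha (Rmin_l _ _)).
assert (Ha2 := Rlt_le_trans _ _ _ Ha (Rmin_r _ _)).
specialize (H2 h Hb).
assert (Hg1 : Cmod (g (z + h) - g z)%C <= M * Cmod h).
{ specialize (Hl (z + h)%C). replace (z + h - z)%C with h in Hl by ring. apply Hl; exact Ha1. }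
assert (Hk : Cmod (g (z + h) - g z)%C < d1).
{ eapply Rle_lt_trans; [exact Hg1|].
  apply Rlt_le_trans with (M * (d1 / M)); [apply Rmult_lt_compat_l; assumption|].
  right; field; lra. }
specialize (H1 _ Hk).
replace (g z + (g (z + h) - g z))%C with (g (z + h)%C) in H1 by ring.
replace (f (g (z + h)) - f (g z) - h * (dg * df))%C
 with ((f (g (z + h)) - f (g z) - (g (z + h) - g z) * df)
   + (g (z + h) - g z - h * dg) * df)%C by ring.
eapply Rle_trans; [apply Cmod_triangle|]. rewrite Cmod_mult.
assert (P1 : eps / 2 / M * Cmod (g (z + h) - g z)%C <= eps / 2 * Cmod h).
{ apply Rle_trans with (eps / 2 / M * (M * Cmod h)).
  - apply Rmult_le_compat_l; [|exact Hg1]. left. repeat apply Rdiv_lt_0_compat; lra.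
  - right. field. lra. }
assert (P2 : Cmod (g (z + h) - g z - h * dg)%C * Cmod df <= eps / 2 * Cmod h).
{ apply Rle_trans with (eps / 2 / D * Cmod h * D).
  - apply Rmult_le_compat; try apply Cmod_ge_0; try assumption. unfold D; lra.
  - right. field. lra. }
lra.
Qed.

Lemma Cderivable_mult (f g : C -> C) (z : C) :
  Cderivable f z -> Cderivable g z -> Cderivable (fun w => f w * g w)%C z.
Proof. intros [df Hf] [dg Hg]. eexists. apply is_Cderive_mult; eassumption. Qed.

Lemma Cderivable_plus (f g : C -> C) (z : C) :
  Cderivable f z -> Cderivable g z -> Cderivable (fun w => f w + g w)%C z.
Proof. intros [df Hf] [dg Hg]. eexists. apply is_Cderive_plus; eassumption. Qed.

Lemma Cderivable_minus (f g : C -> C) (z : C) :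
  Cderivable f z -> Cderivable g z -> Cderivable (fun w => f w - g w)%C z.
Proof. intros [df Hf] [dg Hg]. eexists. apply is_Cderive_minus; eassumption. Qed.

Lemma Cderivable_const (c z : C) : Cderivable (fun _ => c) z.
Proof. eexists. apply is_Cderive_const. Qed.

Lemma Cderivable_id (z : C) : Cderivable (fun w => w) z.
Proof. eexists. apply is_Cderive_id. Qed.

Lemma Cderivable_comp (f g : C -> C) (z : C) :
  Cderivable f (g z) -> Cderivable g z -> Cderivable (fun w => f (g w)) z.
Proof. intros [df Hf] [dg Hg]. eexists. apply is_Cderive_comp; eassumption. Qed.

Lemma Cderivable_div (f g : C -> C) (z : C) :
  Cderivable f z -> Cderivable g z -> g z <> RtoC 0 -> Cderivable (fun w => f w / g w)%C z.
Proof.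
intros Hf Hg H. apply Cderivable_mult; [exact Hf|].
apply Cderivable_comp; [|exact Hg]. eexists. apply is_Cderive_inv. exact H.
Qed.

Lemma Cderivable_ext (f g : C -> C) (z : C) :
  (forall w, f w = g w) -> Cderivable f z -> Cderivable g z.
Proof. intros H. apply ex_derive_ext. exact H. Qed.

Lemma Cderivable_ext_near (f g : C -> C) (z : C) (del : R) :
  0 < del -> (forall w, Cmod (w - z)%C < del -> f w = g w) -> Cderivable f z -> Cderivable g z.
Proof.
intros Hd H. apply ex_derive_ext_loc. exists (mkposreal del Hd).
intros w Hw. apply H. exact Hw.
Qed.

(** * The complex exponential *)

Lemma C_eq (a b : C) : Re a = Re b -> Im a = Im b -> a = b.
Proof. destruct a, b; simpl. now intros -> ->. Qed.

Lemma Cexp_plus (a b : C) : Cexp (a + b)%C = (Cexp a * Cexp b)%C.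
Proof.
unfold Cexp. rewrite re_plus, im_plus, exp_plus, cos_plus, sin_plus.
apply C_eq; simpl; ring.
Qed.

Lemma Cexp_0 : Cexp 0 = 1.
Proof. unfold Cexp; simpl. rewrite exp_0, cos_0, sin_0. apply C_eq; simpl; ring. Qed.

Lemma Cmod_Cexp (z : C) : Cmod (Cexp z) = exp (Re z).
Proof.
unfold Cexp, Cmod; simpl.
replace (exp (Re z) * cos (Im z) * (exp (Re z) * cos (Im z) * 1) +
   exp (Re z) * sin (Im z) * (exp (Re z) * sin (Im z) * 1))
  with ((exp (Re z))² * ((sin (Im z))² + (cos (Im z))²)) by (unfold Rsqr; ring).
rewrite sin2_cos2, Rmult_1_r. apply sqrt_Rsqr. left; apply exp_pos.
Qed.

Lemma Cexp_neq_0 (z : C) : Cexp z <> RtoC 0.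
Proof. apply Cmod_gt_0. rewrite Cmod_Cexp. apply exp_pos. Qed.

Lemma Cexp_opp (z : C) : Cexp (- z)%C = (/ Cexp z)%C.
Proof.
assert (H : (Cexp (- z) * Cexp z)%C = 1).
{ rewrite <- Cexp_plus. replace (- z + z)%C with (RtoC 0) by ring. apply Cexp_0. }
pose proof (Cexp_neq_0 z).
replace (Cexp (- z)%C) with (Cexp (- z) * Cexp z / Cexp z)%C by (field; assumption).
rewrite H. field. assumption.
Qed.

Lemma Cexp_RtoC (x : R) : Cexp (RtoC x) = RtoC (exp x).
Proof. unfold Cexp; simpl. rewrite cos_0, sin_0. apply C_eq; simpl; ring. Qed.

Lemma Cexp_nat (n : nat) (z : C) : Cexp (RtoC (INR n) * z)%C = (Cexp z ^ n)%C.
Proof.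
induction n.
- simpl. rewrite <- Cexp_0. f_equal. ring.
- rewrite S_INR, RtoC_plus, Cpow_S, <- IHn, <- Cexp_plus. f_equal. ring.
Qed.

(** For [a >= 0], multiply [1 - a <= exp (-a)] by [exp a]; the second-order bound below uses the
    same trick. *)
Lemma exp_minus_1_bound (a : R) : Rabs (exp a - 1) <= Rabs a * exp (Rabs a).
Proof.
destruct (Rle_lt_dec 0 a).
- rewrite (Rabs_pos_eq a) by assumption. rewrite Rabs_pos_eq.
  + pose proof (exp_ineq1_le (- a)). rewrite exp_Ropp in H.
    pose proof (exp_pos a).
    assert (exp a * (1 + - a) <= exp a * / exp a) by (apply Rmult_le_compat_l; lra).
    rewrite Rinv_r in H1 by lra. lra.
  + pose proof (exp_ineq1_le a). lra.
- rewrite (Rabs_left a) by assumption. rewrite Rabs_left1.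
  + pose proof (exp_ineq1_le a). pose proof (exp_ineq1_le (- a)). nra.
  + pose proof (exp_increasing a 0 r). rewrite exp_0 in H. lra.
Qed.

Lemma exp_Rabs_ge_1 (a : R) : 1 <= exp (Rabs a).
Proof. pose proof (exp_ineq1_le (Rabs a)). pose proof (Rabs_pos a). lra. Qed.

Lemma exp_taylor2_bound (a : R) : Rabs (exp a - 1 - a) <= a * a * exp (Rabs a).
Proof.
assert (H0 : 0 <= exp a - 1 - a) by (pose proof (exp_ineq1_le a); lra).
rewrite Rabs_pos_eq by exact H0.
pose proof (exp_Rabs_ge_1 a).
destruct (Rle_lt_dec 0 a).
- rewrite (Rabs_pos_eq a) by assumption.
  pose proof (exp_ineq1_le (- a)). rewrite exp_Ropp in H1.
  pose proof (exp_pos a).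
  assert (exp a * (1 + - a) <= exp a * / exp a) by (apply Rmult_le_compat_l; lra).
  rewrite Rinv_r in H3 by lra. nra.
- pose proof (exp_ineq1_le (- a)). rewrite exp_Ropp in H1.
  pose proof (exp_pos a).
  assert (H3 : exp a * (1 + - a) <= exp a * / exp a) by (apply Rmult_le_compat_l; lra).
  rewrite Rinv_r in H3 by lra.
  assert (exp a - 1 <= a * exp a) by lra.
  assert (exp a - 1 - a <= a * (exp a - 1)) by lra.
  pose proof (exp_ineq1_le a).
  assert (a * (exp a - 1) <= a * a) by nra. nra.
Qed.

Lemma Rabs_sin_le (b : R) : Rabs (sin b) <= Rabs b.
Proof.
destruct (Req_dec b 0) as [->|Hb]. { rewrite sin_0, Rabs_R0; lra. }
destruct (MVT_gen sin 0 b cos) as [c [_ Hc]].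
- intros; apply is_derive_sin.
- intros. apply continuity_pt_filterlim. apply continuous_sin.
- rewrite sin_0, !Rminus_0_r in Hc. rewrite Hc, Rabs_mult.
  pose proof (Rabs_pos b). pose proof (COS_bound c).
  assert (Rabs (cos c) <= 1) by (apply Rabs_le; lra). nra.
Qed.

Lemma Rabs_cos_minus_1_le (b : R) : Rabs (cos b - 1) <= b * b.
Proof.
replace b with (2 * (b / 2)) at 1 by field.
rewrite cos_2a_sin.
replace (1 - 2 * sin (b / 2) * sin (b / 2) - 1) with (- (2 * (sin (b/2) * sin (b / 2)))) by ring.
rewrite Rabs_Ropp, Rabs_mult, Rabs_mult, (Rabs_pos_eq 2) by lra.
pose proof (Rabs_sin_le (b / 2)). pose proof (Rabs_pos (sin (b / 2))).
assert (Rabs (b/2) * Rabs (b/2) = b * b / 4).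
{ rewrite <- Rabs_mult, Rabs_pos_eq by nra. field. }
nra.
Qed.

(** The mean value theorem leaves [|cos c - 1| |b|], which is at most [|b|^3] and suffices for
    [|b| <= 1]; for larger [b] linear bounds are enough. *)
Lemma Rabs_sin_minus_le (b : R) : Rabs (sin b - b) <= b * b.
Proof.
destruct (MVT_gen (fun x => sin x - x) 0 b (fun x => cos x - 1)) as [c [Hc1 Hc]].
- intros. auto_derive; [exact I|ring].
- intros. apply continuity_pt_minus; [apply continuity_sin|apply continuity_pt_id].
- rewrite sin_0, !Rminus_0_r in Hc. rewrite Hc, Rabs_mult.
  destruct (Rle_lt_dec (Rabs b) 1) as [H|H].
  + assert (Hcb : Rabs c <= Rabs b).
    { unfold Rmin, Rmax in Hc1. destruct (Rle_dec 0 b).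
      - rewrite !Rabs_pos_eq by lra. lra.
      - rewrite !Rabs_left1 by lra. lra. }
    pose proof (Rabs_cos_minus_1_le c).
    assert (c * c <= b * b).
    { rewrite <- (Rabs_pos_eq (c * c)), <- (Rabs_pos_eq (b * b)), !Rabs_mult by nra.
      apply Rmult_le_compat; try apply Rabs_pos; assumption. }
    assert (E : b * b = Rabs b * Rabs b) by (rewrite <- Rabs_mult, Rabs_pos_eq; nra).
    pose proof (Rabs_pos b). pose proof (Rabs_pos (cos c - 1)). nra.
  + assert (E : b * b = Rabs b * Rabs b) by (rewrite <- Rabs_mult, Rabs_pos_eq; nra).
    rewrite E. rewrite <- Rabs_mult, <- Hc.
    destruct (Rle_lt_dec 2 (Rabs b)).
    * unfold Rminus. eapply Rle_trans; [apply Rabs_triang|]. rewrite Rabs_Ropp.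
      pose proof (Rabs_sin_le b). nra.
    * rewrite Hc, Rabs_mult.
      assert (Rabs c <= Rabs b).
    { unfold Rmin, Rmax in Hc1. destruct (Rle_dec 0 b).
      - rewrite !Rabs_pos_eq by lra. lra.
      - rewrite !Rabs_left1 by lra. lra. }
      assert (Hcos : Rabs (cos c - 1) <= Rabs b).
      { replace c with (2 * (c / 2)) by field. rewrite cos_2a_sin.
        replace (1 - 2 * sin (c / 2) * sin (c / 2) - 1)
          with (- (2 * (sin (c/2) * sin (c / 2)))) by ring.
        rewrite Rabs_Ropp, Rabs_mult, Rabs_mult, (Rabs_pos_eq 2) by lra.
        pose proof (Rabs_sin_le (c / 2)). pose proof (Rabs_pos (sin (c / 2))).
        pose proof (SIN_bound (c / 2)).
        assert (Rabs (sin (c/2)) <= 1) by (apply Rabs_le; lra).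
        assert (Rabs (c / 2) = Rabs c / 2).
        { unfold Rdiv. rewrite Rabs_mult, (Rabs_pos_eq (/2)) by lra. reflexivity. }
        nra. }
      pose proof (Rabs_pos b). nra.
Qed.

(** The bound is global in [w] because it is used with [w = h ln t] for all [t > 0]. Real and
    imaginary part contribute [2 m^2 exp m] each, and 4 is rounded up to 5. *)
Lemma Cexp_taylor2_bound (w : C) :
  Cmod (Cexp w - 1 - w)%C <= 5 * (Cmod w * Cmod w) * exp (Cmod w).
Proof.
destruct w as [a b].
pose proof (re_le_Cmod (a, b)) as Ha. pose proof (im_le_Cmod (a, b)) as Hb. simpl in Ha, Hb.
set (m := Cmod (a, b)) in *. assert (Hm : 0 <= m) by apply Cmod_ge_0.
eapply Rle_trans; [apply Cmod_ReIm|]. simpl.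
assert (He : exp (Rabs a) <= exp m).
{ destruct Ha as [Ha| ->]; [left; apply exp_increasing; exact Ha|right; reflexivity]. }
assert (H1 : 1 <= exp m) by (pose proof (exp_ineq1_le m); lra).
assert (Hea : exp a <= exp m).
{ pose proof (Rle_abs a). destruct (Rle_lt_or_eq_dec a m) as [H2|E]; [lra| |rewrite E; right; reflexivity].
  left; apply exp_increasing; exact H2. }
assert (Haa : a * a <= m * m).
{ rewrite <- (Rabs_pos_eq (a * a)), Rabs_mult by nra.
  apply Rmult_le_compat; try apply Rabs_pos; assumption. }
assert (Hbb : b * b <= m * m).
{ rewrite <- (Rabs_pos_eq (b * b)), Rabs_mult by nra.
  apply Rmult_le_compat; try apply Rabs_pos; assumption. }
assert (Hmm : 0 <= m * m) by nra.
assert (R1 : Rabs (exp a * cos b + - (1) + - a) <= 2 * (m * m) * exp m).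
{ replace (exp a * cos b + - (1) + - a) with ((exp a - 1 - a) + exp a * (cos b - 1)) by ring.
  eapply Rle_trans; [apply Rabs_triang|]. rewrite Rabs_mult, (Rabs_pos_eq (exp a)) by (left; apply exp_pos).
  pose proof (exp_taylor2_bound a). pose proof (Rabs_cos_minus_1_le b).
  assert (a * a * exp (Rabs a) <= m * m * exp m).
  { apply Rmult_le_compat; try nra; try assumption. left; apply exp_pos. }
  assert (exp a * Rabs (cos b - 1) <= exp m * (m * m)).
  { apply Rmult_le_compat; try assumption; try apply Rabs_pos; [left; apply exp_pos|lra]. }
  lra. }
assert (R2 : Rabs (exp a * sin b + - 0 + - b) <= 2 * (m * m) * exp m).
{ replace (exp a * sin b + - 0 + - b) with ((exp a - 1) * sin b + (sin b - b)) by ring.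
  eapply Rle_trans; [apply Rabs_triang|]. rewrite Rabs_mult.
  pose proof (exp_minus_1_bound a). pose proof (Rabs_sin_le b). pose proof (Rabs_sin_minus_le b).
  assert (Rabs a * exp (Rabs a) <= m * exp m).
  { apply Rmult_le_compat; try assumption; [apply Rabs_pos|left; apply exp_pos]. }
  assert (Rabs (exp a - 1) * Rabs (sin b) <= m * exp m * m).
  { apply Rmult_le_compat; try apply Rabs_pos; lra. }
  nra. }
apply Rle_trans with (2 * (m * m) * exp m + 2 * (m * m) * exp m).
- apply Rplus_le_compat; assumption.
- assert (0 <= m * m * exp m) by (apply Rmult_le_pos; lra). lra.
Qed.

Lemma is_Cderive_Cexp (z : C) : is_Cderive Cexp z (Cexp z).
Proof.
apply is_Cderive_eps. intros eps Heps.
set (K := Cmod (Cexp z) * (5 * exp 1)).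
assert (HK : 0 < K).
{ unfold K. rewrite Cmod_Cexp. pose proof (exp_pos (Re z)). pose proof (exp_pos 1). nra. }
exists (Rmin 1 (eps / K)). split. { apply Rmin_pos; [lra|]. apply Rdiv_lt_0_compat; assumption. }
intros h Hh.
assert (H1 := Rlt_le_trans _ _ _ Hh (Rmin_l _ _)).
assert (H2 := Rlt_le_trans _ _ _ Hh (Rmin_r _ _)).
rewrite Cexp_plus.
replace (Cexp z * Cexp h - Cexp z - h * Cexp z)%C with (Cexp z * (Cexp h - 1 - h))%C by ring.
rewrite Cmod_mult.
pose proof (Cexp_taylor2_bound h) as Hb. pose proof (Cmod_ge_0 h).
assert (He : exp (Cmod h) <= exp 1) by (left; apply exp_increasing; exact H1).
assert (Hb' : Cmod (Cexp h - 1 - h)%C <= 5 * exp 1 * Cmod h * Cmod h).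
{ eapply Rle_trans; [exact Hb|].
  replace (5 * exp 1 * Cmod h * Cmod h) with (5 * (Cmod h * Cmod h) * exp 1) by ring.
  apply Rmult_le_compat_l; nra. }
apply Rle_trans with (K * Cmod h * Cmod h).
- unfold K. replace (Cmod (Cexp z) * (5 * exp 1) * Cmod h * Cmod h) with
    (Cmod (Cexp z) * (5 * exp 1 * Cmod h * Cmod h)) by ring.
  apply Rmult_le_compat_l; [apply Cmod_ge_0|exact Hb'].
- apply Rmult_le_compat_r; [assumption|].
  apply Rle_trans with (K * (eps / K)); [apply Rmult_le_compat_l; lra|]. right; field; lra.
Qed.

Lemma Cderivable_Cexp (z : C) : Cderivable Cexp z.
Proof. eexists. apply is_Cderive_Cexp. Qed.

(** * Complex powers of positive reals *)

Lemma cpow_plus (t : R) (a b : C) : cpow t (a + b)%C = (cpow t a * cpow t b)%C.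
Proof. unfold cpow. rewrite <- Cexp_plus. f_equal. ring. Qed.

Lemma cpow_neq_0 (t : R) (s : C) : cpow t s <> RtoC 0.
Proof. apply Cexp_neq_0. Qed.

Lemma cpow_opp (t : R) (s : C) : cpow t (- s)%C = (/ cpow t s)%C.
Proof. unfold cpow. rewrite <- Cexp_opp. f_equal. ring. Qed.

Lemma Cmod_cpow (t : R) (s : C) : Cmod (cpow t s) = Rpower t (Re s).
Proof.
unfold cpow. rewrite Cmod_Cexp, re_scal_r. reflexivity.
Qed.

Lemma cpow_RtoC (t a : R) : cpow t (RtoC a) = RtoC (Rpower t a).
Proof. unfold cpow. rewrite <- RtoC_mult. apply Cexp_RtoC. Qed.

Lemma cpow_INR (t : R) (n : nat) : 0 < t -> cpow t (RtoC (INR n)) = RtoC (t ^ n).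
Proof. intros H. rewrite cpow_RtoC, Rpower_pow by exact H. reflexivity. Qed.

Lemma cpow_0 (t : R) : cpow t 0 = 1.
Proof. unfold cpow. rewrite Cmult_0_l. apply Cexp_0. Qed.

Lemma cpow_1 (t : R) : 0 < t -> cpow t 1 = RtoC t.
Proof. intros H. rewrite cpow_RtoC, Rpower_1 by exact H. reflexivity. Qed.

Lemma cpow_base_mult (a b : R) (s : C) :
  0 < a -> 0 < b -> cpow (a * b) s = (cpow a s * cpow b s)%C.
Proof.
intros Ha Hb. unfold cpow. rewrite ln_mult by assumption.
rewrite RtoC_plus, <- Cexp_plus. f_equal. ring.
Qed.

Lemma cpow_minus_1 (t : R) (s : C) : 0 < t -> cpow t s = (cpow t (s - 1) * RtoC t)%C.
Proof.
intros H. rewrite <- (cpow_1 t H). rewrite <- cpow_plus. f_equal. ring.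
Qed.

Lemma Cderivable_cpow (t : R) (s : C) : Cderivable (fun s => cpow t s) s.
Proof.
unfold cpow. apply Cderivable_comp; [apply Cderivable_Cexp|].
apply Cderivable_mult; [apply Cderivable_id|apply Cderivable_const].
Qed.

(** * Differentiable curves *)

Lemma is_curve_derive_eps (f : R -> C) (t : R) (l : C) :
  is_curve_derive f t l <->
  (forall eps : R, 0 < eps -> exists del : R, 0 < del /\
    forall h : R, Rabs h < del -> Cmod (f (t + h)%R - f t - RtoC h * l)%C <= eps * Rabs h).
Proof.
split.
- intros [_ H] eps Heps.
  destruct (H t (fun P HP => HP) (mkposreal eps Heps)) as [del Hd].
  exists del. split; [apply cond_pos |].
  intros h Hh.
  assert (Hb : ball (M := R_UniformSpace) t del (t + h)).
  { change (Rabs (t + h - t) < del). replace (t + h - t) with h by ring. exact Hh. }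
  specialize (Hd _ Hb). cbv beta in Hd.
  rewrite norm_C_R in Hd.
  change (norm (minus (t + h) t)) with (Rabs (t + h - t)) in Hd.
  change (scal (minus (t + h) t) l) with (scal (V := C_R_ModuleSpace) (t + h - t) l) in Hd.
  rewrite scal_R_Cmult in Hd.
  replace (t + h - t) with h in Hd by ring. exact Hd.
- intros H. split.
  + apply is_linear_scal_l.
  + intros x Hx.
    assert (Hzx : t = x).
    { apply (is_filter_lim_locally_unique (V := R_NormedModule)). exact Hx. }
    subst x. intros eps.
    destruct (H eps (cond_pos eps)) as [del [Hdel Hd]].
    exists (mkposreal del Hdel). intros y Hy.
    change (Rabs (y - t) < del) in Hy.
    specialize (Hd _ Hy). rewrite norm_C_R.
    change (norm (minus y t)) with (Rabs (y - t)).
    change (scal (minus y t) l) with (scal (V := C_R_ModuleSpace) (y - t) l).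
    rewrite scal_R_Cmult.
    assert (E : forall a b : R, a + (b - a) = b) by (intros; ring).
    rewrite E in Hd. exact Hd.
Qed.

Lemma is_curve_derive_pair (f : R -> C) (t : R) (l : C) :
  is_derive (fun u => Re (f u)) t (Re l) -> is_derive (fun u => Im (f u)) t (Im l) ->
  is_curve_derive f t l.
Proof.
intros H1 H2. apply is_curve_derive_eps. intros eps Heps.
assert (He : 0 < eps / 2) by lra.
destruct H1 as [_ H1]. destruct H2 as [_ H2].
destruct (H1 t (fun P HP => HP) (mkposreal _ He)) as [d1 Hd1].
destruct (H2 t (fun P HP => HP) (mkposreal _ He)) as [d2 Hd2].
exists (Rmin d1 d2). split; [apply Rmin_pos; apply cond_pos|].
intros h Hh.
assert (Ha := Rlt_le_trans _ _ _ Hh (Rmin_l _ _)).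
assert (Hb := Rlt_le_trans _ _ _ Hh (Rmin_r _ _)).
assert (B1 : ball (M := R_UniformSpace) t d1 (t + h)).
{ change (Rabs (t + h - t) < d1). replace (t + h - t) with h by ring. exact Ha. }
assert (B2 : ball (M := R_UniformSpace) t d2 (t + h)).
{ change (Rabs (t + h - t) < d2). replace (t + h - t) with h by ring. exact Hb. }
specialize (Hd1 _ B1). specialize (Hd2 _ B2).
change (Rabs (Re (f (t + h)%R) - Re (f t) - (t + h - t) * Re l) <= eps / 2 * Rabs (t + h - t)) in Hd1.
change (Rabs (Im (f (t + h)%R) - Im (f t) - (t + h - t) * Im l) <= eps / 2 * Rabs (t + h - t)) in Hd2.
replace (t + h - t) with h in Hd1, Hd2 by ring.
eapply Rle_trans; [apply Cmod_ReIm|].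
unfold Cminus. rewrite !re_plus, !im_plus, !re_opp, !im_opp, re_scal_l, im_scal_l.
unfold Rminus in Hd1, Hd2. lra.
Qed.

Lemma is_curve_derive_RtoC (f : R -> R) (t l : R) :
  is_derive f t l -> is_curve_derive (fun u => RtoC (f u)) t (RtoC l).
Proof.
intros H. apply is_curve_derive_pair; simpl; [exact H|].
apply (is_derive_const (K := R_AbsRing) (V := R_NormedModule)).
Qed.

Lemma is_curve_derive_comp (g : C -> C) (f : R -> C) (t : R) (dg df : C) :
  is_Cderive g (f t) dg -> is_curve_derive f t df ->
  is_curve_derive (fun u => g (f u)) t (df * dg)%C.
Proof.
intros Hg Hf.
rewrite is_Cderive_eps in Hg. rewrite is_curve_derive_eps in Hf |- *. intros eps Heps.
set (D := Cmod dg + 1). assert (HD : 0 < D) by (unfold D; pose proof (Cmod_ge_0 dg); lra).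
set (M := Cmod df + 1). assert (HM : 0 < M) by (unfold M; pose proof (Cmod_ge_0 df); lra).
destruct (Hf 1) as (d0 & Hd0 & H0); [lra|].
destruct (Hg (eps / 2 / M)) as (d1 & Hd1 & H1).
{ repeat apply Rdiv_lt_0_compat; lra. }
destruct (Hf (eps / 2 / D)) as (d2 & Hd2 & H2).
{ repeat apply Rdiv_lt_0_compat; lra. }
exists (Rmin (Rmin d0 (d1 / M)) d2).
assert (Hdm : 0 < d1 / M) by (apply Rdiv_lt_0_compat; lra).
split. { repeat apply Rmin_pos; lra. }
intros h Hh.
assert (Ha := Rlt_le_trans _ _ _ Hh (Rmin_l _ _)).
assert (Hb := Rlt_le_trans _ _ _ Hh (Rmin_r _ _)).
assert (Ha1 := Rlt_le_trans _ _ _ Ha (Rmin_l _ _)).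
assert (Ha2 := Rlt_le_trans _ _ _ Ha (Rmin_r _ _)).
specialize (H2 h Hb). specialize (H0 h Ha1).
assert (Hg1 : Cmod (f (t + h)%R - f t)%C <= M * Rabs h).
{ replace (f (t + h)%R - f t)%C with ((f (t + h)%R - f t - h * df) + h * df)%C by ring.
  eapply Rle_trans; [apply Cmod_triangle|]. rewrite Cmod_mult, Cmod_R. unfold M. lra. }
assert (Hk : Cmod (f (t + h)%R - f t)%C < d1).
{ eapply Rle_lt_trans; [exact Hg1|].
  apply Rlt_le_trans with (M * (d1 / M)); [apply Rmult_lt_compat_l; assumption|].
  right; field; lra. }
specialize (H1 _ Hk).
replace (f t + (f (t + h)%R - f t))%C with (f (t + h)%R) in H1 by ring.
replace (g (f (t + h)%R) - g (f t) - h * (df * dg))%C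
 with ((g (f (t + h)%R) - g (f t) - (f (t + h)%R - f t) * dg)
   + (f (t + h)%R - f t - h * df) * dg)%C by ring.
eapply Rle_trans; [apply Cmod_triangle|]. rewrite Cmod_mult.
assert (P1 : eps / 2 / M * Cmod (f (t + h)%R - f t)%C <= eps / 2 * Rabs h).
{ apply Rle_trans with (eps / 2 / M * (M * Rabs h)).
  - apply Rmult_le_compat_l; [|exact Hg1]. left. repeat apply Rdiv_lt_0_compat; lra.
  - right. field. lra. }
assert (P2 : Cmod (f (t + h)%R - f t - h * df)%C * Cmod dg <= eps / 2 * Rabs h).
{ apply Rle_trans with (eps / 2 / D * Rabs h * D).
  - apply Rmult_le_compat; try apply Cmod_ge_0; try assumption. unfold D; lra.
  - right. field. lra. }
lra.
Qed.

Lemma is_curve_derive_plus (f g : R -> C) (t : R) (df dg : C) :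
  is_curve_derive f t df -> is_curve_derive g t dg ->
  is_curve_derive (fun u => f u + g u)%C t (df + dg)%C.
Proof. apply (is_derive_plus (K := R_AbsRing) (V := C_R_NormedModule)). Qed.

Lemma is_curve_derive_scal (c : C) (f : R -> C) (t : R) (df : C) :
  is_curve_derive f t df -> is_curve_derive (fun u => c * f u)%C t (c * df)%C.
Proof.
intros H. replace (c * df)%C with (df * c)%C by ring.
apply (is_curve_derive_comp (fun w => c * w)%C); [|exact H].
pose proof (is_Cderive_mult (fun _ => c) (fun w => w) (f t) _ _
  (is_Cderive_const _ _) (is_Cderive_id _)) as H0.
cbv beta in H0. replace (0 * f t + c * 1)%C with c in H0 by ring. exact H0.
Qed.

Lemma is_curve_derive_const (c : C) (t : R) : is_curve_derive (fun _ => c) t (RtoC 0).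
Proof. apply (is_derive_const (K := R_AbsRing) (V := C_R_NormedModule)). Qed.

Lemma is_curve_derive_mult (f g : R -> C) (t : R) (df dg : C) :
  is_curve_derive f t df -> is_curve_derive g t dg ->
  is_curve_derive (fun u => f u * g u)%C t (df * g t + f t * dg)%C.
Proof.
intros Hf Hg.
(* polarization reduces products to squares *)
assert (Hsq : forall h dh, is_curve_derive h t dh ->
  is_curve_derive (fun u => h u * h u)%C t (dh * (2 * h t))%C).
{ intros h dh Hh. apply (is_curve_derive_comp (fun w => w * w)%C); [|exact Hh].
  replace (2 * h t)%C with (1 * h t + h t * 1)%C by ring.
  apply (is_Cderive_mult (fun w => w) (fun w => w)); apply is_Cderive_id. }
eapply (is_derive_ext (V := C_R_NormedModule)
  (fun u => (/ 4) * ((f u + g u) * (f u + g u)) + (- / 4) * ((f u + - (1) * g u) * (f u + - (1) * g u)))%C).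
{ intros u. simpl. field. }
replace (df * g t + f t * dg)%C with
 ((/ 4) * ((df + dg) * (2 * (f t + g t))) + (- / 4) * ((df + - (1) * dg) * (2 * (f t + - (1) * g t))))%C
 by field.
apply is_curve_derive_plus; apply is_curve_derive_scal; apply Hsq;
 apply is_curve_derive_plus; try apply is_curve_derive_scal; assumption.
Qed.

Lemma curve_derive_continuous (f : R -> C) (t : R) (l : C) :
  is_curve_derive f t l -> curve_continuous f t.
Proof. intros H. apply (ex_derive_continuous (V := C_R_NormedModule)). now exists l. Qed.

Lemma is_curve_derive_cpow (t : R) (s : C) :
  0 < t -> is_curve_derive (fun u => cpow u s) t (s * cpow t (s - 1))%C.
Proof.
intros Ht. unfold cpow at 1.
replace (s * cpow t (s - 1))%C with (s * RtoC (/ t) * Cexp (s * RtoC (ln t)))%C.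
- apply (is_curve_derive_comp Cexp); [apply is_Cderive_Cexp|].
  apply is_curve_derive_scal, is_curve_derive_RtoC.
  apply is_derive_Reals. apply derivable_pt_lim_ln. exact Ht.
- change (Cexp (s * RtoC (ln t))%C) with (cpow t s).
  rewrite (cpow_minus_1 t s Ht), RtoC_inv by lra. field.
  intros E. apply RtoC_inj in E. lra.
Qed.

Lemma curve_continuous_cpow (t : R) (s : C) : 0 < t -> curve_continuous (fun u => cpow u s) t.
Proof. intros H. eapply curve_derive_continuous, is_curve_derive_cpow, H. Qed.

(** * Integrals of complex-valued functions *)

(** The scalars of [C_R_NormedModule] are real, so a complex factor is handled through
    components. *)
Lemma is_CRInt_scal (c : C) (f : R -> C) (a b : R) (l : C) :
  is_CRInt f a b l -> is_CRInt (fun t => c * f t)%C a b (c * l)%C.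
Proof.
intros H.
pose proof (is_RInt_fct_extend_fst (U := R_NormedModule) (V := R_NormedModule) f a b l H) as H1.
pose proof (is_RInt_fct_extend_snd (U := R_NormedModule) (V := R_NormedModule) f a b l H) as H2.
apply (is_RInt_fct_extend_pair (U := R_NormedModule) (V := R_NormedModule)
  (fun t => c * f t)%C a b (Re c * Re l - Im c * Im l) (Re c * Im l + Im c * Re l)).
- apply (is_RInt_minus (V := R_NormedModule) (fun t => Re c * Re (f t)) (fun t => Im c * Im (f t)));
  apply (is_RInt_scal (V := R_NormedModule)); assumption.
- apply (is_RInt_plus (V := R_NormedModule) (fun t => Re c * Im (f t)) (fun t => Im c * Re (f t)));
  apply (is_RInt_scal (V := R_NormedModule)); assumption.
Qed.

Lemma is_CRInt_RtoC (f : R -> R) (a b l : R) :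
  is_RInt f a b l -> is_CRInt (fun t => RtoC (f t)) a b (RtoC l).
Proof.
intros H.
apply (is_RInt_fct_extend_pair (U := R_NormedModule) (V := R_NormedModule)); simpl; [exact H|].
pose proof (is_RInt_const (V := R_NormedModule) a b 0) as H0.
change (scal (b - a) 0) with ((b - a) * 0) in H0. rewrite Rmult_0_r in H0. exact H0.
Qed.

Lemma is_CRInt_derive (f df : R -> C) (a b : R) :
  (forall t, Rmin a b <= t <= Rmax a b -> is_curve_derive f t (df t)) ->
  (forall t, Rmin a b <= t <= Rmax a b -> curve_continuous df t) ->
  is_CRInt df a b (f b - f a)%C.
Proof. apply (is_RInt_derive (V := C_R_CompleteNormedModule)). Qed.

Lemma is_CRInt_norm_const (f : R -> C) (a b M : R) (l : C) :
  a <= b -> (forall t, a <= t <= b -> Cmod (f t) <= M) -> is_CRInt f a b l ->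
  Cmod l <= (b - a) * M.
Proof.
intros Hab HM H. rewrite <- norm_C_R.
apply (norm_RInt_le_const (V := C_R_NormedModule) f a b l M Hab); [|exact H].
intros t Ht. rewrite norm_C_R. apply HM. exact Ht.
Qed.

(** * Improper integrals *)

(* Treats the ranges (0,oo), (0,y] and [y,oo) at once. *)
Record positive_range (Fa Fb : (R -> Prop) -> Prop) (D : R -> Prop) : Prop := {
  range_proper_l : ProperFilter Fa;
  range_proper_r : ProperFilter Fb;
  range_l : Fa D;
  range_r : Fb D;
  range_convex : forall x y z, D x -> D z -> x <= y <= z -> D y;
  range_order : filter_prod Fa Fb (fun ab => fst ab <= snd ab);
  range_pos : forall x, D x -> 0 < x }.

Lemma range_half_line :
  positive_range (at_right 0) (Rbar_locally p_infty) (fun t => 0 < t).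
Proof.
split; try typeclasses eauto.
- exists (mkposreal 1 Rlt_0_1). intros; assumption.
- exists 0. intros; assumption.
- intros; lra.
- exists (fun t => 0 < t < 1) (fun t => 1 < t).
  + exists (mkposreal 1 Rlt_0_1). intros y Hy Hy0. split; [exact Hy0|].
    change (Rabs (y - 0) < 1) in Hy. rewrite Rminus_0_r, Rabs_pos_eq in Hy; lra.
  + exists 1. intros; assumption.
  + intros x y Hx Hy; simpl; lra.
- intros; assumption.
Qed.

Lemma range_left (y : R) (Hy : 0 < y) :
  positive_range (at_right 0) (at_point y) (fun t => 0 < t <= y).
Proof.
assert (H : at_right 0 (fun t => 0 < t < y)).
{ exists (mkposreal y Hy). intros u Hu Hu0. split; [exact Hu0|].
  change (Rabs (u - 0) < y) in Hu. rewrite Rminus_0_r, Rabs_pos_eq in Hu; lra. }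
split; try typeclasses eauto.
- revert H. apply filter_imp. intros; lra.
- hnf. lra.
- intros; lra.
- exists (fun t => 0 < t < y) (fun t => t = y); [exact H|reflexivity|].
  intros u v Hu ->; simpl; lra.
- intros; lra.
Qed.

Lemma range_right (y : R) (Hy : 0 < y) :
  positive_range (at_point y) (Rbar_locally p_infty) (fun t => y <= t).
Proof.
split; try typeclasses eauto.
- hnf. lra.
- exists y. intros; lra.
- intros; lra.
- exists (fun t => t = y) (fun t => y < t); [reflexivity| |].
  + exists y. intros; assumption.
  + intros u v -> Hv; simpl; lra.
- intros; lra.
Qed.

Lemma minus_plus_cancel (G : AbelianGroup) (a b c : G) : minus (plus a (plus b c)) b = plus a c.
Proof.
unfold minus. rewrite (plus_comm b c), plus_assoc.
now rewrite <- (plus_assoc _ b), plus_opp_r, plus_zero_r.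
Qed.

Section Range.

Context {Fa Fb : (R -> Prop) -> Prop} {D : R -> Prop} (HR : positive_range Fa Fb D).

Let FFa : ProperFilter Fa := range_proper_l _ _ _ HR.
Let FFb : ProperFilter Fb := range_proper_r _ _ _ HR.
#[local] Existing Instance FFa.
#[local] Existing Instance FFb.

Lemma range_prod : filter_prod Fa Fb (fun ab => D (fst ab) /\ D (snd ab)).
Proof.
exists D D; [apply HR|apply HR|]. intros; simpl; split; assumption.
Qed.

Lemma range_between (a b t : R) : D a -> D b -> Rmin a b <= t <= Rmax a b -> D t.
Proof.
intros Ha Hb. unfold Rmin, Rmax. destruct (Rle_dec a b); intros Ht.
- now apply (range_convex _ _ _ HR a t b).
- now apply (range_convex _ _ _ HR b t a).
Qed.

(** Cauchy criterion: two truncated integrals of [f] differ by integrals over two end pieces, which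
    are dominated by the same pieces of [g], and those are small because the truncated integrals of
    [g] converge. *)
Lemma ex_RInt_gen_dominated (V : CompleteNormedModule R_AbsRing) (f : R -> V) (g : R -> R) (lg : R) :
  (forall t, D t -> continuous f t) -> (forall t, D t -> continuous g t) ->
  (forall t, D t -> norm (f t) <= g t) -> is_RInt_gen g Fa Fb lg ->
  exists l, is_RInt_gen f Fa Fb l /\ norm l <= lg.
Proof.
intros Hf Hg Hfg Hlg.
assert (Hexf : forall a b, D a -> D b -> ex_RInt f a b).
{ intros a b Ha Hb. apply ex_RInt_continuous. intros t Ht. apply Hf.
  now apply (range_between a b). }
assert (Hexg : forall a b, D a -> D b -> ex_RInt g a b).
{ intros a b Ha Hb. apply (ex_RInt_continuous (V := R_CompleteNormedModule)).
  intros t Ht. apply Hg. now apply (range_between a b). }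
assert (Hdom : forall a b, D a -> D b -> norm (RInt f a b) <= Rabs (RInt g a b)).
(* The filters do not order two nearby lower (or upper) endpoints, so the comparison is needed for
   both orientations. *)
{ assert (Hle : forall a b, D a -> D b -> a <= b -> norm (RInt f a b) <= Rabs (RInt g a b)).
  { intros a b Ha Hb Hab. eapply Rle_trans; [|apply Rle_abs].
    apply (norm_RInt_le f g a b); [exact Hab| | |].
    - intros t Ht. apply Hfg. now apply (range_convex _ _ _ HR a t b).
    - apply RInt_correct. now apply Hexf.
    - apply (RInt_correct (V := R_CompleteNormedModule)). now apply Hexg. }
  intros a b Ha Hb. destruct (Rle_lt_dec a b) as [H|H]; [now apply Hle|].
  assert (E : norm (RInt f a b) = norm (RInt f b a)).
  { rewrite <- (opp_RInt_swap f b a) by now apply Hexf. apply (norm_opp (V := V)). }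
  rewrite E.
  rewrite <- (opp_RInt_swap (V := R_CompleteNormedModule) g b a) by now apply Hexg.
  change (opp (RInt g b a)) with (- RInt g b a). rewrite Rabs_Ropp.
  apply Hle; try assumption. lra. }
assert (Hex : exists l, is_RInt_gen f Fa Fb l).
{ unfold is_RInt_gen.
  apply (filterlimi_locally_cauchy (U := V)).
  { generalize range_prod. apply filter_imp. intros [a b] [Ha Hb]; simpl in *. split.
    - destruct (Hexf a b Ha Hb) as [l Hl]. now exists l.
    - intros y1 y2 H1 H2. rewrite <- (is_RInt_unique _ _ _ _ H1).
      now apply is_RInt_unique. }
  intros eps.
  assert (He2 : 0 < eps / 2) by (pose proof (cond_pos eps); lra).
  (* Each end piece of [g] is a difference of two truncated integrals within [eps / 4] of [lg],
     hence below [eps / 2]. *)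
  assert (Hball : filter_prod Fa Fb (fun ab => D (fst ab) /\ D (snd ab)
     /\ Rabs (RInt g (fst ab) (snd ab) - lg) < eps / 4)).
  { assert (He4 : 0 < eps / 4) by lra.
    pose proof (proj1 (filterlimi_locally (U := R_UniformSpace) _ _) Hlg (mkposreal _ He4)) as H1.
    generalize (filter_and _ _ range_prod H1). apply filter_imp.
    intros [a b] [[Ha Hb] [z [Hz Hzb]]]; simpl in *. repeat split; try assumption.
    rewrite (is_RInt_unique (V := R_CompleteNormedModule) _ _ _ _ Hz). exact Hzb. }
  destruct Hball as [Qa Qb HQa HQb HQ].
  exists (fun ab => Qa (fst ab) /\ Qb (snd ab)). split.
  { exists Qa Qb; try assumption. intros; split; assumption. }
  intros [a b] [a' b'] [Ha Hb] [Ha' Hb'] u v Hu Hv; simpl in *.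
  destruct (HQ _ _ Ha Hb) as (Da & Db & H1); simpl in *.
  destruct (HQ _ _ Ha' Hb) as (Da' & _ & H2); simpl in *.
  destruct (HQ _ _ Ha' Hb') as (_ & Db' & H3); simpl in *.
  refine (@norm_compat1 R_AbsRing (CompleteNormedModule.NormedModule R_AbsRing V) u v eps _).
  rewrite <- (is_RInt_unique _ _ _ _ Hu), <- (is_RInt_unique _ _ _ _ Hv).
  (* The endpoints are moved one at a time: [[a', b']] is cut into [[a', a]], [[a, b]] and
     [[b, b']]. *)
  rewrite <- (RInt_Chasles f a' a b') by now apply Hexf.
  rewrite <- (RInt_Chasles f a b b') by now apply Hexf.
  eapply Rle_lt_trans; [right; apply f_equal; apply (minus_plus_cancel V)|].
  eapply Rle_lt_trans; [apply (norm_triangle (V := V))|].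
  pose proof (Hdom a' a Da' Da) as N1. pose proof (Hdom b b' Db Db') as N2.
  assert (G1 : RInt g a' a + RInt g a b = RInt g a' b).
  { apply (RInt_Chasles (V := R_CompleteNormedModule)); now apply Hexg. }
  assert (G2 : RInt g a' b + RInt g b b' = RInt g a' b').
  { apply (RInt_Chasles (V := R_CompleteNormedModule)); now apply Hexg. }
  assert (M1 : Rabs (RInt g a' a) < eps / 2).
  { replace (RInt g a' a) with ((RInt g a' b - lg) + - (RInt g a b - lg)) by lra.
    eapply Rle_lt_trans; [apply Rabs_triang|]. rewrite Rabs_Ropp. lra. }
  assert (M2 : Rabs (RInt g b b') < eps / 2).
  { replace (RInt g b b') with ((RInt g a' b' - lg) + - (RInt g a' b - lg)) by lra.
    eapply Rle_lt_trans; [apply Rabs_triang|]. rewrite Rabs_Ropp. lra. }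
  lra. }
destruct Hex as [l Hl]. exists l. split; [exact Hl|].
apply (RInt_gen_norm (Fa := Fa) (Fb := Fb) f g l lg); try assumption.
- apply HR.
- generalize range_prod. apply filter_imp. intros [a b] [Ha Hb] t Ht; simpl in *.
  apply Hfg. now apply (range_convex _ _ _ HR a t b).
Qed.

Lemma is_RInt_gen_primitive (V : CompleteNormedModule R_AbsRing) (F f : R -> V) (la lb : V) :
  (forall t, D t -> is_derive F t (f t)) -> (forall t, D t -> continuous f t) ->
  filterlim F Fa (locally la) -> filterlim F Fb (locally lb) ->
  is_RInt_gen f Fa Fb (minus lb la).
Proof.
intros HF Hf Ha Hb. unfold is_RInt_gen.
apply (filterlimi_lim_ext_loc (fun ab => minus (F (snd ab)) (F (fst ab)))).
- generalize range_prod. apply filter_imp. intros [a b] [Da Db]; simpl in *.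
  apply is_RInt_derive; intros t Ht.
  + apply HF. now apply (range_between a b).
  + apply Hf. now apply (range_between a b).
- change (filterlim (fun ab => plus (F (snd ab)) (opp (F (fst ab)))) (filter_prod Fa Fb)
    (locally (plus lb (opp la)))).
  eapply (filterlim_comp_2 (G := locally lb) (H := locally (opp la))); [| |apply (filterlim_plus (V := V) lb (opp la))].
  + eapply filterlim_comp; [apply filterlim_snd|exact Hb].
  + eapply filterlim_comp; [|apply (filterlim_opp (V := V) la)].
    eapply filterlim_comp; [apply filterlim_fst|exact Ha].
Qed.

Lemma is_CRInt_gen_scal (c : C) (f : R -> C) (l : C) :
  is_CRInt_gen f Fa Fb l -> is_CRInt_gen (fun t => c * f t)%C Fa Fb (c * l)%C.
Proof.
intros H P HP.
assert (Hc : filterlim (fun z : C => (c * z)%C) (locally (T := C_R_NormedModule) l)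
   (locally (T := C_R_NormedModule) (c * l)%C)).
{ intros Q HQ. apply (locally_norm_le_locally (V := C_R_NormedModule)) in HQ.
  destruct HQ as [eps He].
  apply (locally_le_locally_norm (V := C_R_NormedModule)).
  assert (Hd : 0 < eps / (Cmod c + 1)).
  { apply Rdiv_lt_0_compat; [apply cond_pos|]. pose proof (Cmod_ge_0 c). lra. }
  exists (mkposreal _ Hd). intros y Hy. apply He.
  unfold ball_norm in *. rewrite norm_C_R in *.
  change (Cmod (y - l)%C < eps / (Cmod c + 1)) in Hy.
  change (Cmod (c * y - c * l)%C < eps).
  replace (c * y - c * l)%C with (c * (y - l))%C by ring. rewrite Cmod_mult.
  pose proof (Cmod_ge_0 c). pose proof (Cmod_ge_0 (y - l)).
  apply Rle_lt_trans with ((Cmod c + 1) * Cmod (y - l)%C); [nra|].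
  apply Rlt_le_trans with ((Cmod c + 1) * (eps / (Cmod c + 1))).
  - apply Rmult_lt_compat_l; lra.
  - right; field; lra. }
specialize (H (fun z => P (c * z)%C) (Hc P HP)).
revert H. unfold filtermapi. apply filter_imp. intros ab [z [Hz HPz]].
exists (c * z)%C. split; [apply is_CRInt_scal; exact Hz|exact HPz].
Qed.

Lemma is_CRInt_gen_RtoC (f : R -> R) (l : R) :
  is_RInt_gen f Fa Fb l -> is_CRInt_gen (fun t => RtoC (f t)) Fa Fb (RtoC l).
Proof.
intros H P HP.
assert (Hc : filterlim RtoC (locally l) (locally (T := C_R_NormedModule) (RtoC l))).
{ apply (curve_continuous_RtoC (fun u => u)). apply continuous_id. }
specialize (H (fun z => P (RtoC z)) (Hc P HP)).
revert H. unfold filtermapi. apply filter_imp. intros ab [z [Hz HPz]].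
exists (RtoC z). split; [apply is_CRInt_RtoC; exact Hz|exact HPz].
Qed.

Lemma range_RInt_gen_scal (k : R) (f : R -> R) (l : R) :
  is_RInt_gen f Fa Fb l -> is_RInt_gen (fun t => k * f t) Fa Fb (k * l).
Proof. apply (is_RInt_gen_scal (V := R_NormedModule)). Qed.

Lemma is_CRInt_gen_unique (f : R -> C) (l l' : C) :
  is_CRInt_gen f Fa Fb l -> is_CRInt_gen f Fa Fb l' -> l = l'.
Proof.
intros H H'.
rewrite <- (is_RInt_gen_unique (V := C_R_CompleteNormedModule) _ _ H).
apply (is_RInt_gen_unique (V := C_R_CompleteNormedModule)). exact H'.
Qed.

Lemma is_CRInt_gen_ext (f g : R -> C) (l : C) :
  (forall t, D t -> f t = g t) -> is_CRInt_gen f Fa Fb l -> is_CRInt_gen g Fa Fb l.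
Proof.
intros H. apply (is_RInt_gen_ext (V := C_R_NormedModule)).
generalize range_prod. apply filter_imp. intros [a b] [Ha Hb] t Ht; simpl in *.
apply H. apply (range_between a b); try assumption. lra.
Qed.

Lemma is_CRInt_gen_plus (f g : R -> C) (lf lg : C) :
  is_CRInt_gen f Fa Fb lf -> is_CRInt_gen g Fa Fb lg ->
  is_CRInt_gen (fun t => f t + g t)%C Fa Fb (lf + lg)%C.
Proof. apply (is_RInt_gen_plus (V := C_R_NormedModule)). Qed.

Lemma is_CRInt_gen_minus (f g : R -> C) (lf lg : C) :
  is_CRInt_gen f Fa Fb lf -> is_CRInt_gen g Fa Fb lg ->
  is_CRInt_gen (fun t => f t - g t)%C Fa Fb (lf - lg)%C.
Proof. apply (is_RInt_gen_minus (V := C_R_NormedModule)). Qed.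

Lemma is_CRInt_gen_norm (f : R -> C) (g : R -> R) (lf : C) (lg : R) :
  (forall t, D t -> Cmod (f t) <= g t) ->
  is_CRInt_gen f Fa Fb lf -> is_RInt_gen g Fa Fb lg -> Cmod lf <= lg.
Proof.
intros H Hf Hg. rewrite <- norm_C_R.
apply (RInt_gen_norm (V := C_R_CompleteNormedModule) (Fa := Fa) (Fb := Fb) f g lf lg); try assumption.
- apply HR.
- generalize range_prod. apply filter_imp. intros [a b] [Ha Hb] t Ht; simpl in *.
  rewrite norm_C_R. apply H. now apply (range_convex _ _ _ HR a t b).
Qed.

Lemma ex_CRInt_gen_dominated (f : R -> C) (g : R -> R) (lg : R) :
  (forall t, D t -> curve_continuous f t) -> (forall t, D t -> continuous g t) ->
  (forall t, D t -> Cmod (f t) <= g t) -> is_RInt_gen g Fa Fb lg ->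
  exists l, is_CRInt_gen f Fa Fb l.
Proof.
intros Hf Hg Hfg Hlg.
destruct (ex_RInt_gen_dominated C_R_CompleteNormedModule f g lg) as [l [Hl _]]; try assumption.
- intros t Ht. rewrite norm_C_R. now apply Hfg.
- now exists l.
Qed.

End Range.

(** * Convergence and dilation of Gamma-type integrals *)

Lemma Rpower_pos (t a : R) : 0 < Rpower t a.
Proof. apply exp_pos. Qed.

Lemma continuous_Rpower (a t : R) : 0 < t -> continuous (fun u => Rpower u a) t.
Proof.
intros Ht. apply (ex_derive_continuous (V := R_NormedModule)). unfold Rpower. auto_derive. exact Ht.
Qed.

Lemma continuous_exp_lin (k t : R) : continuous (fun u => exp (- (k * u))) t.
Proof. apply (ex_derive_continuous (V := R_NormedModule)). auto_derive. exact I. Qed.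

Lemma is_derive_Rpower (a t : R) :
  0 < t -> is_derive (fun u => Rpower u a) t (a * Rpower t (a - 1)).
Proof.
intros Ht. unfold Rpower. auto_derive; [exact Ht|].
replace ((a - 1) * ln t) with (a * ln t + - ln t) by ring.
rewrite exp_plus, exp_Ropp, exp_ln by exact Ht. ring.
Qed.

(** With [p >= b + 2] one has [t^(b+2) <= y^(b+2-p) t^p] for [t >= y], and [t^p exp(-kt) <= (p/k)^p]
    follows from [ln u <= u] at [u = k t / p]. The second clause of the maximum makes [p]
    positive. *)
Lemma Rpower_exp_bound (b k y : R) : 0 < k -> 0 < y ->
  exists K, 0 < K /\ forall t, y <= t -> Rpower t b * exp (- (k * t)) <= K / t ^ 2.
Proof.
intros Hk Hy. set (p := Rmax (b + 2) 1).
assert (Hp1 : b + 2 <= p) by apply Rmax_l. assert (Hp : 1 <= p) by apply Rmax_r.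
exists (Rpower y (b + 2 - p) * Rpower (p / k) p).
split. { apply Rmult_lt_0_compat; apply Rpower_pos. }
intros t Ht. assert (Ht0 : 0 < t) by lra.
assert (Hln : ln y <= ln t).
{ destruct Ht as [Ht| ->]; [left; now apply ln_increasing|right; reflexivity]. }
replace (t ^ 2) with (Rpower t 2) by (rewrite <- (Rpower_pow 2 t Ht0); f_equal; simpl; ring).
unfold Rdiv at 1. rewrite <- Rpower_Ropp. unfold Rpower. rewrite <- !exp_plus.
assert (Hle : b * ln t + - (k * t) <= (b + 2 - p) * ln y + p * ln (p / k) + - (2) * ln t).
{ assert (Hl : p * ln (k * t / p) <= k * t).
  { replace (k * t) with (p * (k * t / p)) at 2 by (field; lra).
    apply Rmult_le_compat_l; [lra|].
    assert (Hu : 0 < k * t / p) by (apply Rdiv_lt_0_compat; [nra|lra]).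
    pose proof (exp_ineq1_le (ln (k * t / p))). rewrite exp_ln in H by exact Hu. lra. }
  replace (ln t) with (ln (k * t / p) + ln (p / k)) at 1.
  2: { rewrite <- ln_mult; try (apply Rdiv_lt_0_compat; nra). f_equal. field. lra. }
  assert (E : ln (k * t / p) + ln (p / k) = ln t).
  { rewrite <- ln_mult; try (apply Rdiv_lt_0_compat; nra). f_equal. field. lra. }
  nra. }
destruct Hle as [Hle|Hle]; [left; apply exp_increasing; lra|right; f_equal; lra].
Qed.

Lemma is_RInt_gen_inv_sqr (K y : R) : 0 < y ->
  is_RInt_gen (fun t => K / t ^ 2) (at_point y) (Rbar_locally p_infty) (K / y).
Proof.
intros Hy. replace (K / y) with (minus 0 (- K / y)) by
  (change (0 - (- K / y) = K / y); field; lra).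
apply (is_RInt_gen_primitive (range_right y Hy) R_CompleteNormedModule (fun t => - K / t)).
- intros t Ht. auto_derive; [lra|]. field. lra.
- intros t Ht. apply (ex_derive_continuous (V := R_NormedModule)). auto_derive.
  intros H. apply Rmult_integral in H. lra.
- intros P HP. apply locally_singleton in HP. exact HP.
- replace 0 with (- K * 0) by ring. unfold Rdiv.
  assert (Hc : is_lim (fun t => - K * / t) p_infty (Rbar_mult (- K) 0)).
  { apply (is_lim_scal_l Rinv (- K) p_infty 0).
    apply (is_lim_inv (fun t => t) p_infty p_infty); [apply is_lim_id|discriminate]. }
  exact Hc.
Qed.

Lemma ex_gamma_integral_right (a k y : R) : 0 < k -> 0 < y ->
  exists l, is_RInt_gen (fun t => Rpower t a * exp (- (k * t))) (at_point y) (Rbar_locally p_infty) l.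
Proof.
intros Hk Hy. destruct (Rpower_exp_bound a k y Hk Hy) as (K & HK & HB).
destruct (ex_RInt_gen_dominated (range_right y Hy) R_CompleteNormedModule
  (fun t => Rpower t a * exp (- (k * t))) (fun t => K / t ^ 2) (K / y)) as [l [Hl _]].
- intros t Ht. apply (continuous_mult (K := R_AbsRing)); [apply continuous_Rpower; lra|apply continuous_exp_lin].
- intros t Ht. apply (ex_derive_continuous (V := R_NormedModule)). auto_derive.
  intros H. apply Rmult_integral in H. lra.
- intros t Ht. change (Rabs (Rpower t a * exp (- (k * t))) <= K / t ^ 2).
  rewrite Rabs_pos_eq; [now apply HB|].
  apply Rmult_le_pos; left; [apply Rpower_pos|apply exp_pos].
- apply is_RInt_gen_inv_sqr. exact Hy.
- now exists l.
Qed.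

Lemma Rpower_lim_0 (a : R) : 0 < a -> filterlim (fun t => Rpower t a) (at_right 0) (locally 0).
Proof.
intros Ha. unfold Rpower.
apply (filterlim_comp _ _ _ (fun t => a * ln t) exp _ (Rbar_locally m_infty)).
- apply (filterlim_comp _ _ _ ln (fun u => a * u) _ (Rbar_locally m_infty)); [apply is_lim_ln_0|].
  assert (E : Rbar_mult a m_infty = m_infty).
  { simpl. destruct (Rle_dec 0 a) as [H|H]; [|lra].
    destruct (Rle_lt_or_eq_dec 0 a H); [reflexivity|lra]. }
  pose proof (filterlim_Rbar_mult_l a m_infty) as H. rewrite E in H. exact H.
- apply is_lim_exp_m.
Qed.

Lemma is_RInt_gen_power (a y : R) : 0 < a -> 0 < y ->
  is_RInt_gen (fun t => Rpower t (a - 1)) (at_right 0) (at_point y) (Rpower y a / a).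
Proof.
intros Ha Hy. replace (Rpower y a / a) with (minus (Rpower y a / a) (0 / a)) by
  (change (Rpower y a / a - 0 / a = Rpower y a / a); field; lra).
apply (is_RInt_gen_primitive (range_left y Hy) R_CompleteNormedModule (fun t => Rpower t a / a)).
- intros t Ht. replace (Rpower t (a - 1)) with (/ a * (a * Rpower t (a - 1))) by (field; lra).
  apply (is_derive_ext (fun u => / a * Rpower u a)); [intros; unfold Rdiv; simpl; ring|].
  apply is_derive_scal. apply is_derive_Rpower. lra.
- intros t Ht. apply continuous_Rpower. lra.
- apply (filterlim_comp _ _ _ (fun t => Rpower t a) (fun u => u / a) _ (locally 0)).
  + now apply Rpower_lim_0.
  + apply (ex_derive_continuous (V := R_NormedModule) (fun u => u / a)). auto_derive. lra.
- intros P HP. apply locally_singleton in HP. exact HP.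
Qed.

Lemma ex_gamma_integral (a k : R) : 0 < a -> 0 < k ->
  exists l, is_RInt_gen (fun t => Rpower t (a - 1) * exp (- (k * t)))
    (at_right 0) (Rbar_locally p_infty) l.
Proof.
intros Ha Hk.
destruct (ex_gamma_integral_right (a - 1) k 1 Hk Rlt_0_1) as [l2 H2].
destruct (ex_RInt_gen_dominated (range_left 1 Rlt_0_1) R_CompleteNormedModule
  (fun t => Rpower t (a - 1) * exp (- (k * t))) (fun t => Rpower t (a - 1)) (Rpower 1 a / a))
  as [l1 [H1 _]].
- intros t Ht. apply (continuous_mult (K := R_AbsRing)); [apply continuous_Rpower; lra|apply continuous_exp_lin].
- intros t Ht. apply continuous_Rpower. lra.
- intros t Ht. change (Rabs (Rpower t (a - 1) * exp (- (k * t))) <= Rpower t (a - 1)).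
  assert (exp (- (k * t)) <= 1).
  { rewrite <- exp_0. left. apply exp_increasing. nra. }
  pose proof (Rpower_pos t (a - 1)). pose proof (exp_pos (- (k * t))).
  rewrite Rabs_pos_eq by nra. nra.
- apply is_RInt_gen_power; lra.
- exists (plus l1 l2). apply (is_RInt_gen_Chasles (V := R_NormedModule) _ 1); assumption.
Qed.

Lemma is_RInt_gen_dilate (V : NormedModule R_AbsRing) (Fa Fb Ga Gb : (R -> Prop) -> Prop)
  (f : R -> V) (k : R) (l : V) :
  filterlim (fun t => k * t) Fa Ga -> filterlim (fun t => k * t) Fb Gb ->
  is_RInt_gen f Ga Gb l -> is_RInt_gen (fun t => scal k (f (k * t))) Fa Fb l.
Proof.
intros Ha Hb H P HP. specialize (H P HP). unfold filtermapi in *.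
destruct H as [Qa Qb HQa HQb HQ].
exists (fun t => Qa (k * t)) (fun t => Qb (k * t)); [apply (Ha _ HQa)|apply (Hb _ HQb)|].
intros a b Ka Kb. destruct (HQ _ _ Ka Kb) as [z [Hz HPz]]. exists z. split; [|exact HPz].
simpl in *.
apply (is_RInt_ext (fun t => scal k (f (k * t + 0)))).
- intros; now rewrite Rplus_0_r.
- apply is_RInt_comp_lin. rewrite !Rplus_0_r. exact Hz.
Qed.

Lemma filterlim_dilate_right (k : R) : 0 < k -> filterlim (fun t => k * t) (at_right 0) (at_right 0).
Proof.
intros Hk P [eps He].
assert (Hd : 0 < eps / k) by (apply Rdiv_lt_0_compat; [apply cond_pos|exact Hk]).
exists (mkposreal _ Hd). intros t Ht Ht0.
change (Rabs (t - 0) < eps / k) in Ht. rewrite Rminus_0_r, Rabs_pos_eq in Ht by lra.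
apply He; [|nra]. change (Rabs (k * t - 0) < eps). rewrite Rminus_0_r, Rabs_pos_eq by nra.
apply Rlt_le_trans with (k * (eps / k)); [nra|right; field; lra].
Qed.

Lemma filterlim_dilate_infty (k : R) : 0 < k ->
  filterlim (fun t => k * t) (Rbar_locally p_infty) (Rbar_locally p_infty).
Proof.
intros Hk P [M HM]. exists (M / k). intros t Ht. apply HM.
apply Rle_lt_trans with (k * (M / k)); [right; field; lra|]. apply Rmult_lt_compat_l; assumption.
Qed.

(** * Holomorphic dependence on the exponent *)

Lemma exp_mult_Rabs_le (e y : R) : exp (e * Rabs y) <= exp (e * y) + exp (- e * y).
Proof.
pose proof (exp_pos (e * y)). pose proof (exp_pos (- e * y)).
unfold Rabs. destruct (Rcase_abs y).
- replace (e * - y) with (- e * y) by ring. lra.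
- lra.
Qed.

(** Summing the two extreme powers gives one dominating function for a whole neighbourhood of the
    exponent, valid both for [t < 1] and for [t > 1]. *)
Lemma Rpower_shift_le (t a h e : R) : Rabs h <= e ->
  Rpower t (a + h) <= Rpower t a * (Rpower t e + Rpower t (- e)).
Proof.
intros H. rewrite Rpower_plus. apply Rmult_le_compat_l; [left; apply Rpower_pos|].
unfold Rpower. eapply Rle_trans; [|apply exp_mult_Rabs_le].
assert (h * ln t <= e * Rabs (ln t)).
{ eapply Rle_trans; [apply Rle_abs|]. rewrite Rabs_mult.
  apply Rmult_le_compat_r; [apply Rabs_pos|exact H]. }
destruct H0 as [H0| ->]; [left; now apply exp_increasing|right; reflexivity].
Qed.

Lemma Rabs_ln_le (t e : R) : 0 < e -> Rabs (ln t) <= / e * (Rpower t e + Rpower t (- e)).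
Proof.
intros He. unfold Rpower.
apply Rle_trans with (/ e * exp (e * Rabs (ln t))).
- pose proof (exp_ineq1_le (e * Rabs (ln t))).
  apply Rle_trans with (/ e * (e * Rabs (ln t))); [right; field; lra|].
  apply Rmult_le_compat_l; [left; now apply Rinv_0_lt_compat|lra].
- apply Rmult_le_compat_l; [left; now apply Rinv_0_lt_compat|]. apply exp_mult_Rabs_le.
Qed.

Lemma exp_ge_sqr (u : R) : 0 <= u -> u * u <= 4 * exp u.
Proof.
intros H. pose proof (exp_ineq1_le (u / 2)).
replace u with (u / 2 + u / 2) at 3 by field. rewrite exp_plus.
assert (0 <= u / 2) by lra. nra.
Qed.

(** With [y = |ln t|], half of the exponent [e y] absorbs [exp(|h| y)] and the other half absorbs
    [y^2 <= (16/e^2) exp(e y/2)]; times the 5 of [Cexp_taylor2_bound] this gives 80. *)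
Lemma cpow_taylor2_bound (t e : R) (h : C) : 0 < e -> Cmod h <= e / 2 ->
  Cmod (cpow t h - 1 - h * RtoC (ln t))%C
  <= 80 / (e * e) * (Cmod h * Cmod h) * (Rpower t e + Rpower t (- e)).
Proof.
intros He Hh. unfold cpow. pose proof (Cmod_ge_0 h) as Hh0. pose proof (Rabs_pos (ln t)) as Hy0.
eapply Rle_trans; [apply Cexp_taylor2_bound|]. rewrite Cmod_mult, Cmod_R.
set (y := Rabs (ln t)) in *.
apply Rle_trans with (80 / (e * e) * (Cmod h * Cmod h) * exp (e * y)).
2: { apply Rmult_le_compat_l; [|apply exp_mult_Rabs_le].
  apply Rmult_le_pos; [|nra]. apply Rmult_le_pos; [lra|]. left; apply Rinv_0_lt_compat; nra. }
assert (H1 : exp (Cmod h * y) <= exp (e / 2 * y)).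
{ assert (Cmod h * y <= e / 2 * y) by nra.
  destruct H as [H| ->]; [left; now apply exp_increasing|right; reflexivity]. }
assert (H2 : y * y <= 16 / (e * e) * exp (e / 2 * y)).
{ pose proof (exp_ge_sqr (e / 2 * y)). assert (0 <= e / 2 * y) by nra. specialize (H H0).
  apply Rle_trans with (4 / (e * e) * (e / 2 * y * (e / 2 * y))); [right; field; lra|].
  apply Rle_trans with (4 / (e * e) * (4 * exp (e / 2 * y))); [|right; field; lra].
  apply Rmult_le_compat_l; [|exact H].
  left. apply Rdiv_lt_0_compat; nra. }
replace (5 * (Cmod h * y * (Cmod h * y)) * exp (Cmod h * y))
  with (5 * (Cmod h * Cmod h) * ((y * y) * exp (Cmod h * y))) by ring.
replace (80 / (e * e) * (Cmod h * Cmod h) * exp (e * y))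
  with (5 * (Cmod h * Cmod h) * ((16 / (e * e) * exp (e / 2 * y)) * exp (e / 2 * y))).
2: { replace (e * y) with (e / 2 * y + e / 2 * y) by field. rewrite exp_plus. field. lra. }
apply Rmult_le_compat_l; [nra|].
apply Rmult_le_compat; try assumption; [nra|left; apply exp_pos].
Qed.

Definition mellin (Fa Fb : (R -> Prop) -> Prop) (G : R -> C) (s : C) : C :=
  RInt_gen (V := C_R_CompleteNormedModule) (fun t => cpow t (s - 1) * G t)%C Fa Fb.

Section Mellin.

Context {Fa Fb : (R -> Prop) -> Prop} {D : R -> Prop} (HR : positive_range Fa Fb D).

Let FFa : ProperFilter Fa := range_proper_l _ _ _ HR.
Let FFb : ProperFilter Fb := range_proper_r _ _ _ HR.
#[local] Existing Instance FFa.
#[local] Existing Instance FFb.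

Lemma mellin_unique (G : R -> C) (s l : C) :
  is_CRInt_gen (fun t => cpow t (s - 1) * G t)%C Fa Fb l -> mellin Fa Fb G s = l.
Proof. intros H. apply (is_RInt_gen_unique (V := C_R_CompleteNormedModule)). exact H. Qed.

Lemma curve_continuous_mellin (G : R -> C) (s : C) (t : R) :
  0 < t -> curve_continuous G t -> curve_continuous (fun t => cpow t (s - 1) * G t)%C t.
Proof. intros Ht HG. apply curve_continuous_mult; [apply curve_continuous_cpow; exact Ht|exact HG]. Qed.

Lemma mellin_correct (G : R -> C) (s : C) (g : R -> R) (lg : R) :
  (forall t, D t -> curve_continuous G t) -> (forall t, D t -> continuous g t) ->
  (forall t, D t -> Rpower t (Re s - 1) * Cmod (G t) <= g t) -> is_RInt_gen g Fa Fb lg ->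
  is_CRInt_gen (fun t => cpow t (s - 1) * G t)%C Fa Fb (mellin Fa Fb G s).
Proof.
intros HG Hg Hdom Hlg.
destruct (ex_CRInt_gen_dominated HR (fun t => cpow t (s - 1) * G t)%C g lg) as [l Hl].
- intros t Ht. apply curve_continuous_mellin; [now apply HR|now apply HG].
- exact Hg.
- intros t Ht. rewrite Cmod_mult, Cmod_cpow. unfold Cminus. rewrite re_plus, re_opp, re_RtoC.
  now apply Hdom.
- exact Hlg.
- rewrite (mellin_unique _ _ _ Hl). exact Hl.
Qed.

(** Differentiation under the integral sign: the first-order error of the integrand is at most a
    constant times [|h|^2 g(t)], so one integrable [g] covering the exponents [Re s - 1 + e] and
    [Re s - 1 - e] makes the error of the integral quadratic in [h]. *)
Lemma Cderivable_mellin (G : R -> C) (s : C) (e : R) (g : R -> R) (lg : R) :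
  0 < e ->
  (forall t, D t -> curve_continuous G t) -> (forall t, D t -> continuous g t) ->
  (forall t, D t -> Rpower t (Re s - 1) * (Rpower t e + Rpower t (- e)) * Cmod (G t) <= g t) ->
  is_RInt_gen g Fa Fb lg ->
  Cderivable (mellin Fa Fb G) s.
Proof.
intros He HG Hg Hdom Hlg.
assert (Hcor : forall h : C, Cmod h <= e ->
  is_CRInt_gen (fun t => cpow t (s + h - 1) * G t)%C Fa Fb (mellin Fa Fb G (s + h)%C)).
{ intros h Hh. apply (mellin_correct G (s + h)%C g lg); try assumption.
  intros t Ht. eapply Rle_trans; [|now apply Hdom].
  apply Rmult_le_compat_r; [apply Cmod_ge_0|].
  rewrite re_plus. replace (Re s + Re h - 1) with (Re s - 1 + Re h) by ring.
  apply Rpower_shift_le. pose proof (re_le_Cmod h). lra. }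
(* The candidate derivative; [Rabs_ln_le] absorbs the logarithm into [t^e + t^(-e)]. *)
destruct (ex_CRInt_gen_dominated HR (fun t => RtoC (ln t) * (cpow t (s - 1) * G t))%C
  (fun t => / e * g t) (/ e * lg)) as [L HL].
{ intros t Ht. assert (Ht0 := range_pos _ _ _ HR t Ht).
  apply curve_continuous_mult.
  - apply curve_continuous_RtoC. apply (ex_derive_continuous (V := R_NormedModule)). auto_derive. exact Ht0.
  - apply curve_continuous_mellin; [exact Ht0|now apply HG]. }
{ intros t Ht. apply (continuous_scal_r (V := R_NormedModule)). now apply Hg. }
{ intros t Ht. rewrite !Cmod_mult, Cmod_R, Cmod_cpow.
  unfold Cminus. rewrite re_plus, re_opp, re_RtoC.
  apply Rle_trans with (/ e * (Rpower t (Re s - 1) * (Rpower t e + Rpower t (- e)) * Cmod (G t))).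
  - replace (/ e * (Rpower t (Re s - 1) * (Rpower t e + Rpower t (- e)) * Cmod (G t)))
      with ((/ e * (Rpower t e + Rpower t (- e))) * (Rpower t (Re s + - (1)) * Cmod (G t)))
      by (unfold Rminus; ring).
    apply Rmult_le_compat_r; [|now apply Rabs_ln_le].
    apply Rmult_le_pos; [left; apply Rpower_pos|apply Cmod_ge_0].
  - apply Rmult_le_compat_l; [left; now apply Rinv_0_lt_compat|now apply Hdom]. }
{ apply (is_RInt_gen_scal (V := R_NormedModule)). exact Hlg. }
exists L. apply is_Cderive_eps. intros eps Heps.
set (K := 80 / (e * e) * (Rabs lg + 1)).
assert (HK0 : 0 < 80 / (e * e)) by (apply Rdiv_lt_0_compat; nra).
assert (HK : 0 < K) by (unfold K; pose proof (Rabs_pos lg); apply Rmult_lt_0_compat; lra).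
exists (Rmin (e / 2) (eps / K)).
split. { apply Rmin_pos; [lra|]. now apply Rdiv_lt_0_compat. }
intros h Hh.
assert (H1 := Rlt_le_trans _ _ _ Hh (Rmin_l _ _)).
assert (H2 := Rlt_le_trans _ _ _ Hh (Rmin_r _ _)).
pose proof (Cmod_ge_0 h) as Hh0.
assert (Hs := Hcor 0). rewrite Cplus_0_r in Hs. rewrite Cmod_0 in Hs. specialize (Hs (Rlt_le _ _ He)).
assert (Hsh := Hcor h ltac:(lra)).
assert (Hdiff := is_CRInt_gen_minus HR _ _ _ _ (is_CRInt_gen_minus HR _ _ _ _ Hsh Hs)
   (is_CRInt_gen_scal HR h _ _ HL)).
assert (Hb : Cmod (mellin Fa Fb G (s + h)%C - mellin Fa Fb G s - h * L)%C
   <= (80 / (e * e) * (Cmod h * Cmod h)) * lg).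
{ eapply (is_CRInt_gen_norm HR _ (fun t => (80 / (e * e) * (Cmod h * Cmod h)) * g t)); [|exact Hdiff|].
  - intros t Ht. cbv beta.
    replace (cpow t (s + h - 1) * G t - cpow t (s - 1) * G t
       - h * (RtoC (ln t) * (cpow t (s - 1) * G t)))%C
     with (cpow t (s - 1) * (cpow t h - 1 - h * RtoC (ln t)) * G t)%C.
    2: { replace (s + h - 1)%C with ((s - 1) + h)%C by ring. rewrite cpow_plus. ring. }
    rewrite !Cmod_mult, Cmod_cpow. unfold Cminus at 1. rewrite re_plus, re_opp, re_RtoC.
    eapply Rle_trans; [|apply Rmult_le_compat_l; [|now apply Hdom]].
    2: { apply Rmult_le_pos; nra. }
    replace (80 / (e * e) * (Cmod h * Cmod h) *
       (Rpower t (Re s - 1) * (Rpower t e + Rpower t (- e)) * Cmod (G t)))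
      with (Rpower t (Re s - 1) * (80 / (e * e) * (Cmod h * Cmod h) * (Rpower t e + Rpower t (- e)))
         * Cmod (G t)) by ring.
    apply Rmult_le_compat_r; [apply Cmod_ge_0|].
    apply Rmult_le_compat_l; [left; apply Rpower_pos|].
    apply cpow_taylor2_bound; lra.
  - apply (is_RInt_gen_scal (V := R_NormedModule)). exact Hlg. }
eapply Rle_trans; [exact Hb|].
apply Rle_trans with (K * Cmod h * Cmod h).
- unfold K. pose proof (Rle_abs lg).
  replace (80 / (e * e) * (Rabs lg + 1) * Cmod h * Cmod h)
    with (80 / (e * e) * (Cmod h * Cmod h) * (Rabs lg + 1)) by ring.
  apply Rmult_le_compat_l; [apply Rmult_le_pos; nra|lra].
- apply Rmult_le_compat_r; [exact Hh0|].
  apply Rle_trans with (K * (eps / K)); [apply Rmult_le_compat_l; lra|right; field; lra].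
Qed.

End Mellin.

Lemma filterlim_C_0 {T : Type} (F : (T -> Prop) -> Prop) {FF : Filter F} (f : T -> C) (g : T -> R) :
  F (fun t => Cmod (f t) <= g t) -> filterlim g F (locally 0) ->
  filterlim f F (locally (T := C_R_NormedModule) (RtoC 0)).
Proof.
intros H Hg P HP. apply (locally_norm_le_locally (V := C_R_NormedModule)) in HP.
destruct HP as [eps He].
specialize (Hg _ (locally_ball (T := R_UniformSpace) 0 eps)). unfold filtermap in *.
generalize (filter_and _ _ H Hg). apply filter_imp. intros t [H1 H2].
change (Rabs (g t - 0) < eps) in H2. rewrite Rminus_0_r in H2.
apply He. unfold ball_norm. rewrite norm_C_R.
change (Cmod (f t - 0)%C < eps). replace (f t - 0)%C with (f t) by ring.
pose proof (Rle_abs (g t)). lra.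
Qed.

(** * Mellin transforms of exponentially decaying functions *)

(** The bound holds down to [t = 0], so it also makes [G] bounded there; this is what lets the
    Mellin integral converge for [Re s > 0]. *)
Definition decays (G : R -> C) : Prop :=
  (forall t, 0 < t -> curve_continuous G t) /\
  exists K k, 0 < k /\ forall t, 0 < t -> Cmod (G t) <= K * exp (- (k * t)).

Lemma continuous_gamma_integrand (a k t : R) :
  0 < t -> continuous (fun t => Rpower t a * exp (- (k * t))) t.
Proof.
intros Ht. apply (continuous_mult (K := R_AbsRing)); [now apply continuous_Rpower|apply continuous_exp_lin].
Qed.

Lemma Rpower_pair (t a e : R) :
  Rpower t a * (Rpower t e + Rpower t (- e)) = Rpower t (a + e) + Rpower t (a - e).
Proof. unfold Rminus. rewrite !Rpower_plus. ring. Qed.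

Lemma mellin_correct_half_line (G : R -> C) (s : C) : decays G -> 0 < Re s ->
  is_CRInt_gen (fun t => cpow t (s - 1) * G t)%C (at_right 0) (Rbar_locally p_infty)
    (mellin (at_right 0) (Rbar_locally p_infty) G s).
Proof.
intros [HG (K & k & Hk & HB)] Hs.
destruct (ex_gamma_integral (Re s) k Hs Hk) as [l Hl].
apply (mellin_correct range_half_line G s
  (fun t => K * (Rpower t (Re s - 1) * exp (- (k * t)))) (K * l)).
- exact HG.
- intros t Ht. apply (continuous_scal_r (V := R_NormedModule)). now apply continuous_gamma_integrand.
- intros t Ht. replace (K * (Rpower t (Re s - 1) * exp (- (k * t))))
    with (Rpower t (Re s - 1) * (K * exp (- (k * t)))) by ring.
  apply Rmult_le_compat_l; [left; apply Rpower_pos|now apply HB].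
- apply (is_RInt_gen_scal (V := R_NormedModule)). exact Hl.
Qed.

Lemma Cderivable_mellin_half_line (G : R -> C) (s : C) : decays G -> 0 < Re s ->
  Cderivable (mellin (at_right 0) (Rbar_locally p_infty) G) s.
Proof.
intros [HG (K & k & Hk & HB)] Hs. set (e := Re s / 2). assert (He : 0 < e) by (unfold e; lra).
destruct (ex_gamma_integral (Re s + e) k) as [l1 Hl1]; [lra|exact Hk|].
destruct (ex_gamma_integral (Re s - e) k) as [l2 Hl2]; [unfold e; lra|exact Hk|].
apply (Cderivable_mellin range_half_line G s e (fun t =>
  K * (Rpower t (Re s + e - 1) * exp (- (k * t)) + Rpower t (Re s - e - 1) * exp (- (k * t)))) (K * (l1 + l2)));
  try assumption.
- intros t Ht. apply (continuous_scal_r (V := R_NormedModule)).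
  apply (continuous_plus (V := R_NormedModule)); now apply continuous_gamma_integrand.
- intros t Ht. rewrite Rpower_pair.
  replace (Re s - 1 + e) with (Re s + e - 1) by ring. replace (Re s - 1 - e) with (Re s - e - 1) by ring.
  replace (K * (Rpower t (Re s + e - 1) * exp (- (k * t)) + Rpower t (Re s - e - 1) * exp (- (k * t))))
    with ((Rpower t (Re s + e - 1) + Rpower t (Re s - e - 1)) * (K * exp (- (k * t)))) by ring.
  apply Rmult_le_compat_l; [|now apply HB].
  pose proof (Rpower_pos t (Re s + e - 1)). pose proof (Rpower_pos t (Re s - e - 1)). lra.
- apply (is_RInt_gen_scal (V := R_NormedModule)).
  apply (is_RInt_gen_plus (V := R_NormedModule)); assumption.
Qed.

Lemma mellin_correct_right (G : R -> C) (s : C) (y : R) : decays G -> 0 < y ->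
  is_CRInt_gen (fun t => cpow t (s - 1) * G t)%C (at_point y) (Rbar_locally p_infty)
    (mellin (at_point y) (Rbar_locally p_infty) G s).
Proof.
intros [HG (K & k & Hk & HB)] Hy.
destruct (ex_gamma_integral_right (Re s - 1) k y Hk Hy) as [l Hl].
apply (mellin_correct (range_right y Hy) G s
  (fun t => K * (Rpower t (Re s - 1) * exp (- (k * t)))) (K * l)).
- intros t Ht. apply HG. lra.
- intros t Ht. apply (continuous_scal_r (V := R_NormedModule)). apply continuous_gamma_integrand. lra.
- intros t Ht. replace (K * (Rpower t (Re s - 1) * exp (- (k * t))))
    with (Rpower t (Re s - 1) * (K * exp (- (k * t)))) by ring.
  apply Rmult_le_compat_l; [left; apply Rpower_pos|apply HB; lra].
- apply (is_RInt_gen_scal (V := R_NormedModule)). exact Hl.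
Qed.

Lemma Cderivable_mellin_right (G : R -> C) (s : C) (y : R) : decays G -> 0 < y ->
  Cderivable (mellin (at_point y) (Rbar_locally p_infty) G) s.
Proof.
intros [HG (K & k & Hk & HB)] Hy.
destruct (ex_gamma_integral_right (Re s - 1 + 1) k y Hk Hy) as [l1 Hl1].
destruct (ex_gamma_integral_right (Re s - 1 - 1) k y Hk Hy) as [l2 Hl2].
apply (Cderivable_mellin (range_right y Hy) G s 1 (fun t =>
  K * (Rpower t (Re s - 1 + 1) * exp (- (k * t)) + Rpower t (Re s - 1 - 1) * exp (- (k * t)))) (K * (l1 + l2))).
- lra.
- intros t Ht. apply HG. lra.
- intros t Ht. apply (continuous_scal_r (V := R_NormedModule)).
  apply (continuous_plus (V := R_NormedModule)); apply continuous_gamma_integrand; lra.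
- intros t Ht. rewrite Rpower_pair.
  replace (K * (Rpower t (Re s - 1 + 1) * exp (- (k * t)) + Rpower t (Re s - 1 - 1) * exp (- (k * t))))
    with ((Rpower t (Re s - 1 + 1) + Rpower t (Re s - 1 - 1)) * (K * exp (- (k * t)))) by ring.
  apply Rmult_le_compat_l; [|apply HB; lra].
  pose proof (Rpower_pos t (Re s - 1 + 1)). pose proof (Rpower_pos t (Re s - 1 - 1)). lra.
- apply (is_RInt_gen_scal (V := R_NormedModule)).
  apply (is_RInt_gen_plus (V := R_NormedModule)); assumption.
Qed.

(** Vanishing to order [N] at 0 moves the abscissa of convergence from 0 to [-N]. The explicit bound
    later makes remainders of series tend to 0. *)
Lemma is_CRInt_gen_left_bound (G : R -> C) (s : C) (y K : R) (N : nat) :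
  0 < y -> 0 < Re s + INR N ->
  (forall t, 0 < t <= y -> curve_continuous G t) ->
  (forall t, 0 < t <= y -> Cmod (G t) <= K * t ^ N) ->
  is_CRInt_gen (fun t => cpow t (s - 1) * G t)%C (at_right 0) (at_point y)
    (mellin (at_right 0) (at_point y) G s)
  /\ Cmod (mellin (at_right 0) (at_point y) G s) <= K * (Rpower y (Re s + INR N) / (Re s + INR N)).
Proof.
intros Hy Hs HG HB.
assert (Hg : is_RInt_gen (fun t => K * Rpower t (Re s + INR N - 1)) (at_right 0) (at_point y)
  (K * (Rpower y (Re s + INR N) / (Re s + INR N)))).
{ apply (is_RInt_gen_scal (V := R_NormedModule)). now apply is_RInt_gen_power. }
assert (Hd : forall t, 0 < t <= y ->
  Rpower t (Re s - 1) * Cmod (G t) <= K * Rpower t (Re s + INR N - 1)).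
{ intros t Ht. replace (Re s + INR N - 1) with (Re s - 1 + INR N) by ring.
  rewrite Rpower_plus, Rpower_pow by lra.
  replace (K * (Rpower t (Re s - 1) * t ^ N)) with (Rpower t (Re s - 1) * (K * t ^ N)) by ring.
  apply Rmult_le_compat_l; [left; apply Rpower_pos|now apply HB]. }
assert (H : is_CRInt_gen (fun t => cpow t (s - 1) * G t)%C (at_right 0) (at_point y)
    (mellin (at_right 0) (at_point y) G s)).
{ eapply (mellin_correct (range_left y Hy)); [exact HG| |exact Hd|exact Hg].
  intros t Ht. apply (continuous_scal_r (V := R_NormedModule)). apply continuous_Rpower; lra. }
split; [exact H|].
refine (is_CRInt_gen_norm (range_left y Hy) _ _ _ _ _ H Hg).
intros t Ht. rewrite Cmod_mult, Cmod_cpow. unfold Cminus. rewrite re_plus, re_opp, re_RtoC.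
now apply Hd.
Qed.

Lemma Cderivable_mellin_left (G : R -> C) (s : C) (y K : R) (N : nat) :
  0 < y -> 0 < Re s + INR N ->
  (forall t, 0 < t <= y -> curve_continuous G t) ->
  (forall t, 0 < t <= y -> Cmod (G t) <= K * t ^ N) ->
  Cderivable (mellin (at_right 0) (at_point y) G) s.
Proof.
(* Half of the margin keeps both [a + e] and [a - e] positive. *)
intros Hy Hs HG HB. set (a := Re s + INR N) in *. set (e := a / 2).
apply (Cderivable_mellin (range_left y Hy) G s e
  (fun t => K * (Rpower t (a + e - 1) + Rpower t (a - e - 1)))
  (K * (Rpower y (a + e) / (a + e) + Rpower y (a - e) / (a - e)))).
- unfold e; lra.
- exact HG.
- intros t Ht. apply (continuous_scal_r (V := R_NormedModule)).
  apply (continuous_plus (V := R_NormedModule)); apply continuous_Rpower; lra.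
- intros t Ht. rewrite Rpower_pair.
  replace (a + e - 1) with (Re s - 1 + e + INR N) by (unfold a; ring).
  replace (a - e - 1) with (Re s - 1 - e + INR N) by (unfold a; ring).
  rewrite !(Rpower_plus _ (INR N)), Rpower_pow by lra.
  replace (K * (Rpower t (Re s - 1 + e) * t ^ N + Rpower t (Re s - 1 - e) * t ^ N))
   with ((Rpower t (Re s - 1 + e) + Rpower t (Re s - 1 - e)) * (K * t ^ N)) by ring.
  apply Rmult_le_compat_l; [|now apply HB].
  pose proof (Rpower_pos t (Re s - 1 + e)). pose proof (Rpower_pos t (Re s - 1 - e)). lra.
- apply (is_RInt_gen_scal (V := R_NormedModule)).
  apply (is_RInt_gen_plus (V := R_NormedModule)); apply is_RInt_gen_power; unfold e; lra.
Qed.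

(** * The Gamma function *)

Lemma curve_continuous_exp (k t : R) : curve_continuous (fun t => RtoC (exp (- (k * t)))) t.
Proof. apply curve_continuous_RtoC, continuous_exp_lin. Qed.

Lemma decays_exp (k : R) : 0 < k -> decays (fun t => RtoC (exp (- (k * t)))).
Proof.
intros Hk. split.
- intros t _. apply curve_continuous_exp.
- exists 1, k. split; [exact Hk|]. intros t _. rewrite Cmod_R, Rabs_pos_eq by (left; apply exp_pos). lra.
Qed.

Lemma decays_exp_1 : decays (fun t => RtoC (exp (- t))).
Proof.
destruct (decays_exp 1 Rlt_0_1) as [H1 (K & k & Hk & H2)]. split.
- intros t Ht. apply (continuous_ext (U := C_R_NormedModule) (fun t => RtoC (exp (- (1 * t))))).
  + intros. now rewrite Rmult_1_l.
  + now apply H1.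
- exists K, k. split; [exact Hk|]. intros t Ht. specialize (H2 t Ht). now rewrite Rmult_1_l in H2.
Qed.

Lemma Gamma_integral_correct (s : C) : 0 < Re s ->
  is_CRInt_gen (fun t => cpow t (s - 1) * RtoC (exp (- t)))%C
    (at_right 0) (Rbar_locally p_infty) (Gamma_integral s).
Proof. apply (mellin_correct_half_line _ s decays_exp_1). Qed.

Lemma Cderivable_Gamma_integral (s : C) : 0 < Re s -> Cderivable Gamma_integral s.
Proof. apply (Cderivable_mellin_half_line _ s decays_exp_1). Qed.

Lemma upper_Gamma_correct (s : C) (y : R) : 0 < y ->
  is_CRInt_gen (fun t => cpow t (s - 1) * RtoC (exp (- t)))%C
    (at_point y) (Rbar_locally p_infty) (upper_Gamma s y).
Proof. apply (mellin_correct_right _ s y decays_exp_1). Qed.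

Lemma is_CRInt_gen_dilate_exp (Fa Fb Ga Gb : (R -> Prop) -> Prop) (D : R -> Prop) (s l : C) (k : R) :
  positive_range Fa Fb D -> 0 < k ->
  filterlim (fun t => k * t) Fa Ga -> filterlim (fun t => k * t) Fb Gb ->
  is_CRInt_gen (fun t => cpow t (s - 1) * RtoC (exp (- t)))%C Ga Gb l ->
  is_CRInt_gen (fun t => cpow t (s - 1) * RtoC (exp (- (k * t))))%C Fa Fb (cpow k (- s) * l)%C.
Proof.
intros HR Hk Ha Hb H.
pose proof (is_RInt_gen_dilate C_R_NormedModule _ _ _ _ _ k l Ha Hb H) as H1.
apply (is_CRInt_gen_scal HR (cpow k (- s)%C)) in H1.
revert H1. apply (is_CRInt_gen_ext HR). intros t Ht.
assert (Ht0 := range_pos _ _ _ HR t Ht).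
change (scal k (cpow (k * t) (s - 1) * exp (- (k * t)))%C)
  with (scal (V := C_R_ModuleSpace) k (cpow (k * t) (s - 1) * exp (- (k * t)))%C).
rewrite scal_R_Cmult, cpow_base_mult by assumption.
transitivity (cpow k (- s) * (cpow k (s - 1) * RtoC k) * (cpow t (s - 1) * exp (- (k * t))))%C; [ring|].
rewrite <- (cpow_minus_1 k s Hk), <- cpow_plus.
replace (- s + s)%C with (RtoC 0) by ring. rewrite cpow_0. ring.
Qed.

Lemma Gamma_integral_dilate (s : C) (k : R) : 0 < Re s -> 0 < k ->
  is_CRInt_gen (fun t => cpow t (s - 1) * RtoC (exp (- (k * t))))%C
    (at_right 0) (Rbar_locally p_infty) (cpow k (- s) * Gamma_integral s)%C.
Proof.
intros Hs Hk. eapply (is_CRInt_gen_dilate_exp _ _ _ _ _ s _ k range_half_line Hk).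
- now apply filterlim_dilate_right.
- now apply filterlim_dilate_infty.
- now apply Gamma_integral_correct.
Qed.

Lemma upper_Gamma_dilate (s : C) (k y : R) : 0 < k -> 0 < y ->
  is_CRInt_gen (fun t => cpow t (s - 1) * RtoC (exp (- (k * t))))%C
    (at_point y) (Rbar_locally p_infty) (cpow k (- s) * upper_Gamma s (k * y))%C.
Proof.
intros Hk Hy. eapply (is_CRInt_gen_dilate_exp _ _ _ _ _ s _ k (range_right y Hy) Hk).
- intros P HP. exact HP.
- now apply filterlim_dilate_infty.
- apply upper_Gamma_correct. nra.
Qed.

Lemma Gamma_integral_1 : Gamma_integral 1 = 1.
Proof.
assert (H : is_CRInt_gen (fun t => cpow t (1 - 1) * RtoC (exp (- t)))%C
    (at_right 0) (Rbar_locally p_infty) (RtoC 1)).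
{ apply (is_CRInt_gen_ext range_half_line (fun t => RtoC (exp (- t)))).
  { intros t _. replace (1 - 1)%C with (RtoC 0) by ring. rewrite cpow_0. ring. }
  apply (is_CRInt_gen_RtoC range_half_line).
  replace 1 with (minus 0 (- exp (- 0))) by
   (change (0 - - exp (- 0) = 1); rewrite Ropp_0, exp_0; ring).
  apply (is_RInt_gen_primitive range_half_line R_CompleteNormedModule (fun t => - exp (- t))).
  - intros t _. auto_derive; [exact I|ring].
  - intros t _. apply (ex_derive_continuous (V := R_NormedModule)). auto_derive. exact I.
  - assert (Hc : continuous (fun t => - exp (- t)) 0).
    { apply (ex_derive_continuous (V := R_NormedModule)). auto_derive. exact I. }
    intros P HP. specialize (Hc P HP). unfold filtermap in *.
    unfold at_right, within. revert Hc. apply filter_imp. intros; assumption.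
  - replace 0 with (- 0) by ring.
    apply (filterlim_comp _ _ _ (fun t => exp (- t)) Ropp _ (locally 0)).
    + apply (filterlim_comp _ _ _ Ropp exp _ (Rbar_locally m_infty)).
      * apply (filterlim_Rbar_opp p_infty).
      * apply is_lim_exp_m.
    + apply (filterlim_opp (V := R_NormedModule) 0). }
apply (is_CRInt_gen_unique range_half_line _ _ _ (Gamma_integral_correct 1 ltac:(simpl; lra)) H).
Qed.

(** Integration by parts: [t^s exp(-t)] is a primitive of the difference of the two integrands and
    vanishes at both ends. *)
Lemma Gamma_integral_S (s : C) : 0 < Re s -> Gamma_integral (s + 1)%C = (s * Gamma_integral s)%C.
Proof.
intros Hs.
assert (Hs1 : 0 < Re (s + 1)%C) by (rewrite re_plus, re_RtoC; lra).
assert (H : is_CRInt_gen (fun t => s * (cpow t (s - 1) * RtoC (exp (- t)))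
    - cpow t (s + 1 - 1) * RtoC (exp (- t)))%C
    (at_right 0) (Rbar_locally p_infty) (0 - 0)%C).
{ apply (is_RInt_gen_primitive range_half_line C_R_CompleteNormedModule
   (fun t => cpow t s * RtoC (exp (- t)))%C).
  - intros t Ht.
    replace (s * (cpow t (s - 1) * RtoC (exp (- t))) - cpow t (s + 1 - 1) * RtoC (exp (- t)))%C
     with ((s * cpow t (s - 1)) * RtoC (exp (- t)) + cpow t s * RtoC (- exp (- t)))%C.
    + apply (is_curve_derive_mult (fun t => cpow t s) (fun t => RtoC (exp (- t)))); [now apply is_curve_derive_cpow|].
      apply is_curve_derive_RtoC. auto_derive; [exact I|ring].
    + replace (s + 1 - 1)%C with s by ring. rewrite RtoC_opp. ring.
  - intros t Ht. apply curve_continuous_minus; [apply curve_continuous_mult;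
      [apply curve_continuous_const|]|]; apply (curve_continuous_mellin (fun t => RtoC (exp (- t))));
      try exact Ht; now apply decays_exp_1.
  - apply (filterlim_C_0 _ _ (fun t => Rpower t (Re s))); [|now apply Rpower_lim_0].
    generalize (range_l _ _ _ range_half_line). apply filter_imp. intros t Ht.
    rewrite Cmod_mult, Cmod_cpow, Cmod_R, Rabs_pos_eq by (left; apply exp_pos).
    assert (exp (- t) <= 1) by (rewrite <- exp_0; left; apply exp_increasing; lra).
    pose proof (Rpower_pos t (Re s)). nra.
  - destruct (Rpower_exp_bound (Re s) 1 1 Rlt_0_1 Rlt_0_1) as (K & HK & HB).
    apply (filterlim_C_0 _ _ (fun t => K * / t)).
    + exists 1. intros t Ht.
      rewrite Cmod_mult, Cmod_cpow, Cmod_R, Rabs_pos_eq by (left; apply exp_pos).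
      specialize (HB t (Rlt_le _ _ Ht)). rewrite Rmult_1_l in HB.
      eapply Rle_trans; [exact HB|]. unfold Rdiv. apply Rmult_le_compat_l; [lra|].
      apply Rinv_le_contravar; [lra|]. simpl. nra.
    + replace 0 with (K * 0) by ring.
      apply (is_lim_scal_l Rinv K p_infty 0).
      apply (is_lim_inv (fun t => t) p_infty p_infty); [apply is_lim_id|discriminate]. }
pose proof (is_CRInt_gen_minus range_half_line _ _ _ _
  (is_CRInt_gen_scal range_half_line s _ _ (Gamma_integral_correct s Hs))
  (Gamma_integral_correct (s + 1)%C Hs1)) as H'.
pose proof (is_CRInt_gen_unique range_half_line _ _ _ H H') as E.
replace (Gamma_integral (s + 1)%C) with
  (s * Gamma_integral s - (s * Gamma_integral s - Gamma_integral (s + 1)))%C by ring.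
rewrite <- E. ring.
Qed.

(** * Gamma has no zeros *)

(** The redundant factor in [1 * t] keeps the shape [k * t] of [ex_gamma_integral]. The real
    function supplies the moments of the Gamma density. *)
Definition real_gamma (a : R) : R :=
  RInt_gen (V := R_CompleteNormedModule) (fun t => Rpower t (a - 1) * exp (- (1 * t)))
    (at_right 0) (Rbar_locally p_infty).

Lemma real_gamma_correct (a : R) : 0 < a ->
  is_RInt_gen (fun t => Rpower t (a - 1) * exp (- (1 * t))) (at_right 0) (Rbar_locally p_infty)
    (real_gamma a).
Proof.
intros Ha. apply (RInt_gen_correct (V := R_CompleteNormedModule)).
apply ex_gamma_integral; lra.
Qed.

Lemma Gamma_integral_RtoC (a : R) : 0 < a -> Gamma_integral (RtoC a) = RtoC (real_gamma a).
Proof.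
intros Ha. apply (is_CRInt_gen_unique range_half_line _ _ _ (Gamma_integral_correct a Ha)).
eapply (is_CRInt_gen_ext range_half_line); [|apply (is_CRInt_gen_RtoC range_half_line); now apply real_gamma_correct].
intros t Ht. cbv beta. rewrite <- RtoC_minus, cpow_RtoC, <- RtoC_mult, Rmult_1_l. reflexivity.
Qed.

Lemma real_gamma_S (a : R) : 0 < a -> real_gamma (a + 1) = a * real_gamma a.
Proof.
intros Ha. apply RtoC_inj. rewrite RtoC_mult, <- !Gamma_integral_RtoC, RtoC_plus by lra.
now apply Gamma_integral_S.
Qed.

(** The piece over [1, 2] is strictly positive and the two improper pieces around it are
    nonnegative. *)
Lemma real_gamma_pos (a : R) : 0 < a -> 0 < real_gamma a.
Proof.
intros Ha. set (g := fun t => Rpower t (a - 1) * exp (- (1 * t))).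
assert (Hpos : forall t, 0 <= g t).
{ intros t. apply Rmult_le_pos; left; [apply Rpower_pos|apply exp_pos]. }
assert (Hcont : forall t, 0 < t -> continuous g t) by (intros; now apply continuous_gamma_integrand).
(* Domination of the zero function by [g] already gives [0 <= norm l' <= l]. *)
assert (Hnn : forall Fa Fb D l, positive_range Fa Fb D -> is_RInt_gen g Fa Fb l -> 0 <= l).
{ intros Fa Fb D l HR Hl.
  destruct (ex_RInt_gen_dominated HR R_CompleteNormedModule (fun _ => 0) g l) as [l' [_ H]];
    try assumption.
  - intros. apply continuous_const.
  - intros t Ht. apply Hcont. now apply HR.
  - intros t Ht. change (Rabs 0 <= g t). rewrite Rabs_R0. apply Hpos.
  - eapply Rle_trans; [apply (norm_ge_0 (V := R_NormedModule))|exact H]. }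
destruct (ex_gamma_integral_right (a - 1) 1 2 Rlt_0_1 Rlt_0_2) as [l3 H3].
destruct (ex_RInt_gen_dominated (range_left 1 Rlt_0_1) R_CompleteNormedModule
  g (fun t => Rpower t (a - 1)) (Rpower 1 a / a)) as [l1 [H1 _]].
{ intros t Ht. apply Hcont. lra. }
{ intros t Ht. apply continuous_Rpower. lra. }
{ intros t Ht. change (Rabs (g t) <= Rpower t (a - 1)). rewrite Rabs_pos_eq by apply Hpos.
  unfold g. assert (exp (- (1 * t)) <= 1).
  { rewrite Rmult_1_l, <- exp_0. left; apply exp_increasing; lra. }
  pose proof (Rpower_pos t (a - 1)) as Hp.
  rewrite <- (Rmult_1_r (Rpower t (a - 1))) at 2. apply Rmult_le_compat_l; lra. }
{ apply is_RInt_gen_power; lra. }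
assert (H2 : is_RInt g 1 2 (RInt g 1 2)).
{ apply (RInt_correct (V := R_CompleteNormedModule)). apply (ex_RInt_continuous (V := R_CompleteNormedModule)).
  intros t Ht. apply Hcont. rewrite Rmin_left in Ht by lra. lra. }
assert (P2 : 0 < RInt g 1 2).
{ apply RInt_gt_0; [lra| |].
  - intros t _. apply Rmult_lt_0_compat; [apply Rpower_pos|apply exp_pos].
  - intros t Ht. apply Hcont. lra. }
assert (P1 : 0 <= l1) by (eapply Hnn; [apply (range_left 1 Rlt_0_1)|exact H1]).
assert (P3 : 0 <= l3) by (eapply Hnn; [apply (range_right 2 Rlt_0_2)|exact H3]).
assert (Hall : is_RInt_gen g (at_right 0) (Rbar_locally p_infty) (plus (plus l1 (RInt g 1 2)) l3)).
{ apply (is_RInt_gen_Chasles (V := R_NormedModule) _ 2); [|exact H3].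
  apply (is_RInt_gen_Chasles (V := R_NormedModule) _ 1); [exact H1|].
  apply is_RInt_gen_at_point. exact H2. }
unfold real_gamma. fold g.
rewrite (is_RInt_gen_unique (V := R_CompleteNormedModule) _ _ Hall).
change (0 < (l1 + RInt g 1 2) + l3). lra.
Qed.

Lemma Cmod_Cexp_imag_minus_1 (y : R) : Cmod (Cexp (0, y) - 1)%C <= 3 * Rabs y.
Proof.
eapply Rle_trans; [apply Cmod_ReIm|]. unfold Cexp; simpl. rewrite exp_0.
replace (1 * cos y + - (1)) with (cos y - 1) by ring. replace (1 * sin y + - 0) with (sin y) by ring.
pose proof (Rabs_sin_le y). pose proof (Rabs_cos_minus_1_le y). pose proof (COS_bound y). pose proof (Rabs_pos y).
assert (Rabs (cos y - 1) <= 2 * Rabs y).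
{ destruct (Rle_lt_dec (Rabs y) 1).
  - assert (y * y = Rabs y * Rabs y) by (rewrite <- Rabs_mult, Rabs_pos_eq; [reflexivity|apply Rle_0_sqr]).
    assert (Rabs y * Rabs y <= 1 * Rabs y) by (apply Rmult_le_compat_r; assumption). lra.
  - apply Rabs_le. lra. }
lra.
Qed.

(** [|ln u|] is at most [u - 1] or [1/u - 1], and [y <= e/2 + y^2/(2e)]. A quadratic bound is wanted
    since, with [u = t/a], its mean under the Gamma density consists of moments. *)
Lemma Rabs_ln_AMGM (u e : R) : 0 < u -> 0 < e ->
  Rabs (ln u) <= e + ((u - 1) * (u - 1) + (/ u - 1) * (/ u - 1)) / (2 * e).
Proof.
intros Hu He.
assert (Hg : forall v, 0 < v -> ln v <= v - 1).
{ intros v Hv. pose proof (exp_ineq1_le (ln v)). rewrite exp_ln in H by exact Hv. lra. }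
assert (Hiu : 0 < / u) by now apply Rinv_0_lt_compat.
pose proof (Hg u Hu) as H1. pose proof (Hg (/ u) Hiu) as H2. rewrite ln_Rinv in H2 by exact Hu.
assert (Ham : forall x, x <= e / 2 + x * x / (2 * e)).
{ intros x. assert (0 <= (x - e) * (x - e) / (2 * e)).
  { apply Rmult_le_pos; [apply Rle_0_sqr|]. left. apply Rinv_0_lt_compat. lra. }
  replace ((x - e) * (x - e) / (2 * e)) with (x * x / (2 * e) + e / 2 - x) in H by (field; lra). lra. }
pose proof (Ham (u - 1)) as A1. pose proof (Ham (/ u - 1)) as A2.
assert (B1 : 0 <= (u - 1) * (u - 1) / (2 * e)).
{ apply Rmult_le_pos; [apply Rle_0_sqr|]. left. apply Rinv_0_lt_compat. lra. }
assert (B2 : 0 <= (/ u - 1) * (/ u - 1) / (2 * e)).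
{ apply Rmult_le_pos; [apply Rle_0_sqr|]. left. apply Rinv_0_lt_compat. lra. }
unfold Rdiv in *. rewrite Rmult_plus_distr_r. apply Rabs_le. lra.
Qed.

(* Under the density proportional to [t^(a-1) exp(-t)] the variable [t] concentrates around [a],
   so [Gamma_integral (a + i b)] is close to [a^(i b) * real_gamma a] for large [a]. *)
Lemma Gamma_integral_concentration (a b e : R) : 2 < a -> 0 < e ->
  Cmod (Gamma_integral (a, b) - cpow a (0, b) * RtoC (real_gamma a))%C
  <= 3 * Rabs b * (real_gamma a * (e + (/ a + (a + 2) / ((a - 1) * (a - 2))) / (2 * e))).
Proof.
intros Ha He.
set (q := fun u => e + ((u - 1) * (u - 1) + (/ u - 1) * (/ u - 1)) / (2 * e)).
assert (R1 : real_gamma (a + 1) = a * real_gamma a) by (apply real_gamma_S; lra).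
assert (R2 : real_gamma (a + 2) = (a + 1) * a * real_gamma a).
{ replace (a + 2) with (a + 1 + 1) by ring. rewrite real_gamma_S, R1 by lra. ring. }
assert (R3 : real_gamma (a - 1) = real_gamma a / (a - 1)).
{ replace a with (a - 1 + 1) at 2 by ring. rewrite real_gamma_S by lra. field. lra. }
assert (R4 : real_gamma (a - 2) = real_gamma a / ((a - 1) * (a - 2))).
{ replace (real_gamma a) with ((a - 1) * real_gamma (a - 1)) by (rewrite R3; field; lra).
  replace (a - 1) with (a - 2 + 1) at 2 by ring. rewrite real_gamma_S by lra. field. lra. }
assert (Hq : is_RInt_gen (fun t => 3 * Rabs b * (Rpower t (a - 1) * exp (- (1 * t)) * q (t / a)))
  (at_right 0) (Rbar_locally p_infty)
  (3 * Rabs b * (real_gamma a * (e + (/ a + (a + 2) / ((a - 1) * (a - 2))) / (2 * e))))).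
{ apply (is_RInt_gen_scal (V := R_NormedModule)).
  (* [q (t / a)] is a combination of [t^2, t, 1, 1/t, 1/t^2]; each power shifts the parameter of the
     density, giving [real_gamma] from [a + 2] down to [a - 2], which is why [2 < a] is assumed. *)
  replace (real_gamma a * (e + (/ a + (a + 2) / ((a - 1) * (a - 2))) / (2 * e)))
   with (plus (scal (e + / e) (real_gamma a)) (plus (scal (/ (2 * e * (a * a))) (real_gamma (a + 2)))
     (plus (scal (- / (e * a)) (real_gamma (a + 1))) (plus (scal (a * a / (2 * e)) (real_gamma (a - 2)))
       (scal (- a / e) (real_gamma (a - 1))))))).
  2: { rewrite R1, R2, R3, R4. unfold plus, scal; simpl. unfold mult; simpl. field. lra. }
  assert (Hs : forall c x, 0 < x -> is_RInt_gen (fun t => scal c (Rpower t (x - 1) * exp (- (1 * t))))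
    (at_right 0) (Rbar_locally p_infty) (scal c (real_gamma x))).
  { intros c x Hx. apply (is_RInt_gen_scal (V := R_NormedModule)). now apply real_gamma_correct. }
  assert (P0 : 0 < a) by lra. assert (P2 : 0 < a + 2) by lra. assert (P1 : 0 < a + 1) by lra.
  assert (Q2 : 0 < a - 2) by lra. assert (Q1 : 0 < a - 1) by lra.
  pose proof (is_RInt_gen_plus (V := R_NormedModule) _ _ _ _ (Hs (e + / e) a P0)
   (is_RInt_gen_plus (V := R_NormedModule) _ _ _ _ (Hs (/ (2 * e * (a * a))) (a + 2) P2)
    (is_RInt_gen_plus (V := R_NormedModule) _ _ _ _ (Hs (- / (e * a)) (a + 1) P1)
     (is_RInt_gen_plus (V := R_NormedModule) _ _ _ _ (Hs (a * a / (2 * e)) (a - 2) Q2)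
      (Hs (- a / e) (a - 1) Q1))))) as Hsum.
  revert Hsum. apply (is_RInt_gen_ext (V := R_NormedModule)).
  generalize (range_prod range_half_line). apply filter_imp. intros [x y] [Hx Hy] t Ht; simpl in Hx, Hy.
  assert (Ht0 : 0 < t) by (apply (range_between range_half_line x y t Hx Hy); simpl in Ht; lra).
  unfold plus, scal; simpl. unfold mult; simpl. unfold q.
  replace (a + 2 - 1) with (a - 1 + 1 + 1) by ring. replace (a + 1 - 1) with (a - 1 + 1) by ring.
  replace (a - 2 - 1) with (a - 1 + - (1) + - (1)) by ring.
  replace (a - 1 - 1) with (a - 1 + - (1)) by ring.
  rewrite !Rpower_plus, Rpower_Ropp, Rpower_1 by exact Ht0. field. lra. }
assert (H1 := Gamma_integral_correct (a, b) ltac:(simpl; lra)).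
assert (H2 := is_CRInt_gen_scal range_half_line (cpow a (0, b)) _ _
   (is_CRInt_gen_RtoC range_half_line _ _ (real_gamma_correct a ltac:(lra)))).
refine (is_CRInt_gen_norm range_half_line _ _ _ _ _ (is_CRInt_gen_minus range_half_line _ _ _ _ H1 H2) Hq).
intros t Ht. cbv beta.
assert (E : (cpow t ((a, b) - 1) * exp (- t) - cpow a (0, b) * RtoC (Rpower t (a - 1) * exp (- (1 * t))))%C
  = (cpow a (0, b) * RtoC (Rpower t (a - 1) * exp (- (1 * t))) * (Cexp (0, b * ln (t / a))%R - 1))%C).
{ replace ((a, b) - 1)%C with (RtoC (a - 1) + (0, b))%C by (apply C_eq; simpl; ring).
  rewrite cpow_plus, cpow_RtoC, RtoC_mult, Rmult_1_l.
  assert (Ec : cpow t (0, b) = (cpow a (0, b) * Cexp (0, (b * ln (t / a))%R))%C).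
  { unfold cpow. rewrite <- Cexp_plus. f_equal. unfold Rdiv. rewrite ln_mult, ln_Rinv.
    - apply C_eq; simpl; ring.
    - lra.
    - exact Ht.
    - apply Rinv_0_lt_compat; lra. }
  rewrite Ec. ring. }
rewrite E, !Cmod_mult, Cmod_cpow, Cmod_R. simpl (Re (0, b)).
assert (E1 : Rpower a 0 = 1) by (apply Rpower_O; lra). rewrite E1, Rmult_1_l.
assert (Hw : 0 <= Rpower t (a - 1) * exp (- (1 * t))).
{ apply Rmult_le_pos; left; [apply Rpower_pos|apply exp_pos]. }
rewrite Rabs_pos_eq by exact Hw.
replace (3 * Rabs b * (Rpower t (a - 1) * exp (- (1 * t)) * q (t / a)))
  with (Rpower t (a - 1) * exp (- (1 * t)) * (3 * (Rabs b * q (t / a)))) by ring.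
apply Rmult_le_compat_l; [exact Hw|].
eapply Rle_trans; [apply Cmod_Cexp_imag_minus_1|]. rewrite Rabs_mult.
apply Rmult_le_compat_l; [lra|]. apply Rmult_le_compat_l; [apply Rabs_pos|].
apply Rabs_ln_AMGM; [|exact He]. apply Rdiv_lt_0_compat; lra.
Qed.

(** A zero would make the concentration error at least [real_gamma a], the modulus of the main
    term. *)
Lemma Gamma_integral_neq_0_large (a b : R) : 2 < a -> 72 * ((Rabs b + 1) * (Rabs b + 1)) + 10 < a ->
  Gamma_integral (a, b) <> RtoC 0.
Proof.
intros Ha2 Ha E. set (B := Rabs b + 1) in *. pose proof (Rabs_pos b).
(* Once the variance term, at most [4/a/(2e)], is below [e], the error is below [3 B * 2 e = 1]
   times [real_gamma a]. The condition [2/a < e^2] reads [a > 72 B^2]. *)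
set (e := / (6 * B)). assert (HB : 0 < B) by (unfold B; lra).
assert (He : 0 < e) by (apply Rinv_0_lt_compat; lra).
pose proof (Gamma_integral_concentration a b e Ha2 He) as Hc. rewrite E in Hc.
replace (0 - cpow a (0, b) * RtoC (real_gamma a))%C with (- (cpow a (0, b) * RtoC (real_gamma a)))%C in Hc by ring.
rewrite Cmod_opp, Cmod_mult, Cmod_cpow, Cmod_R in Hc. simpl (Re (0, b)) in Hc.
rewrite Rpower_O in Hc by lra.
pose proof (real_gamma_pos a ltac:(lra)) as Hg. rewrite Rabs_pos_eq, Rmult_1_l in Hc by lra.
assert (Hs : / a + (a + 2) / ((a - 1) * (a - 2)) <= 4 / a).
{ apply Rmult_le_reg_r with (a * ((a - 1) * (a - 2))); [repeat apply Rmult_lt_0_compat; lra|].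
  replace ((/ a + (a + 2) / ((a - 1) * (a - 2))) * (a * ((a - 1) * (a - 2))))
    with ((a - 1) * (a - 2) + (a + 2) * a) by (field; lra).
  replace (4 / a * (a * ((a - 1) * (a - 2)))) with (4 * ((a - 1) * (a - 2))) by (field; lra).
  nra. }
assert (Hq : e + (/ a + (a + 2) / ((a - 1) * (a - 2))) / (2 * e) < 2 * e).
{ assert ((/ a + (a + 2) / ((a - 1) * (a - 2))) / (2 * e) < e); [|lra].
  apply Rle_lt_trans with (4 / a / (2 * e)).
  - apply Rmult_le_compat_r; [left; apply Rinv_0_lt_compat; lra|exact Hs].
  - apply Rmult_lt_reg_r with (2 * e * a); [repeat apply Rmult_lt_0_compat; lra|].
    replace (4 / a / (2 * e) * (2 * e * a)) with 4 by (field; lra).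
    replace (e * (2 * e * a)) with (2 * a * (e * e)) by ring.
    unfold e. apply Rmult_lt_reg_r with (6 * B * (6 * B)); [nra|].
    replace (2 * a * (/ (6 * B) * / (6 * B)) * (6 * B * (6 * B))) with (2 * a) by (field; lra).
    nra. }
assert (Hf : 3 * Rabs b * (real_gamma a * (e + (/ a + (a + 2) / ((a - 1) * (a - 2))) / (2 * e)))
  <= 3 * B * (real_gamma a * (2 * e))).
{ assert (H0 : 0 <= e + (/ a + (a + 2) / ((a - 1) * (a - 2))) / (2 * e)).
  { assert (0 < / a) by (apply Rinv_0_lt_compat; lra).
    assert (0 < (a + 2) / ((a - 1) * (a - 2))) by (apply Rdiv_lt_0_compat; [lra|apply Rmult_lt_0_compat; lra]).
    assert (0 < (/ a + (a + 2) / ((a - 1) * (a - 2))) / (2 * e)) by (apply Rdiv_lt_0_compat; lra). lra. }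
  apply Rmult_le_compat; try lra.
  - apply Rmult_le_pos; lra.
  - unfold B; lra.
  - apply Rmult_le_compat_l; lra. }
assert (3 * B * (real_gamma a * (2 * e)) = real_gamma a) by (unfold e; field; lra).
assert (Hstrict : real_gamma a < real_gamma a); [|lra].
eapply Rle_lt_trans; [exact Hc|].
(* For [b = 0] the error bound is 0, below the positive [real_gamma a]; otherwise strictness comes
   from [Hq]. *)
destruct (Req_dec (Rabs b) 0) as [E0|E0].
- rewrite E0, Rmult_0_r, Rmult_0_l. exact Hg.
- rewrite <- H0 at 2. apply Rlt_le_trans with (3 * Rabs b * (real_gamma a * (2 * e))).
  + apply Rmult_lt_compat_l; [lra|]. apply Rmult_lt_compat_l; [exact Hg|exact Hq].
  + apply Rmult_le_compat_r; [nra|unfold B; lra].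
Qed.

Lemma rising_Gamma_integral (s : C) (n : nat) : 0 < Re s ->
  Gamma_integral (s + RtoC (INR n))%C = (rising s n * Gamma_integral s)%C.
Proof.
intros Hs. induction n.
- simpl. rewrite Cplus_0_r. ring.
- rewrite S_INR, RtoC_plus, Cplus_assoc, Gamma_integral_S, IHn.
  + simpl. ring.
  + rewrite re_plus, re_RtoC. pose proof (pos_INR n). lra.
Qed.

(** By the functional equation a zero at [s] gives zeros at all [s + n], whose imaginary part is
    fixed while the real part grows past the threshold of the previous lemma. *)
Lemma Gamma_integral_neq_0 (s : C) : 0 < Re s -> Gamma_integral s <> RtoC 0.
Proof.
intros Hs E. destruct s as [a b]. simpl in Hs.
destruct (INR_unbounded (72 * ((Rabs b + 1) * (Rabs b + 1)) + 12)) as [n Hn].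
pose proof (rising_Gamma_integral (a, b) n Hs) as Hr. rewrite E, Cmult_0_r in Hr.
revert Hr. replace ((a, b) + RtoC (INR n))%C with (a + INR n, b)%R by (apply C_eq; simpl; ring).
pose proof (Rabs_pos b).
apply Gamma_integral_neq_0_large; nra.
Qed.

Lemma rising_plus (s : C) (m n : nat) :
  rising s (m + n) = (rising s m * rising (s + RtoC (INR m)) n)%C.
Proof.
induction n.
- rewrite Nat.add_0_r. simpl. ring.
- rewrite Nat.add_succ_r. simpl. rewrite IHn, plus_INR, RtoC_plus. ring.
Qed.

Definition Gamma_pole (s : C) : Prop := exists k : nat, s = RtoC (- INR k).

Lemma rising_neq_0 (s : C) (n : nat) : ~ Gamma_pole s -> rising s n <> RtoC 0.
Proof.
intros Hs. induction n; simpl.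
- apply C1_nz.
- apply Cmult_neq_0; [exact IHn|]. intros E. apply Hs. exists n.
  replace s with (s + RtoC (INR n) - RtoC (INR n))%C by ring. rewrite E, RtoC_opp. ring.
Qed.

(** Frees [Gamma] from the least shift in its definition: admissible shifts [m] and [m + k] are
    linked by [rising_plus] and the functional equation. *)
Lemma Gamma_rising (s : C) (n : nat) : ~ Gamma_pole s -> 0 < Re s + INR n ->
  (Gamma s * rising s n)%C = Gamma_integral (s + RtoC (INR n))%C.
Proof.
intros Hs Hn. unfold Gamma. set (N := Z.to_nat (up (- Re s))).
destruct (archimed (- Re s)) as [A1 A2].
assert (HN : 0 < Re s + INR N).
{ unfold N. rewrite INR_IZR_INZ.
  destruct (Z.le_gt_cases 0 (up (- Re s))) as [H|H].
  - rewrite Z2Nat.id by exact H. lra.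
  (* Here [Z.to_nat] truncates to 0, but then [Re s] is already positive. *)
  - assert (IZR (up (- Re s)) <= -1) by (apply IZR_le; lia).
    pose proof (IZR_le 0 (Z.of_nat (Z.to_nat (up (- Re s)))) (Nat2Z.is_nonneg _)). lra. }
pose proof (rising_neq_0 s N Hs) as HrN. pose proof (rising_neq_0 s n Hs) as Hrn.
assert (Hkey : forall m k, 0 < Re s + INR m ->
  (Gamma_integral (s + RtoC (INR m)) / rising s m * rising s (m + k))%C
    = Gamma_integral (s + RtoC (INR (m + k)))%C).
{ intros m k Hm. rewrite plus_INR, RtoC_plus, Cplus_assoc, (rising_Gamma_integral (s + RtoC (INR m))), rising_plus.
  - field. now apply rising_neq_0.
  - rewrite re_plus, re_RtoC. exact Hm. }
destruct (Nat.le_ge_cases N n) as [H|H].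
- replace n with (N + (n - N))%nat by lia. now apply Hkey.
- specialize (Hkey n (N - n)%nat Hn). replace (n + (N - n))%nat with N in Hkey by lia.
  rewrite <- Hkey. field. split; assumption.
Qed.

Lemma Gamma_neq_0 (s : C) : ~ Gamma_pole s -> Gamma s <> RtoC 0.
Proof.
intros Hs E. destruct (INR_unbounded (- Re s)) as [n Hn].
assert (Hp : 0 < Re s + INR n) by lra.
pose proof (Gamma_rising s n Hs Hp) as H. rewrite E, Cmult_0_l in H.
apply (Gamma_integral_neq_0 (s + RtoC (INR n))%C).
- rewrite re_plus, re_RtoC. exact Hp.
- symmetry. exact H.
Qed.

(** * Goursat's lemma on rectangles *)

Definition Cint (f : R -> C) (a b : R) : C := RInt (V := C_R_CompleteNormedModule) f a b.

Lemma Cint_correct (f : R -> C) (a b : R) :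
  (forall t, Rmin a b <= t <= Rmax a b -> curve_continuous f t) -> is_CRInt f a b (Cint f a b).
Proof.
intros H. apply (RInt_correct (V := C_R_CompleteNormedModule)).
apply (ex_RInt_continuous (V := C_R_CompleteNormedModule)). exact H.
Qed.

Lemma Cint_unique (f : R -> C) (a b : R) (l : C) : is_CRInt f a b l -> Cint f a b = l.
Proof. apply (is_RInt_unique (V := C_R_CompleteNormedModule)). Qed.

Lemma Cint_Chasles (f : R -> C) (a b c : R) : a <= b <= c ->
  (forall t, a <= t <= c -> curve_continuous f t) ->
  Cint f a c = (Cint f a b + Cint f b c)%C.
Proof.
intros Habc H. symmetry.
apply (RInt_Chasles (V := C_R_CompleteNormedModule) f a b c);
  apply (ex_RInt_continuous (V := C_R_CompleteNormedModule)); intros t;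
  rewrite Rmin_left, Rmax_right by lra; intros Ht; apply H; lra.
Qed.

Lemma Cint_norm_le (f : R -> C) (a b M : R) : a <= b ->
  (forall t, a <= t <= b -> curve_continuous f t) ->
  (forall t, a <= t <= b -> Cmod (f t) <= M) -> Cmod (Cint f a b) <= (b - a) * M.
Proof.
intros Hab Hc HM. apply (is_CRInt_norm_const f a b M _ Hab HM). apply Cint_correct.
rewrite Rmin_left, Rmax_right by lra. exact Hc.
Qed.

Lemma Cint_minus (f g : R -> C) (a b : R) : a <= b ->
  (forall t, a <= t <= b -> curve_continuous f t) ->
  (forall t, a <= t <= b -> curve_continuous g t) ->
  Cint (fun t => f t - g t)%C a b = (Cint f a b - Cint g a b)%C.
Proof.
intros Hab Hf Hg. apply Cint_unique. apply (is_RInt_minus (V := C_R_NormedModule));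
apply Cint_correct; rewrite Rmin_left, Rmax_right by lra; assumption.
Qed.

Lemma is_curve_derive_horizontal (x y : R) : is_curve_derive (fun u => (u, y)) x (RtoC 1).
Proof.
apply is_curve_derive_pair; simpl.
- apply (is_derive_id (K := R_AbsRing)).
- apply (is_derive_const (K := R_AbsRing) (V := R_NormedModule)).
Qed.

Lemma is_curve_derive_vertical (x y : R) : is_curve_derive (fun u => (x, u)) y Ci.
Proof.
apply is_curve_derive_pair; simpl.
- apply (is_derive_const (K := R_AbsRing) (V := R_NormedModule)).
- apply (is_derive_id (K := R_AbsRing)).
Qed.

(** The counterclockwise contour integral: [a, b] are abscissae, [c, d] ordinates, and [Ci] is the
    velocity on vertical sides. *)
Definition rect_integral (h : C -> C) (a b c d : R) : C :=
  (Cint (fun x => h (x, c)) a b - Cint (fun x => h (x, d)) a b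
   + Ci * (Cint (fun y => h (b, y)) c d - Cint (fun y => h (a, y)) c d))%C.

Definition rect_derivable (h : C -> C) (a b c d : R) : Prop :=
  forall x y, a <= x <= b -> c <= y <= d -> Cderivable h (x, y).

Lemma horizontal_continuous (h : C -> C) (x y : R) :
  Cderivable h (x, y) -> curve_continuous (fun u => h (u, y)) x.
Proof.
intros H. apply (curve_continuous_comp h (fun u => (u, y))); [exact H|].
eapply curve_derive_continuous, is_curve_derive_horizontal.
Qed.

Lemma vertical_continuous (h : C -> C) (x y : R) :
  Cderivable h (x, y) -> curve_continuous (fun u => h (x, u)) y.
Proof.
intros H. apply (curve_continuous_comp h (fun u => (x, u))); [exact H|].
eapply curve_derive_continuous, is_curve_derive_vertical.
Qed.

Lemma rect_integral_quarter (h : C -> C) (a m b c n d : R) : a <= m <= b -> c <= n <= d ->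
  rect_derivable h a b c d ->
  rect_integral h a b c d =
  (rect_integral h a m c n + rect_integral h m b c n
   + rect_integral h a m n d + rect_integral h m b n d)%C.
Proof.
intros Hm Hn H. unfold rect_integral.
assert (Hh : forall y, c <= y <= d ->
  Cint (fun x => h (x, y)) a b = (Cint (fun x => h (x, y)) a m + Cint (fun x => h (x, y)) m b)%C).
{ intros y Hy. apply Cint_Chasles; [exact Hm|]. intros x Hx. apply horizontal_continuous. now apply H. }
assert (Hv : forall x, a <= x <= b ->
  Cint (fun y => h (x, y)) c d = (Cint (fun y => h (x, y)) c n + Cint (fun y => h (x, y)) n d)%C).
{ intros x Hx. apply Cint_Chasles; [exact Hn|]. intros y Hy. apply vertical_continuous. now apply H. }
rewrite !Hh, !Hv by lra. ring.
Qed.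

Lemma rect_integral_primitive (H h : C -> C) (a b c d : R) :
  (forall z, is_Cderive H z (h z)) -> (forall z, Cderivable h z) -> rect_integral h a b c d = 0.
Proof.
intros HH Hh. unfold rect_integral.
assert (Eh : forall y, Cint (fun x => h (x, y)) a b = (H (b, y) - H (a, y))%C).
{ intros y. apply Cint_unique. apply (is_CRInt_derive (fun x => H (x, y))).
  - intros t _. rewrite <- (Cmult_1_l (h (t, y))).
    apply (is_curve_derive_comp H (fun u => (u, y))); [apply HH|apply is_curve_derive_horizontal].
  - intros t _. apply horizontal_continuous. apply Hh. }
assert (Ev : forall x, (Ci * Cint (fun y => h (x, y)) c d)%C = (H (x, d) - H (x, c))%C).
{ intros x. transitivity (Cint (fun y => Ci * h (x, y))%C c d).
  { symmetry. apply Cint_unique. apply is_CRInt_scal. apply Cint_correct.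
    intros t _. apply vertical_continuous. apply Hh. }
  apply Cint_unique. apply (is_CRInt_derive (fun y => H (x, y))).
  - intros t _. apply (is_curve_derive_comp H (fun u => (x, u))); [apply HH|apply is_curve_derive_vertical].
  - intros t _. apply curve_continuous_mult; [apply curve_continuous_const|].
    apply vertical_continuous. apply Hh. }
rewrite !Eh.
replace (Ci * (Cint (fun y => h (b, y)) c d - Cint (fun y => h (a, y)) c d))%C
  with (Ci * Cint (fun y => h (b, y)) c d - Ci * Cint (fun y => h (a, y)) c d)%C by ring.
rewrite !Ev. ring.
Qed.

(** Allows the tangent of [h] at a point to be subtracted for free in Goursat's argument. *)
Lemma rect_integral_affine (p q : C) (a b c d : R) :
  rect_integral (fun z => p + q * z)%C a b c d = 0.
Proof.
apply (rect_integral_primitive (fun z => p * z + q * (z * z) * / 2)%C).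
- intros z.
  pose proof (is_Cderive_plus _ _ z _ _
    (is_Cderive_mult _ _ z _ _ (is_Cderive_const p z) (is_Cderive_id z))
    (is_Cderive_mult _ _ z _ _ (is_Cderive_mult _ _ z _ _ (is_Cderive_const q z)
       (is_Cderive_mult _ _ z _ _ (is_Cderive_id z) (is_Cderive_id z))) (is_Cderive_const (/ 2)%C z))) as H.
  cbv beta in H.
  match type of H with is_derive _ _ ?l => replace l with (p + q * z)%C in H by field end.
  exact H.
- intros z. apply Cderivable_plus; [apply Cderivable_const|].
  apply Cderivable_mult; [apply Cderivable_const|apply Cderivable_id].
Qed.

Lemma rect_integral_minus (h g : C -> C) (a b c d : R) : a <= b -> c <= d ->
  rect_derivable h a b c d -> rect_derivable g a b c d ->
  rect_integral (fun z => h z - g z)%C a b c d = (rect_integral h a b c d - rect_integral g a b c d)%C.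
Proof.
intros Hab Hcd Hh Hg. unfold rect_integral.
rewrite !(Cint_minus (fun x => h (x, _)) (fun x => g (x, _))) by
  first [assumption | intros; apply horizontal_continuous; first [apply Hh | apply Hg]; lra].
rewrite !(Cint_minus (fun y => h (_, y)) (fun y => g (_, y))) by
  first [assumption | intros; apply vertical_continuous; first [apply Hh | apply Hg]; lra].
ring.
Qed.

Lemma rect_integral_bound (h : C -> C) (a b c d M : R) : a <= b -> c <= d ->
  rect_derivable h a b c d ->
  (forall x y, a <= x <= b -> c <= y <= d -> Cmod (h (x, y)) <= M) ->
  Cmod (rect_integral h a b c d) <= 2 * ((b - a) + (d - c)) * M.
Proof.
intros Hab Hcd Hh HM. unfold rect_integral.
assert (Eh : forall y, c <= y <= d -> Cmod (Cint (fun x => h (x, y)) a b) <= (b - a) * M).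
{ intros y Hy. apply Cint_norm_le; [exact Hab| |].
  - intros; apply horizontal_continuous; now apply Hh.
  - intros; now apply HM. }
assert (Ev : forall x, a <= x <= b -> Cmod (Cint (fun y => h (x, y)) c d) <= (d - c) * M).
{ intros x Hx. apply Cint_norm_le; [exact Hcd| |].
  - intros; apply vertical_continuous; now apply Hh.
  - intros; now apply HM. }
eapply Rle_trans; [apply Cmod_triangle|].
rewrite Cmod_mult, Cmod_Ci, Rmult_1_l.
eapply Rle_trans; [apply Rplus_le_compat; apply Cmod_sub_le|].
pose proof (Eh c ltac:(lra)). pose proof (Eh d ltac:(lra)).
pose proof (Ev a ltac:(lra)). pose proof (Ev b ltac:(lra)). lra.
Qed.

Section Goursat.

Variables (h : C -> C) (a c w v : R).
Hypothesis (Hw : 0 <= w) (Hv : 0 <= v) (Hh : rect_derivable h a (a + w) c (c + v)).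

Let width (n : nat) : R := w / 2 ^ n.
Let height (n : nat) : R := v / 2 ^ n.
Let piece (n : nat) (p : R * R) : C :=
  rect_integral h (fst p) (fst p + width n) (snd p) (snd p + height n).
Let inside (n : nat) (p : R * R) : Prop :=
  a <= fst p /\ fst p + width n <= a + w /\ c <= snd p /\ snd p + height n <= c + v.
Let refines (n : nat) (p p' : R * R) : Prop :=
  (fst p <= fst p' /\ fst p' + width (S n) <= fst p + width n) /\
  (snd p <= snd p' /\ snd p' + height (S n) <= snd p + height n) /\
  Cmod (piece n p) / 4 <= Cmod (piece (S n) p').

Let width_S n : width n = 2 * width (S n).
Proof. unfold width. simpl. field. apply pow_nonzero; lra. Qed.
Let height_S n : height n = 2 * height (S n).
Proof. unfold height. simpl. field. apply pow_nonzero; lra. Qed.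
Let width_pos n : 0 <= width n.
Proof. unfold width. apply Rmult_le_pos; [exact Hw|]. left. apply Rinv_0_lt_compat, pow_lt. lra. Qed.
Let height_pos n : 0 <= height n.
Proof. unfold height. apply Rmult_le_pos; [exact Hv|]. left. apply Rinv_0_lt_compat, pow_lt. lra. Qed.

(** If each of the four quarters carried less than a quarter of the modulus, the triangle inequality
    would contradict additivity. *)
Let refine_ex (n : nat) (p : R * R) : inside n p -> exists p', refines n p p'.
Proof.
intros Hp. unfold inside in Hp. pose proof (width_S n) as E1. pose proof (height_S n) as E2.
pose proof (width_pos (S n)) as P1. pose proof (height_pos (S n)) as P2.
destruct p as [x y]; simpl in Hp.
assert (Hq := rect_integral_quarter h x (x + width (S n)) (x + width n)
  y (y + height (S n)) (y + height n) ltac:(lra) ltac:(lra)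
  ltac:(intros s t Hs Ht; apply Hh; lra)).
apply NNPP. intros Hno.
assert (Hlt : forall x' y', x' = x \/ x' = x + width (S n) -> y' = y \/ y' = y + height (S n) ->
  Cmod (piece (S n) (x', y')) < Cmod (piece n (x, y)) / 4).
{ intros x' y' Hx Hy. apply Rnot_le_lt. intros Hle. apply Hno. exists (x', y').
  unfold refines; simpl. split; [destruct Hx; subst; lra|]. split; [destruct Hy; subst; lra|exact Hle]. }
pose proof (Hlt x y (or_introl eq_refl) (or_introl eq_refl)) as L1.
pose proof (Hlt _ y (or_intror eq_refl) (or_introl eq_refl)) as L2.
pose proof (Hlt x _ (or_introl eq_refl) (or_intror eq_refl)) as L3.
pose proof (Hlt _ _ (or_intror eq_refl) (or_intror eq_refl)) as L4.
unfold piece in *; simpl in L1, L2, L3, L4.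
replace (x + width (S n) + width (S n)) with (x + width n) in * by lra.
replace (y + height (S n) + height (S n)) with (y + height n) in * by lra.
rewrite Hq in L1, L2, L3, L4.
set (q1 := rect_integral h x (x + width (S n)) y (y + height (S n))) in *.
set (q2 := rect_integral h (x + width (S n)) (x + width n) y (y + height (S n))) in *.
set (q3 := rect_integral h x (x + width (S n)) (y + height (S n)) (y + height n)) in *.
set (q4 := rect_integral h (x + width (S n)) (x + width n) (y + height (S n)) (y + height n)) in *.
pose proof (Cmod_triangle (q1 + q2 + q3) q4). pose proof (Cmod_triangle (q1 + q2) q3).
pose proof (Cmod_triangle q1 q2). lra.
Qed.

(** A refinement exists only for rectangles inside the given one, so the choice is made blindly by
    [epsilon] and justified afterwards by the induction in [corner_inside]. *)
Let corner : nat -> R * R :=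
  fix corner n := match n with
  | O => (a, c)
  | S k => epsilon (inhabits (0, 0)) (refines k (corner k))
  end.

Let corner_inside (n : nat) : inside n (corner n).
Proof.
induction n.
- unfold inside, width, height; simpl. unfold Rdiv. rewrite Rinv_1, !Rmult_1_r. lra.
- assert (Hr : refines n (corner n) (corner (S n))).
  { simpl. apply epsilon_spec. now apply refine_ex. }
  unfold inside, refines in *. lra.
Qed.

Let corner_refines (n : nat) : refines n (corner n) (corner (S n)).
Proof. simpl. apply epsilon_spec. apply refine_ex. apply corner_inside. Qed.

Let corner_mono (n k : nat) :
  fst (corner n) <= fst (corner (k + n)) /\ fst (corner (k + n)) + width (k + n) <= fst (corner n) + width n /\
  snd (corner n) <= snd (corner (k + n)) /\ snd (corner (k + n)) + height (k + n) <= snd (corner n) + height n.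
Proof.
induction k.
- simpl. lra.
- pose proof (corner_refines (k + n)) as Hr. unfold refines in Hr.
  change (S k + n)%nat with (S (k + n)). lra.
Qed.

(** The supremum of the left ends lies in all the nested intervals. *)
Let nested_limit (u l : nat -> R) :
  (forall n k, u n <= u (k + n)%nat /\ u (k + n)%nat <= u n + l n) -> (forall n, 0 <= l n) ->
  exists x, forall n, u n <= x <= u n + l n.
Proof.
intros H Hl.
destruct (completeness (fun y => exists n, y = u n)) as [x [Hub Hlub]].
- exists (u O + l O). intros y [n ->]. destruct (H O n) as [_ H2]. now rewrite Nat.add_0_r in H2.
- exists (u O). now exists O.
- exists x. intros n. split; [apply Hub; now exists n|].
  apply Hlub. intros y [m ->]. destruct (Nat.le_ge_cases n m) as [Hnm|Hnm].
  + destruct (H n (m - n)%nat) as [_ H2]. now replace (m - n + n)%nat with m in H2 by lia.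
  + destruct (H m (n - m)%nat) as [H2 _]. replace (n - m + m)%nat with n in H2 by lia.
    pose proof (Hl n). lra.
Qed.

Let piece_lower (n : nat) : Cmod (piece O (a, c)) / 4 ^ n <= Cmod (piece n (corner n)).
Proof.
induction n.
- simpl. lra.
- destruct (corner_refines n) as (_ & _ & Hr). eapply Rle_trans; [|exact Hr].
  simpl pow. unfold Rdiv. rewrite Rinv_mult, (Rmult_comm (/ 4)), <- Rmult_assoc.
  apply Rmult_le_compat_r; [lra|exact IHn].
Qed.

Lemma goursat_corner : rect_integral h a (a + w) c (c + v) = 0.
Proof.
assert (E0 : rect_integral h a (a + w) c (c + v) = piece O (a, c)).
{ unfold piece, width, height; simpl. unfold Rdiv. now rewrite Rinv_1, !Rmult_1_r. }
rewrite E0. apply Cmod_eq_0.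
destruct (nested_limit (fun n => fst (corner n)) width) as [x Hx]; [|exact width_pos|].
{ intros n k. pose proof (corner_mono n k). pose proof (width_pos (k + n)). lra. }
destruct (nested_limit (fun n => snd (corner n)) height) as [y Hy]; [|exact height_pos|].
{ intros n k. pose proof (corner_mono n k). pose proof (height_pos (k + n)). lra. }
destruct (Hh x y) as [l Hl].
{ specialize (Hx O). unfold width in Hx; simpl in Hx. unfold Rdiv in Hx. rewrite Rinv_1 in Hx. lra. }
{ specialize (Hy O). unfold height in Hy; simpl in Hy. unfold Rdiv in Hy. rewrite Rinv_1 in Hy. lra. }
apply Rle_antisym; [|apply Cmod_ge_0]. apply Rnot_lt_le. intros Hpos.
set (J := Cmod (piece 0 (a, c))) in *. set (S := w + v + 1).
assert (HS : 0 < S) by (unfold S; lra).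
(* Chosen so that the upper bound [2 eps (S/2^n)^2] is half of the lower bound [J/4^n]. The summand
   1 in [S] keeps it positive for degenerate rectangles. *)
set (eps := J / (4 * (S * S))).
assert (HSS : 0 < S * S) by nra.
assert (Heps : 0 < eps) by (apply Rdiv_lt_0_compat; lra).
destruct (proj1 (is_Cderive_eps _ _ _) Hl eps Heps) as (del & Hdel & Hd).
assert (Hn : exists n, S / 2 ^ n < del).
{ destruct (pow_lt_1_zero (/ 2) ltac:(rewrite Rabs_pos_eq; lra) (del / S)) as [n Hn].
  { apply Rdiv_lt_0_compat; lra. }
  exists n. specialize (Hn n (Nat.le_refl n)). rewrite Rabs_pos_eq in Hn.
  - rewrite pow_inv in Hn. apply Rmult_lt_reg_l with (/ S); [now apply Rinv_0_lt_compat|].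
    replace (/ S * (S / 2 ^ n)) with (/ 2 ^ n) by (field; split; [apply pow_nonzero|]; lra).
    replace (/ S * del) with (del / S) by (field; lra). exact Hn.
  - apply pow_le. lra. }
destruct Hn as [n Hn].
set (px := fst (corner n)). set (py := snd (corner n)).
assert (Hin := corner_inside n). unfold inside in Hin. fold px py in Hin.
specialize (Hx n). specialize (Hy n). cbv beta in Hx, Hy. fold px in Hx. fold py in Hy.
assert (Hsum : width n + height n <= S / 2 ^ n).
{ unfold width, height, S, Rdiv.
  assert (0 < / 2 ^ n) by (apply Rinv_0_lt_compat, pow_lt; lra). nra. }
assert (Hsub : rect_derivable h px (px + width n) py (py + height n)).
{ intros s t Hs Ht. apply Hh; lra. }
(* [p + l * z] is the tangent of [h] at the common point of all the rectangles; only its first-order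
   error, at most [eps] times the half perimeter, contributes to the integral. *)
set (p := (h (x, y) - l * (x, y))%C).
assert (Haff : rect_derivable (fun z => p + l * z)%C px (px + width n) py (py + height n)).
{ intros s t _ _. apply Cderivable_plus; [apply Cderivable_const|].
  apply Cderivable_mult; [apply Cderivable_const|apply Cderivable_id]. }
assert (Hup : Cmod (piece n (corner n)) <= 2 * (width n + height n) * (eps * (width n + height n))).
{ unfold piece. fold px py.
  replace (rect_integral h px (px + width n) py (py + height n))
   with (rect_integral (fun z => h z - (p + l * z))%C px (px + width n) py (py + height n)).
  2: { rewrite rect_integral_minus, rect_integral_affine; [ring| | |exact Hsub|exact Haff].
       - pose proof (width_pos n); lra.
       - pose proof (height_pos n); lra. }
  replace (2 * (width n + height n)) with (2 * ((px + width n - px) + (py + height n - py))) by ring.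
  apply rect_integral_bound.
  - pose proof (width_pos n); lra.
  - pose proof (height_pos n); lra.
  - intros s t Hs Ht. apply Cderivable_minus; [now apply Hsub|now apply Haff].
  - intros s t Hs Ht.
    assert (Hm : Cmod ((s, t) - (x, y))%C <= width n + height n).
    { eapply Rle_trans; [apply Cmod_ReIm|]. simpl.
      apply Rplus_le_compat; apply Rabs_le; lra. }
    specialize (Hd ((s, t) - (x, y))%C ltac:(lra)).
    assert (E : forall u z : C, (u + (z - u))%C = z) by (intros; ring). rewrite E in Hd.
    replace (h (s, t) - (p + l * (s, t)))%C with (h (s, t) - h (x, y) - ((s, t) - (x, y)) * l)%C
      by (unfold p; ring).
    eapply Rle_trans; [exact Hd|]. apply Rmult_le_compat_l; lra. }
pose proof (piece_lower n) as Hlow. fold J in Hlow.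
assert (Hfin : J / 4 ^ n <= 2 * eps * ((S / 2 ^ n) * (S / 2 ^ n))).
{ eapply Rle_trans; [exact Hlow|]. eapply Rle_trans; [exact Hup|].
  replace (2 * (width n + height n) * (eps * (width n + height n)))
    with (2 * eps * ((width n + height n) * (width n + height n))) by ring.
  apply Rmult_le_compat_l; [lra|].
  pose proof (width_pos n). pose proof (height_pos n). apply Rmult_le_compat; lra. }
replace (2 * eps * (S / 2 ^ n * (S / 2 ^ n))) with (J / 2 / 4 ^ n) in Hfin.
- assert (H4 : 0 < 4 ^ n) by (apply pow_lt; lra).
  apply Rmult_le_compat_r with (r := 4 ^ n) in Hfin; [|lra].
  unfold Rdiv in Hfin. rewrite !Rmult_assoc, Rinv_l in Hfin by lra. lra.
- unfold eps. replace (4 ^ n) with (2 ^ n * 2 ^ n) by (rewrite <- Rpow_mult_distr; f_equal; ring).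
  field. split; [apply pow_nonzero; lra|lra].
Qed.

End Goursat.

Lemma goursat (h : C -> C) (a b c d : R) : a <= b -> c <= d ->
  rect_derivable h a b c d -> rect_integral h a b c d = 0.
Proof.
intros Hab Hcd Hh. replace b with (a + (b - a)) by ring. replace d with (c + (d - c)) by ring.
apply goursat_corner; try lra.
replace (a + (b - a)) with b by ring. replace (c + (d - c)) with d by ring. exact Hh.
Qed.

(** * The identity theorem on half-planes *)

(** Continuity gives Riemann integrability, and a Riemann integrable function is bounded. *)
Lemma curve_bounded (f : R -> C) (a b : R) : a <= b ->
  (forall t, a <= t <= b -> curve_continuous f t) ->
  exists M, 0 <= M /\ forall t, a <= t <= b -> Cmod (f t) <= M.
Proof.
intros Hab Hf.
assert (Hex : ex_RInt (V := C_R_CompleteNormedModule) f a b).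
{ apply (ex_RInt_continuous (V := C_R_CompleteNormedModule)).
  rewrite Rmin_left, Rmax_right by exact Hab. exact Hf. }
destruct (ex_RInt_ub (V := C_R_NormedModule) f a b Hex) as [M HM].
rewrite Rmin_left, Rmax_right in HM by exact Hab.
exists M. assert (HM' : forall t, a <= t <= b -> Cmod (f t) <= M).
{ intros t Ht. specialize (HM t Ht). now rewrite norm_C_R in HM. }
split; [|exact HM'].
eapply Rle_trans; [apply Cmod_ge_0|apply (HM' a); lra].
Qed.

Lemma exp_opp_le_inv (y : R) : 0 < y -> exp (- y) <= / y.
Proof.
intros Hy. rewrite exp_Ropp. apply Rinv_le_contravar; [exact Hy|].
pose proof (exp_ineq1_le y). lra.
Qed.

Lemma exp_le (x y : R) : x <= y -> exp x <= exp y.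
Proof. intros [H| ->]; [left; now apply exp_increasing|right; reflexivity]. Qed.

Lemma Cmod_gauss (l x y : R) : Cmod (Cexp (RtoC l * ((x, y) * (x, y)))%C) = exp (l * (x * x - y * y)).
Proof. rewrite Cmod_Cexp. f_equal. simpl. ring. Qed.

(* Integrating [F(w) exp(l w^2)] around a rectangle whose left side is centred at [0] and whose
   right side lies where [F] vanishes: the kernel peaks at [0] on the left side and is
   exponentially small, as [l] grows, on the horizontal sides. *)
Lemma zero_propagates_left (F : C -> C) (L : R) : 0 <= L ->
  (forall w, 0 <= Re w -> Cderivable F w) -> (forall w, L < Re w -> F w = 0) -> F 0 = 0.
Proof.
intros HL HF Hz. apply Cmod_eq_0. apply Rle_antisym; [|apply Cmod_ge_0].
(* [A > L] makes [F] vanish on the right side, and [T = A + 1] makes [x^2 - T^2 <= -1] on the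
   horizontal sides, so the kernel is at most [exp(-l)] there. *)
apply Rnot_lt_le. intros Hpos. set (A := L + 1). set (T := L + 2).
set (kern := fun l w => Cexp (RtoC l * (w * w))%C).
assert (Hkern : forall l w, Cderivable (kern l) w).
{ intros l w. unfold kern. apply Cderivable_comp; [apply Cderivable_Cexp|].
  apply Cderivable_mult; [apply Cderivable_const|]. apply Cderivable_mult; apply Cderivable_id. }
assert (Hcv : forall x y, 0 <= x -> curve_continuous (fun u => F (x, u)) y).
{ intros x y Hx. apply vertical_continuous. apply HF. exact Hx. }
assert (Hch : forall x y, 0 <= x -> curve_continuous (fun u => F (u, y)) x).
{ intros x y Hx. apply horizontal_continuous. apply HF. exact Hx. }
destruct (curve_bounded (fun x => F (x, -T)) 0 A) as (M1 & HM1 & B1); [unfold A; lra|intros; apply Hch; lra|].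
destruct (curve_bounded (fun x => F (x, T)) 0 A) as (M2 & HM2 & B2); [unfold A; lra|intros; apply Hch; lra|].
destruct (curve_bounded (fun y => F (0, y)) (-T) T) as (M3 & HM3 & B3); [unfold T; lra|intros; apply Hcv; lra|].
destruct (proj1 (curve_continuous_eps _ _) (Hcv 0 0 (Rle_refl 0)) (Cmod (F 0) / 2)) as (eta0 & Heta0 & Hnear); [lra|].
set (eta := Rmin 1 (eta0 / 2)).
assert (He0 : 0 < eta) by (apply Rmin_pos; lra).
assert (He1 : eta <= 1) by apply Rmin_l.
assert (He2 : eta < eta0) by (pose proof (Rmin_r 1 (eta0 / 2)); unfold eta; lra).
set (c := Cmod (F 0)) in *.
set (K := A * M1 + A * M2 + 2 * T * M3 + 1).
assert (HK : 0 < K) by (unfold K, A, T in *; assert (0 <= A * M1) by (unfold A; nra);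
  assert (0 <= A * M2) by (unfold A; nra); unfold A in *; nra).
(* The rate [q] lies below the gap [eta^2 - eta^2/4] between the decay of the tails and that of the
   central mass. The size of [l] gives [K/(l q) = c eta/4], which contradicts the final inequality
   [c/2 eta <= K exp(-l q)]. *)
set (q := eta * eta / 2). assert (Hq : 0 < q) by (unfold q; nra).
set (l := 4 * K / (c * eta * q)).
assert (Hl : 0 < l) by (unfold l; apply Rdiv_lt_0_compat; [lra|]; repeat apply Rmult_lt_0_compat; lra).
set (f := fun y => (F (0, y) * kern l (0, y))%C).
assert (Hfc : forall y, curve_continuous f y).
{ intros y. apply curve_continuous_mult; [apply Hcv; lra|]. apply vertical_continuous. apply Hkern. }
assert (Hfb : forall y, -T <= y <= T -> Cmod (f y) <= M3 * exp (- (l * (y * y)))).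
{ intros y Hy. unfold f, kern. rewrite Cmod_mult, Cmod_gauss.
  replace (l * (0 * 0 - y * y)) with (- (l * (y * y))) by ring.
  apply Rmult_le_compat_r; [left; apply exp_pos|now apply B3]. }
assert (Hleft : Cmod (Cint f (- T) T) <= (A * M1 + A * M2) * exp (- l)).
{ assert (Hg := goursat (fun w => F w * kern l w)%C 0 A (- T) T ltac:(unfold A; lra) ltac:(unfold T; lra)
    ltac:(intros x y Hx Hy; apply Cderivable_mult; [apply HF; simpl; lra|apply Hkern])).
  unfold rect_integral in Hg. cbv beta in Hg. fold f in Hg.
  assert (Hright : Cint (fun y => F (A, y) * kern l (A, y))%C (- T) T = 0).
  { apply Cint_unique. apply (is_RInt_ext (V := C_R_NormedModule) (fun _ => RtoC 0)).
    - intros y _. rewrite Hz by (simpl; unfold A; lra). now rewrite Cmult_0_l.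
    - pose proof (is_RInt_const (V := C_R_NormedModule) (- T) T (RtoC 0)) as H0.
      change (scal (T - - T) (RtoC 0)) with (scal (V := C_R_ModuleSpace) (T - - T) (RtoC 0)) in H0.
      rewrite scal_R_Cmult, Cmult_0_r in H0. exact H0. }
  rewrite Hright in Hg.
  assert (Hh : forall y M, y = T \/ y = - T -> (forall x, 0 <= x <= A -> Cmod (F (x, y)) <= M) ->
    Cmod (Cint (fun x => F (x, y) * kern l (x, y))%C 0 A) <= A * M * exp (- l)).
  { intros y M Hy HM. replace (A * M * exp (- l)) with ((A - 0) * (M * exp (- l))) by ring.
    apply Cint_norm_le; [unfold A; lra| |].
    - intros x Hx. apply curve_continuous_mult; [apply Hch; lra|]. apply horizontal_continuous. apply Hkern.
    - intros x Hx. unfold kern. rewrite Cmod_mult, Cmod_gauss.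
      apply Rmult_le_compat; [apply Cmod_ge_0|left; apply exp_pos|now apply HM|].
      apply exp_le. assert (x * x - y * y <= - (1)); [|nra].
      replace (y * y) with (T * T) by (destruct Hy; subst y; ring).
      unfold T. unfold A in Hx. nra. }
  pose proof (Hh (- T) M1 (or_intror eq_refl) B1) as E1.
  pose proof (Hh T M2 (or_introl eq_refl) B2) as E2.
  set (I1 := Cint (fun x => F (x, (- T)%R) * kern l (x, (- T)%R))%C 0 A) in *.
  set (I2 := Cint (fun x => F (x, T) * kern l (x, T))%C 0 A) in *.
  assert (E : (Ci * Cint f (- T)%R T)%C = (I1 - I2)%C).
  { replace (Ci * Cint f (- T)%R T)%C with ((I1 - I2) - (I1 - I2 + Ci * (0 - Cint f (- T)%R T)))%C by ring.
    rewrite Hg. ring. }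
  replace (Cmod (Cint f (- T)%R T)) with (Cmod (Ci * Cint f (- T)%R T)%C)
    by (rewrite Cmod_mult, Cmod_Ci; ring).
  rewrite E. eapply Rle_trans; [apply Cmod_sub_le|]. lra. }
assert (HTe : eta < T) by (unfold T; lra).
assert (Hsplit : Cint f (- T) T = (Cint f (- T)%R (- eta)%R + (Cint f (- eta)%R eta + Cint f eta T))%C).
{ rewrite (Cint_Chasles f (- T) (- eta) T), (Cint_Chasles f (- eta) eta T); try lra; intros; try apply Hfc.
  reflexivity. }
assert (Htail : forall y, -T <= y <= T -> eta * eta <= y * y -> Cmod (f y) <= M3 * exp (- (l * (eta * eta)))).
{ intros y Hy Hyy. eapply Rle_trans; [now apply Hfb|]. apply Rmult_le_compat_l; [exact HM3|].
  apply exp_le. nra. }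
assert (T1 : Cmod (Cint f (- T) (- eta)) <= T * M3 * exp (- (l * (eta * eta)))).
{ apply Rle_trans with ((- eta - - T) * (M3 * exp (- (l * (eta * eta))))).
  - apply Cint_norm_le; [lra|intros; apply Hfc|]. intros y Hy. apply Htail; [lra|].
    replace (y * y) with (- y * - y) by ring. apply Rmult_le_compat; lra.
  - pose proof (exp_pos (- (l * (eta * eta)))).
    assert (0 <= M3 * exp (- (l * (eta * eta)))) by (apply Rmult_le_pos; lra). nra. }
assert (T2 : Cmod (Cint f eta T) <= T * M3 * exp (- (l * (eta * eta)))).
{ apply Rle_trans with ((T - eta) * (M3 * exp (- (l * (eta * eta))))).
  - apply Cint_norm_le; [lra|intros; apply Hfc|]. intros y Hy. apply Htail; [lra|]. apply Rmult_le_compat; lra.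
  - pose proof (exp_pos (- (l * (eta * eta)))).
    assert (0 <= M3 * exp (- (l * (eta * eta)))) by (apply Rmult_le_pos; lra). nra. }
assert (Hmid : Cmod (Cint f (- eta) eta) <= K * exp (- (l * (eta * eta)))).
{ replace (Cint f (- eta) eta) with (Cint f (- T)%R T - Cint f (- T)%R (- eta)%R - Cint f eta T)%C
    by (rewrite Hsplit; ring).
  eapply Rle_trans; [apply Cmod_sub_le|]. eapply Rle_trans; [apply Rplus_le_compat_r, Cmod_sub_le|].
  assert (exp (- l) <= exp (- (l * (eta * eta)))) by (apply exp_le;
    assert (eta * eta <= 1 * 1) by (apply Rmult_le_compat; lra);
    assert (l * (eta * eta) <= l * 1) by (apply Rmult_le_compat_l; lra); lra).
  pose proof (exp_pos (- (l * (eta * eta)))).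
  assert (0 <= A * M1 + A * M2) by (unfold A; nra).
  assert ((A * M1 + A * M2) * exp (- l) <= (A * M1 + A * M2) * exp (- (l * (eta * eta)))) by
    (apply Rmult_le_compat_l; assumption).
  unfold K. lra. }
set (g := fun y : R => exp (- (l * (y * y)))).
assert (Hgc : forall y, continuous g y).
{ intros y. apply (ex_derive_continuous (V := R_NormedModule)). unfold g. auto_derive. exact I. }
assert (Hgint : is_RInt g (- eta) eta (RInt g (- eta) eta)).
{ apply (RInt_correct (V := R_CompleteNormedModule)). apply (ex_RInt_continuous (V := R_CompleteNormedModule)).
  intros; apply Hgc. }
set (G := RInt g (- eta) eta) in *.
(* Near 0 the value of [F] is within [c/2] of [F 0], so the central integral has modulus at least
   [c/2 * G]. *)
assert (Hcenter : Cmod (F 0 * RtoC G - Cint f (- eta)%R eta)%C <= c / 2 * G).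
{ rewrite <- norm_C_R.
  apply (norm_RInt_le (V := C_R_NormedModule) (fun y => F 0%R * RtoC (g y) - f y)%C (fun y => c / 2 * g y) (- eta) eta).
  - lra.
  - intros y Hy. rewrite norm_C_R. unfold f.
    replace (kern l (0, y)) with (RtoC (g y)).
    2: { unfold kern, g. replace (RtoC l * ((0, y) * (0, y)))%C with (RtoC (- (l * (y * y))))
          by (apply C_eq; simpl; ring). symmetry. apply Cexp_RtoC. }
    replace (F 0 * RtoC (g y) - F (0, y) * RtoC (g y))%C with (- (F (0, y) - F 0) * RtoC (g y))%C by ring.
    rewrite Cmod_mult, Cmod_opp, Cmod_R, (Rabs_pos_eq (g y)) by (left; apply exp_pos).
    apply Rmult_le_compat_r; [left; apply exp_pos|]. left. apply Hnear.
    rewrite Rminus_0_r. apply Rle_lt_trans with eta; [apply Rabs_le; lra|exact He2].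
  - apply (is_RInt_minus (V := C_R_NormedModule)).
    + apply is_CRInt_scal. apply is_CRInt_RtoC. exact Hgint.
    + apply Cint_correct. intros; apply Hfc.
  - apply (is_RInt_scal (V := R_NormedModule)). exact Hgint. }
(* Only [|y| <= eta/2] is kept; the kernel is larger there than on the tails by a factor exponential
   in [l]. *)
assert (HG : eta * exp (- (l * (eta * eta / 4))) <= G).
{ assert (Hin : is_RInt g (- (eta / 2)) (eta / 2) (RInt g (- (eta / 2)) (eta / 2))).
  { apply (RInt_correct (V := R_CompleteNormedModule)). apply (ex_RInt_continuous (V := R_CompleteNormedModule)).
    intros; apply Hgc. }
  assert (Hch2 : forall x y z, RInt g x y + RInt g y z = RInt g x z).
  { intros. apply (RInt_Chasles (V := R_CompleteNormedModule) g);
    apply (ex_RInt_continuous (V := R_CompleteNormedModule)); intros; apply Hgc. }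
  assert (Hge : forall x y, x <= y -> 0 <= RInt g x y).
  { intros x y Hxy. apply RInt_ge_0; [exact Hxy| |intros; left; apply exp_pos].
    apply (ex_RInt_continuous (V := R_CompleteNormedModule)); intros; apply Hgc. }
  assert (Hinner : eta * exp (- (l * (eta * eta / 4))) <= RInt g (- (eta / 2)) (eta / 2)).
  { apply (is_RInt_le (fun _ => exp (- (l * (eta * eta / 4)))) g (- (eta / 2)) (eta / 2)); [lra| |exact Hin|].
    - replace (eta * exp (- (l * (eta * eta / 4)))) with (scal (eta / 2 - - (eta / 2)) (exp (- (l * (eta * eta / 4))))).
      + apply (is_RInt_const (V := R_NormedModule)).
      + unfold scal; simpl. unfold mult; simpl. field.
    - intros y Hy. unfold g. apply exp_le.
      assert (0 <= (eta / 2 - y) * (eta / 2 + y)) by (apply Rmult_le_pos; lra).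
      assert (l * (y * y) <= l * (eta * eta / 4)) by (apply Rmult_le_compat_l; lra). lra. }
  pose proof (Hch2 (- eta) (- (eta / 2)) eta). pose proof (Hch2 (- (eta / 2)) (eta / 2) eta).
  pose proof (Hge (- eta) (- (eta / 2)) ltac:(lra)). pose proof (Hge (eta / 2) eta ltac:(lra)).
  unfold G. lra. }
assert (HGpos : 0 < G) by (eapply Rlt_le_trans; [|exact HG]; apply Rmult_lt_0_compat; [lra|apply exp_pos]).
assert (Hmain : c / 2 * G <= K * exp (- (l * (eta * eta)))).
{ assert (c * G <= Cmod (Cint f (- eta) eta) + c / 2 * G); [|lra].
  replace (c * G) with (Cmod (F 0 * RtoC G)%C).
  2: { rewrite Cmod_mult, Cmod_R, Rabs_pos_eq by lra. reflexivity. }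
  replace (F 0 * RtoC G)%C with (Cint f (- eta)%R eta + (F 0 * RtoC G - Cint f (- eta)%R eta))%C by ring.
  eapply Rle_trans; [apply Cmod_triangle|]. lra. }
assert (Hexp : c / 2 * eta <= K * exp (- (l * q))).
{ apply Rmult_le_reg_r with (exp (- (l * (eta * eta / 4)))); [apply exp_pos|].
  apply Rle_trans with (c / 2 * G).
  - rewrite Rmult_assoc. apply Rmult_le_compat_l; lra.
  - eapply Rle_trans; [exact Hmain|]. rewrite Rmult_assoc. apply Rmult_le_compat_l; [lra|].
    rewrite <- exp_plus. apply exp_le. unfold q.
    assert (0 <= l * (eta * eta)) by (apply Rmult_le_pos; [lra|apply Rle_0_sqr]). lra. }
pose proof (exp_opp_le_inv (l * q) (Rmult_lt_0_compat _ _ Hl Hq)) as Hi.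
assert (K * exp (- (l * q)) <= K * / (l * q)) by (apply Rmult_le_compat_l; lra).
assert (K * / (l * q) = c * eta / 4) by (unfold l; field; repeat split; lra).
assert (0 < c * eta) by (apply Rmult_lt_0_compat; lra). lra.
Qed.

(** With [s] translated to the origin, the difference vanishes as soon as [Re w > |Re s|], and its
    zeros propagate left to [w = 0]. *)
Lemma half_plane_identity (f g : C -> C) (B : R) :
  (forall s, - B < Re s -> Cderivable f s) -> (forall s, - B < Re s -> Cderivable g s) ->
  (forall s, 0 < Re s -> f s = g s) -> forall s, - B < Re s -> f s = g s.
Proof.
intros Hf Hg Hfg s Hs.
assert (H : (f (s + 0) - g (s + 0))%C = 0).
{ apply (zero_propagates_left (fun w => f (s + w) - g (s + w))%C (Rabs (Re s))).
  - apply Rabs_pos.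
  - intros w Hw. assert (Hsw : - B < Re (s + w)%C) by (rewrite re_plus; lra).
    apply Cderivable_minus.
    + apply (Cderivable_comp f (fun w => s + w)%C); [now apply Hf|].
      apply Cderivable_plus; [apply Cderivable_const|apply Cderivable_id].
    + apply (Cderivable_comp g (fun w => s + w)%C); [now apply Hg|].
      apply Cderivable_plus; [apply Cderivable_const|apply Cderivable_id].
  - intros w Hw. rewrite Hfg; [ring|]. rewrite re_plus.
    pose proof (Rle_abs (- Re s)). rewrite Rabs_Ropp in H. lra. }
rewrite Cplus_0_r in H. now apply Ceq_minus.
Qed.

Lemma entire_identity (f g : C -> C) : entire f -> entire g ->
  (forall s, 0 < Re s -> f s = g s) -> forall s, f s = g s.
Proof.
intros Hf Hg Hfg s. apply (half_plane_identity f g (Rabs (Re s) + 1)); try assumption.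
- intros; apply Hf.
- intros; apply Hg.
- pose proof (Rle_abs (- Re s)). rewrite Rabs_Ropp in H. lra.
Qed.

(** * Continuation of Mellin transforms *)

(** Sums the indices below [n], whereas [sum_n] includes [n]; this accounts for the [S N] in the
    convergence lemmas. *)
Fixpoint Csum (a : nat -> C) (n : nat) : C :=
  match n with
  | O => RtoC 0
  | S k => (Csum a k + a k)%C
  end.

Lemma Csum_S (a : nat -> C) (n : nat) : Csum a (S n) = (Csum a n + a n)%C.
Proof. reflexivity. Qed.

Lemma Csum_ext (a b : nat -> C) (n : nat) :
  (forall k, (k < n)%nat -> a k = b k) -> Csum a n = Csum b n.
Proof.
induction n; intros H; simpl; [reflexivity|].
rewrite IHn by (intros; apply H; lia). now rewrite H by lia.
Qed.

Lemma Csum_plus (a b : nat -> C) (n : nat) :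
  Csum (fun k => a k + b k)%C n = (Csum a n + Csum b n)%C.
Proof. induction n; simpl; [ring|]. rewrite IHn. ring. Qed.

Lemma Csum_scal (c : C) (a : nat -> C) (n : nat) : Csum (fun k => c * a k)%C n = (c * Csum a n)%C.
Proof. induction n; simpl; [ring|]. rewrite IHn. ring. Qed.

Lemma Csum_0 (a : nat -> C) (n : nat) : (forall k, (k < n)%nat -> a k = 0) -> Csum a n = 0.
Proof.
induction n; intros H; simpl; [reflexivity|].
rewrite IHn by (intros; apply H; lia). rewrite H by lia. ring.
Qed.

Definition poly_sum (p : nat -> C) (N : nat) (t : R) : C := Csum (fun k => p k * RtoC (t ^ k))%C N.

(** An asymptotic expansion only: [K] may depend on [N], and convergence of the series is not asked
    for. *)
Definition taylor_at_0 (F : R -> C) (p : nat -> C) (d : R) : Prop :=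
  forall N, exists K, forall t, 0 < t <= d -> Cmod (F t - poly_sum p N t)%C <= K * t ^ N.

Lemma curve_continuous_pow (k : nat) (t : R) : curve_continuous (fun t => RtoC (t ^ k)) t.
Proof.
apply curve_continuous_RtoC, (ex_derive_continuous (V := R_NormedModule)). auto_derive. exact I.
Qed.

Lemma curve_continuous_poly_sum (p : nat -> C) (N : nat) (t : R) : curve_continuous (poly_sum p N) t.
Proof.
unfold poly_sum. induction N; simpl; [apply curve_continuous_const|].
apply (curve_continuous_plus (poly_sum p N)); [exact IHN|].
apply curve_continuous_mult; [apply curve_continuous_const|apply curve_continuous_pow].
Qed.

Lemma is_CRInt_gen_monomial (s : C) (k : nat) (y : R) : 0 < y -> 0 < Re s + INR k ->
  is_CRInt_gen (fun t => cpow t (s - 1) * RtoC (t ^ k))%C (at_right 0) (at_point y)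
    (cpow y (s + RtoC (INR k)) / (s + RtoC (INR k)))%C.
Proof.
intros Hy Hs. set (u := (s + RtoC (INR k))%C).
assert (Hu : 0 < Re u) by (unfold u; rewrite re_plus, re_RtoC; exact Hs).
assert (Hu0 : u <> 0) by (intros E; rewrite E in Hu; simpl in Hu; lra).
replace (cpow y u / u)%C with (/ u * (cpow y u - 0))%C by (field; exact Hu0).
apply (is_CRInt_gen_ext (range_left y Hy) (fun t => / u * (u * cpow t (u - 1)))%C).
{ intros t Ht. rewrite <- (cpow_INR t k) by lra. rewrite <- cpow_plus.
  replace (s - 1 + RtoC (INR k))%C with (u - 1)%C by (unfold u; ring). field. exact Hu0. }
apply (is_CRInt_gen_scal (range_left y Hy)).
apply (is_RInt_gen_primitive (range_left y Hy) C_R_CompleteNormedModule (fun t => cpow t u)).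
- intros t Ht. apply is_curve_derive_cpow. lra.
- intros t Ht. apply curve_continuous_mult; [apply curve_continuous_const|apply curve_continuous_cpow; lra].
- apply (filterlim_C_0 _ _ (fun t => Rpower t (Re u))); [|now apply Rpower_lim_0].
  generalize (range_l _ _ _ (range_left y Hy)). apply filter_imp. intros t Ht.
  rewrite Cmod_cpow. apply Rle_refl.
- intros P HP. apply locally_singleton in HP. exact HP.
Qed.

(** The quotient of [rising s n] by [s + k], written without division so that it also makes sense at
    [s = -k]. *)
Fixpoint rising_except (k : nat) (s : C) (n : nat) : C :=
  match n with
  | O => RtoC 1
  | S j => (rising_except k s j * (if Nat.eq_dec j k then 1 else s + RtoC (INR j)))%C
  end.

Lemma rising_except_ge (k n : nat) (s : C) : (n <= k)%nat -> rising_except k s n = rising s n.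
Proof.
induction n; intros H; simpl; [reflexivity|].
rewrite IHn by lia. destruct (Nat.eq_dec n k); [lia|reflexivity].
Qed.

Lemma rising_except_mult (k n : nat) (s : C) : (k < n)%nat ->
  rising s n = (rising_except k s n * (s + RtoC (INR k)))%C.
Proof.
induction n; intros H; [lia|]. simpl. destruct (Nat.eq_dec n k) as [->|Hn].
- rewrite rising_except_ge by lia. ring.
- rewrite IHn by lia. ring.
Qed.

(** Keeping [(k - n)!] on the left as a factor makes the induction on [n] free of divisions. *)
Lemma rising_opp_INR (k n : nat) : (n <= k)%nat ->
  (rising (RtoC (- INR k)) n * RtoC (INR (fact (k - n))))%C = RtoC ((-1) ^ n * INR (fact k)).
Proof.
induction n; intros H.
- simpl. rewrite Nat.sub_0_r. rewrite Cmult_1_l. f_equal. ring.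
- specialize (IHn ltac:(lia)). replace (k - n)%nat with (S (k - S n)) in IHn by lia.
  rewrite fact_simpl, mult_INR, S_INR, minus_INR, S_INR in IHn by lia.
  simpl rising. simpl pow.
  replace ((-1) * (-1) ^ n * INR (fact k)) with (- ((-1) ^ n * INR (fact k))) by ring.
  rewrite (RtoC_opp ((-1) ^ n * INR (fact k))), <- IHn. rewrite !RtoC_mult, RtoC_plus, RtoC_minus, RtoC_plus, RtoC_opp. ring.
Qed.

Lemma rising_opp_INR_full (k : nat) :
  rising (RtoC (- INR k)) k = RtoC ((-1) ^ k * INR (fact k)).
Proof. rewrite <- (rising_opp_INR k k) by lia. rewrite Nat.sub_diag. simpl. ring. Qed.

Lemma Cderivable_rising (n : nat) (s : C) : Cderivable (fun s => rising s n) s.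
Proof.
induction n; simpl; [apply Cderivable_const|].
apply Cderivable_mult; [exact IHn|]. apply Cderivable_plus; [apply Cderivable_id|apply Cderivable_const].
Qed.

Lemma Cderivable_rising_except (k n : nat) (s : C) : Cderivable (fun s => rising_except k s n) s.
Proof.
induction n; simpl; [apply Cderivable_const|].
apply Cderivable_mult; [exact IHn|]. destruct (Nat.eq_dec n k); [apply Cderivable_const|].
apply Cderivable_plus; [apply Cderivable_id|apply Cderivable_const].
Qed.

Lemma Cderivable_Csum (a : nat -> C -> C) (n : nat) (s : C) :
  (forall k, Cderivable (a k) s) -> Cderivable (fun s => Csum (fun k => a k s) n) s.
Proof.
intros H. induction n; simpl; [apply Cderivable_const|].
apply Cderivable_plus; [exact IHn|apply H].
Qed.

Section Continuation.

Variables (F : R -> C) (p : nat -> C) (d : R).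
Hypotheses (HF : decays F) (Hd : 0 < d) (Ht : taylor_at_0 F p d).

Definition mellin_remainder (N : nat) (s : C) : C :=
  mellin (at_right 0) (at_point d) (fun t => F t - poly_sum p N t)%C s.

(** Hadamard's finite part of the integral over (0, d): the Taylor polynomial is integrated
    formally, by the formula that is correct for [Re s > 0]. *)
Definition mellin_finite_part (N : nat) (s : C) : C :=
  (mellin_remainder N s
   + Csum (fun k => p k * (cpow d (s + RtoC (INR k)) / (s + RtoC (INR k)))) N)%C.

Definition mellin_upper (s : C) : C := mellin (at_point d) (Rbar_locally p_infty) F s.

(** The finite part plus the upper integral, times [1/Gamma(s) = rising s N / Gamma(s + N)], with
    every pole [s + k] cancelled in advance; the formula is holomorphic on [Re s > -N], poles of
    Gamma included. *)
Definition continuation (N : nat) (s : C) : C :=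
  ((rising s N * (mellin_remainder N s + mellin_upper s)
    + Csum (fun k => p k * (cpow d (s + RtoC (INR k)) * rising_except k s N)) N)
   / Gamma_integral (s + RtoC (INR N)))%C.

Lemma remainder_continuous (N : nat) (t : R) :
  0 < t <= d -> curve_continuous (fun t => F t - poly_sum p N t)%C t.
Proof.
intros H. apply curve_continuous_minus; [apply HF; lra|apply curve_continuous_poly_sum].
Qed.

Lemma mellin_remainder_correct (N : nat) (s : C) : 0 < Re s + INR N ->
  is_CRInt_gen (fun t => cpow t (s - 1) * (F t - poly_sum p N t))%C (at_right 0) (at_point d)
    (mellin_remainder N s).
Proof.
intros Hs. destruct (Ht N) as [K HK].
apply (is_CRInt_gen_left_bound _ s d K N Hd Hs); [apply remainder_continuous|exact HK].
Qed.

Lemma Cderivable_mellin_remainder (N : nat) (s : C) : 0 < Re s + INR N ->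
  Cderivable (mellin_remainder N) s.
Proof.
intros Hs. destruct (Ht N) as [K HK].
apply (Cderivable_mellin_left _ s d K N Hd Hs); [apply remainder_continuous|exact HK].
Qed.

Lemma Cderivable_shift (c s : C) : Cderivable (fun w => w + c)%C s.
Proof. apply Cderivable_plus; [apply Cderivable_id|apply Cderivable_const]. Qed.

Lemma Cderivable_continuation (N : nat) (s : C) : 0 < Re s + INR N -> Cderivable (continuation N) s.
Proof.
intros Hs.
assert (Hp : 0 < Re (s + RtoC (INR N))%C) by (rewrite re_plus, re_RtoC; exact Hs).
apply Cderivable_div.
- apply Cderivable_plus.
  + apply Cderivable_mult; [apply Cderivable_rising|].
    apply Cderivable_plus; [now apply Cderivable_mellin_remainder|now apply Cderivable_mellin_right].
  + apply (Cderivable_Csum (fun k s => p k * (cpow d (s + RtoC (INR k)) * rising_except k s N))%C).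
    intros k. apply Cderivable_mult; [apply Cderivable_const|].
    apply Cderivable_mult; [|apply Cderivable_rising_except].
    apply (Cderivable_comp (cpow d) (fun s => s + RtoC (INR k))%C); [apply Cderivable_cpow|apply Cderivable_shift].
- apply (Cderivable_comp Gamma_integral (fun s => s + RtoC (INR N))%C);
    [now apply Cderivable_Gamma_integral|apply Cderivable_shift].
- now apply Gamma_integral_neq_0.
Qed.

Lemma continuation_numerator (N : nat) (s : C) : (forall k, s + RtoC (INR k) <> 0)%C ->
  (rising s N * (mellin_remainder N s + mellin_upper s)
    + Csum (fun k => p k * (cpow d (s + RtoC (INR k)) * rising_except k s N)) N)%C
  = (rising s N * (mellin_finite_part N s + mellin_upper s))%C.
Proof.
intros Hs.
replace (Csum (fun k => p k * (cpow d (s + RtoC (INR k)) * rising_except k s N)) N)%C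
  with (rising s N * Csum (fun k => p k * (cpow d (s + RtoC (INR k)) / (s + RtoC (INR k)))) N)%C.
- unfold mellin_finite_part. ring.
- rewrite <- Csum_scal. apply Csum_ext. intros k Hk. rewrite (rising_except_mult k N s Hk).
  field. apply Hs.
Qed.

Lemma Gamma_pole_neq (s : C) : ~ Gamma_pole s -> forall k, (s + RtoC (INR k) <> 0)%C.
Proof.
intros Hs k E. apply Hs. exists k.
replace s with (s + RtoC (INR k) - RtoC (INR k))%C by ring. rewrite E, RtoC_opp. ring.
Qed.

Lemma Gamma_pole_Re (s : C) : 0 < Re s -> ~ Gamma_pole s.
Proof. intros Hs [k ->]. rewrite re_RtoC in Hs. pose proof (pos_INR k). lra. Qed.

Lemma continuation_nonpole (N : nat) (s : C) : ~ Gamma_pole s -> 0 < Re s + INR N ->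
  (continuation N s * Gamma s)%C = (mellin_finite_part N s + mellin_upper s)%C.
Proof.
intros Hs HN. unfold continuation.
rewrite continuation_numerator by now apply Gamma_pole_neq.
rewrite <- Gamma_rising by assumption. field. split.
- now apply rising_neq_0.
- now apply Gamma_neq_0.
Qed.

Lemma mellin_finite_part_correct (N : nat) (s : C) : 0 < Re s ->
  is_CRInt_gen (fun t => cpow t (s - 1) * F t)%C (at_right 0) (at_point d) (mellin_finite_part N s).
Proof.
intros Hs.
assert (HsN : forall k, 0 < Re s + INR k) by (intros k; pose proof (pos_INR k); lra).
assert (Hpoly : is_CRInt_gen (fun t => cpow t (s - 1) * poly_sum p N t)%C (at_right 0) (at_point d)
  (Csum (fun k => p k * (cpow d (s + RtoC (INR k)) / (s + RtoC (INR k)))) N)%C).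
{ unfold poly_sum. generalize N. intros n. induction n.
  - simpl. apply (is_CRInt_gen_ext (range_left d Hd) (fun t => 0 * (cpow t (s - 1) * RtoC (t ^ 0)))%C).
    + intros; ring.
    + pose proof (is_CRInt_gen_scal (range_left d Hd) 0 _ _ (is_CRInt_gen_monomial s 0 d Hd (HsN O))) as H0.
      rewrite Cmult_0_l in H0. exact H0.
  - simpl. pose proof (is_CRInt_gen_plus (range_left d Hd) _ _ _ _ IHn
      (is_CRInt_gen_scal (range_left d Hd) (p n) _ _ (is_CRInt_gen_monomial s n d Hd (HsN n)))) as H0.
    revert H0. apply (is_CRInt_gen_ext (range_left d Hd)). intros; cbv beta; ring. }
pose proof (is_CRInt_gen_plus (range_left d Hd) _ _ _ _ (mellin_remainder_correct N s (HsN N)) Hpoly) as H0.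
revert H0. apply (is_CRInt_gen_ext (range_left d Hd)). intros; cbv beta; ring.
Qed.

Lemma continuation_half_line (N : nat) (s : C) : 0 < Re s ->
  (continuation N s * Gamma_integral s)%C = mellin (at_right 0) (Rbar_locally p_infty) F s.
Proof.
intros Hs. pose proof (Gamma_pole_Re s Hs) as Hp.
assert (HN : 0 < Re s + INR N) by (pose proof (pos_INR N); lra).
symmetry. apply (mellin_unique range_half_line).
unfold continuation. rewrite continuation_numerator by now apply Gamma_pole_neq.
rewrite rising_Gamma_integral by exact Hs.
replace (rising s N * (mellin_finite_part N s + mellin_upper s) / (rising s N * Gamma_integral s)
   * Gamma_integral s)%C with (mellin_finite_part N s + mellin_upper s)%C.
2: { field. split; [now apply Gamma_integral_neq_0|now apply rising_neq_0]. }
apply (is_RInt_gen_Chasles (V := C_R_NormedModule) _ d).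
- now apply mellin_finite_part_correct.
- now apply mellin_correct_right.
Qed.

(** Both sides are the Mellin transform over Gamma for [Re s > 0] and are holomorphic on the smaller
    of the two half-planes. *)
Lemma continuation_eq (M N : nat) (s : C) : 0 < Re s + INR M -> 0 < Re s + INR N ->
  continuation M s = continuation N s.
Proof.
intros HM HN.
apply (half_plane_identity (continuation M) (continuation N) (Rmin (INR M) (INR N))).
- intros w Hw. apply Cderivable_continuation. pose proof (Rmin_l (INR M) (INR N)). lra.
- intros w Hw. apply Cderivable_continuation. pose proof (Rmin_r (INR M) (INR N)). lra.
- intros w Hw. pose proof (Gamma_integral_neq_0 w Hw) as Hg.
  replace (continuation M w) with (continuation M w * Gamma_integral w / Gamma_integral w)%C by (field; exact Hg).
  replace (continuation N w) with (continuation N w * Gamma_integral w / Gamma_integral w)%C by (field; exact Hg).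
  now rewrite !continuation_half_line.
- unfold Rmin. destruct (Rle_dec (INR M) (INR N)); lra.
Qed.

(** At [s = -k] with [N = k + 1] the factor [rising] vanishes and so does every term still
    containing [s + k]; only [p k * rising s k] survives, over [Gamma(1) = 1]. *)
Lemma continuation_pole (k : nat) :
  continuation (S k) (RtoC (- INR k)) = (RtoC ((-1) ^ k * INR (fact k)) * p k)%C.
Proof.
unfold continuation. set (s := RtoC (- INR k)).
assert (E0 : (s + RtoC (INR k))%C = 0) by (unfold s; rewrite RtoC_opp; ring).
assert (E1 : (s + RtoC (INR (S k)))%C = 1) by (rewrite S_INR, RtoC_plus, Cplus_assoc, E0; ring).
rewrite E1, Gamma_integral_1.
assert (Er : rising s (S k) = 0) by (simpl; rewrite E0; ring).
rewrite Er.
assert (Es : Csum (fun j => p j * (cpow d (s + RtoC (INR j)) * rising_except j s (S k)))%C (S k)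
  = (p k * rising s k)%C).
{ simpl Csum. rewrite Csum_0.
  - rewrite E0, cpow_0. simpl. rewrite rising_except_ge by lia.
    destruct (Nat.eq_dec k k); [|lia]. ring.
  - intros j Hj. simpl. destruct (Nat.eq_dec k j) as [E|_]; [lia|]. rewrite E0. ring.
}
rewrite Es. unfold s. rewrite rising_opp_INR_full. field.
Qed.

End Continuation.

Lemma mellin_continuation (F : R -> C) (p : nat -> C) (d : R) :
  decays F -> 0 < d -> taylor_at_0 F p d ->
  exists L : C -> C, entire L /\
    (forall s, 0 < Re s -> (L s * Gamma_integral s)%C = mellin (at_right 0) (Rbar_locally p_infty) F s) /\
    (forall N s, ~ Gamma_pole s -> 0 < Re s + INR N ->
       (L s * Gamma s)%C = (mellin_finite_part F p d N s + mellin_upper F d s)%C) /\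
    (forall k, L (RtoC (- INR k)) = (RtoC ((-1) ^ k * INR (fact k)) * p k)%C).
Proof.
intros HF Hd Ht.
assert (Hbig : forall x, exists n, - x < INR n) by (intros x; destruct (INR_unbounded (- x)) as [n Hn]; now exists n).
set (level := fun s : C => proj1_sig (constructive_indefinite_description _ (Hbig (Re s)))).
assert (Hlevel : forall s, 0 < Re s + INR (level s)).
{ intros s. unfold level. destruct (constructive_indefinite_description _ (Hbig (Re s))) as [n Hn]. simpl. lra. }
set (L := fun s => continuation F p d (level s) s).
assert (HL : forall N s, 0 < Re s + INR N -> L s = continuation F p d N s).
{ intros N s HN. unfold L. apply continuation_eq; try assumption. apply Hlevel. }
exists L. split; [|split; [|split]].
(* [level] varies with the point; one extra unit makes a single formula valid on the whole unit disc
   around [s]. *)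
- intros s. apply (Cderivable_ext_near (continuation F p d (S (level s))) L s 1 Rlt_0_1).
  + intros w Hw. symmetry. apply HL. rewrite S_INR. pose proof (Hlevel s).
    pose proof (re_le_Cmod (w - s)%C). unfold Cminus in H0. rewrite re_plus, re_opp in H0.
    pose proof (Rle_abs (- (Re w + - Re s))). rewrite Rabs_Ropp in H1. unfold Cminus in Hw. lra.
  + apply Cderivable_continuation; try assumption. rewrite S_INR. pose proof (Hlevel s). lra.
- intros s Hs. rewrite (HL O s) by (simpl; lra). now apply continuation_half_line.
- intros N s Hs HN. rewrite (HL N s HN). now apply continuation_nonpole.
- intros k. rewrite (HL (S k)).
  + apply continuation_pole.
  + rewrite re_RtoC, S_INR. lra.
Qed.

(** * Taylor expansion on a disc *)

Lemma Cint_scal (c : C) (f : R -> C) (a b : R) :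
  (forall t, Rmin a b <= t <= Rmax a b -> curve_continuous f t) ->
  Cint (fun t => c * f t)%C a b = (c * Cint f a b)%C.
Proof. intros H. apply Cint_unique, is_CRInt_scal, Cint_correct, H. Qed.

Lemma Cint_plus (f g : R -> C) (a b : R) :
  (forall t, Rmin a b <= t <= Rmax a b -> curve_continuous f t) ->
  (forall t, Rmin a b <= t <= Rmax a b -> curve_continuous g t) ->
  Cint (fun t => f t + g t)%C a b = (Cint f a b + Cint g a b)%C.
Proof.
intros Hf Hg. apply Cint_unique. apply (is_RInt_plus (V := C_R_NormedModule)); now apply Cint_correct.
Qed.

Lemma Cint_ext (f g : R -> C) (a b : R) : (forall t, f t = g t) -> Cint f a b = Cint g a b.
Proof. intros H. apply (RInt_ext (V := C_R_CompleteNormedModule)). intros; apply H. Qed.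

Lemma is_curve_derive_Cexp_lin (w : C) (t : R) :
  is_curve_derive (fun u => Cexp (w * RtoC u))%C t (w * Cexp (w * RtoC t))%C.
Proof.
replace (w * Cexp (w * RtoC t))%C with (w * RtoC 1 * Cexp (w * RtoC t))%C by ring.
apply (is_curve_derive_comp Cexp (fun u => w * RtoC u)%C); [apply is_Cderive_Cexp|].
apply is_curve_derive_scal, is_curve_derive_RtoC. apply (is_derive_id (K := R_AbsRing)).
Qed.

Lemma curve_continuous_Cexp_lin (w : C) (t : R) : curve_continuous (fun u => Cexp (w * RtoC u))%C t.
Proof. eapply curve_derive_continuous, is_curve_derive_Cexp_lin. Qed.

Lemma Cexp_2PI_nat (n : nat) : Cexp (- (RtoC (INR n) * Ci) * RtoC (2 * PI))%C = 1.
Proof.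
replace (- (RtoC (INR n) * Ci) * RtoC (2 * PI))%C with (RtoC (INR n) * (- Ci * RtoC (2 * PI)))%C by ring.
rewrite Cexp_nat.
replace (Cexp (- Ci * RtoC (2 * PI))%C) with (RtoC 1); [apply Cpow_1_l|].
replace (- Ci * RtoC (2 * PI))%C with ((0, - (2 * PI)) : C) by (apply C_eq; simpl; ring).
unfold Cexp. simpl Re. simpl Im.
rewrite cos_neg, sin_neg, cos_2PI, sin_2PI, exp_0. apply C_eq; simpl; ring.
Qed.

Lemma curve_continuous_Cpow (f : R -> C) (n : nat) (t : R) :
  curve_continuous f t -> curve_continuous (fun u => f u ^ n)%C t.
Proof.
intros H. induction n; simpl; [apply curve_continuous_const|].
apply curve_continuous_mult; assumption.
Qed.

(** Telescoping over [N] equal steps bounds the total increment by [K/N]. Increments are based at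
    [x > 0] because the application has no control at 0. *)
Lemma quadratic_increments_const (g : R -> C) (K : R) :
  (forall x y, 0 < x <= 1 -> 0 <= y <= 1 -> Cmod (g y - g x)%C <= K * ((y - x) * (y - x))) ->
  g 1 = g 0.
Proof.
intros H. apply Ceq_minus, Cmod_eq_0. apply Rle_antisym; [|apply Cmod_ge_0].
assert (HK : 0 <= K).
{ specialize (H 1 0 ltac:(lra) ltac:(lra)). pose proof (Cmod_ge_0 (g 0 - g 1)%C). lra. }
assert (Hn : forall n, Cmod (g 1%R - g 0%R)%C <= K * / INR (S n)).
{ intros n. set (N := INR (S n)). assert (HN : 0 < N) by apply lt_0_INR, Nat.lt_0_succ.
  assert (Hj : forall j, (j <= S n)%nat -> Cmod (g (INR j / N)%R - g 0%R)%C <= INR j * (K * / (N * N))).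
  { induction j; intros Hle.
    - simpl. unfold Rdiv. rewrite Rmult_0_l. replace (g 0 - g 0)%C with (RtoC 0) by ring. rewrite Cmod_0. lra.
    - specialize (IHj ltac:(lia)).
      assert (Hb : INR (S j) <= N) by (apply le_INR; lia).
      pose proof (pos_INR j). rewrite S_INR in *.
      assert (Hx : 0 < (INR j + 1) / N <= 1).
      { split; [apply Rdiv_lt_0_compat; lra|]. apply Rmult_le_reg_r with N; [lra|].
        unfold Rdiv. rewrite Rmult_assoc, Rinv_l by lra. lra. }
      assert (Hy : 0 <= INR j / N <= 1).
      { split; [apply Rmult_le_pos; [lra|left; now apply Rinv_0_lt_compat]|]. apply Rmult_le_reg_r with N; [lra|].
        unfold Rdiv. rewrite Rmult_assoc, Rinv_l by lra. lra. }
      specialize (H _ _ Hx Hy).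
      replace (INR j / N - (INR j + 1) / N) with (- / N) in H by (field; lra).
      replace (- / N * - / N) with (/ (N * N)) in H by (field; lra).
      replace (g ((INR j + 1) / N)%R - g 0%R)%C
       with (- (g (INR j / N)%R - g ((INR j + 1) / N)%R) + (g (INR j / N)%R - g 0%R))%C by ring.
      eapply Rle_trans; [apply Cmod_triangle|]. rewrite Cmod_opp. lra. }
  specialize (Hj (S n) (Nat.le_refl _)). fold N in Hj.
  replace (N / N) with 1 in Hj by (field; lra).
  replace (N * (K * / (N * N))) with (K * / N) in Hj by (field; lra). exact Hj. }
apply Rnot_lt_le. intros Hpos.
destruct (INR_unbounded (K / Cmod (g 1%R - g 0%R)%C)) as [n Hlt].
specialize (Hn n). rewrite S_INR in Hn.
assert (Hn0 : 0 < INR n + 1) by (pose proof (pos_INR n); lra).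
set (x := Cmod (g 1%R - g 0%R)%C) in *.
apply Rmult_le_compat_r with (r := INR n + 1) in Hn; [|lra].
rewrite Rmult_assoc, Rinv_l in Hn by lra.
apply Rmult_lt_compat_r with (r := x) in Hlt; [|lra].
unfold Rdiv in Hlt. rewrite Rmult_assoc, Rinv_l in Hlt by lra. lra.
Qed.

Section Disc.

Variables (phi dphi : C -> C) (rho d M B : R).
Hypotheses (Hd : 0 <= d) (Hrho : d < rho).
Hypothesis Hphi : forall z, Cmod z <= rho -> is_Cderive phi z (dphi z).
Hypothesis Hdphi : forall z, Cmod z <= rho -> Cderivable dphi z.
Hypothesis HM : forall z h, Cmod z <= rho -> Cmod (z + h)%C <= rho ->
  Cmod (phi (z + h) - phi z - h * dphi z)%C <= M * (Cmod h * Cmod h).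
Hypothesis HB : forall z, Cmod z <= rho -> Cmod (phi z) <= B.

Let circle (th : R) : C := (RtoC rho * Cexp (Ci * RtoC th))%C.
Let inv_circle (th : R) : C := (RtoC (/ rho) * Cexp (- Ci * RtoC th))%C.

Let circle_inv th : (inv_circle th * circle th)%C = 1.
Proof.
unfold inv_circle, circle. replace (- Ci * RtoC th)%C with (- (Ci * RtoC th))%C by ring.
rewrite Cexp_opp, RtoC_inv by lra. field. split; [apply Cexp_neq_0|]. intros E. apply RtoC_inj in E. lra.
Qed.

Let Cmod_circle th : Cmod (circle th) = rho.
Proof.
unfold circle. rewrite Cmod_mult, Cmod_Cexp, Cmod_R, Rabs_pos_eq by lra. simpl.
replace (0 * th - 1 * 0) with 0 by ring. rewrite exp_0. ring.
Qed.

Let Cmod_inv_circle th : Cmod (inv_circle th) = / rho.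
Proof.
unfold inv_circle. rewrite Cmod_mult, Cmod_Cexp, Cmod_R, Rabs_pos_eq.
- simpl. replace (- 0 * th - - (1) * 0) with 0 by ring. rewrite exp_0. ring.
- left. apply Rinv_0_lt_compat. lra.
Qed.

Let circle_continuous th : curve_continuous circle th.
Proof. apply curve_continuous_mult; [apply curve_continuous_const|apply curve_continuous_Cexp_lin]. Qed.

Let inv_circle_continuous th : curve_continuous inv_circle th.
Proof. apply curve_continuous_mult; [apply curve_continuous_const|apply curve_continuous_Cexp_lin]. Qed.

Let phi_circle_continuous th : curve_continuous (fun u => phi (circle u)) th.
Proof.
apply curve_continuous_comp; [|apply circle_continuous]. eexists. apply Hphi.
rewrite Cmod_circle. lra.
Qed.

(** Orthogonality of exponentials: for [n <> 0] the integrand is the derivative of a periodic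
    function. *)
Let Cint_inv_circle_pow (n : nat) :
  Cint (fun th => inv_circle th ^ n)%C 0 (2 * PI) = if Nat.eq_dec n 0 then RtoC (2 * PI) else 0.
Proof.
destruct (Nat.eq_dec n 0) as [->|Hn].
- simpl. apply Cint_unique. pose proof (is_RInt_const (V := C_R_NormedModule) 0 (2 * PI) (RtoC 1)) as H.
  change (scal (2 * PI - 0) (RtoC 1)) with (scal (V := C_R_ModuleSpace) (2 * PI - 0) (RtoC 1)) in H.
  rewrite scal_R_Cmult, Cmult_1_r, Rminus_0_r in H. exact H.
- set (w := (- (RtoC (INR n) * Ci))%C).
  assert (Hw : w <> 0).
  { unfold w. intros E. apply (f_equal Im) in E. simpl in E.
    assert (0 < INR n) by (apply lt_0_INR; lia). lra. }
  set (k := (RtoC (/ rho) ^ n / w)%C).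
  transitivity (Cint (fun th => k * (w * Cexp (w * RtoC th)))%C 0 (2 * PI)).
  + apply Cint_ext. intros th. unfold inv_circle. rewrite Cpow_mult_l, <- Cexp_nat.
    replace (RtoC (INR n) * (- Ci * RtoC th))%C with (w * RtoC th)%C by (unfold w; ring).
    unfold k. field. exact Hw.
  + rewrite Cint_scal.
    2: { intros. apply curve_continuous_mult; [apply curve_continuous_const|apply curve_continuous_Cexp_lin]. }
    replace (Cint (fun th => w * Cexp (w * RtoC th))%C 0 (2 * PI)) with (RtoC 0); [ring|].
    symmetry. apply Cint_unique.
    replace (RtoC 0) with (Cexp (w * RtoC (2 * PI)) - Cexp (w * RtoC 0))%C.
    * apply (is_CRInt_derive (fun th => Cexp (w * RtoC th))%C).
      -- intros; apply is_curve_derive_Cexp_lin.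
      -- intros; apply curve_continuous_mult; [apply curve_continuous_const|apply curve_continuous_Cexp_lin].
    * unfold w. rewrite Cexp_2PI_nat, Cmult_0_r, Cexp_0. ring.
Qed.

Section Point.

Variables (t : R) (Ht : 0 <= t <= d).

Let ratio (th : R) : C := (RtoC t * inv_circle th)%C.
(** The Cauchy kernel [w / (w - t)] at [w = circle th], with the factor [w] of [dw = i w dth]
    included; [kappa] bounds it uniformly for [t <= d]. *)
Let kernel (th : R) : C := (/ (1 - ratio th))%C.
Let kappa : R := / (1 - d / rho).

Let d_rho : 0 <= d / rho < 1.
Proof.
split; [apply Rmult_le_pos; [exact Hd|left; apply Rinv_0_lt_compat; lra]|].
apply Rmult_lt_reg_r with rho; [lra|]. unfold Rdiv. rewrite Rmult_assoc, Rinv_l by lra. lra.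
Qed.

Let Cmod_ratio th : Cmod (ratio th) = t / rho.
Proof. unfold ratio. rewrite Cmod_mult, Cmod_inv_circle, Cmod_R, Rabs_pos_eq by lra. reflexivity. Qed.

Let Cmod_ratio_le th : Cmod (ratio th) <= d / rho.
Proof.
rewrite Cmod_ratio. apply Rmult_le_compat_r; [left; apply Rinv_0_lt_compat; lra|lra].
Qed.

Let denominator_bound th : 1 - d / rho <= Cmod (1 - ratio th)%C.
Proof.
pose proof (Cmod_ge_sub 1 (- ratio th)%C) as H. rewrite Cmod_opp, Cmod_1 in H.
pose proof (Cmod_ratio_le th). unfold Cminus. lra.
Qed.

Let denominator_neq th : (1 - ratio th <> 0)%C.
Proof. apply Cmod_gt_0. pose proof (denominator_bound th). pose proof d_rho. lra. Qed.

Let kernel_bound th : Cmod (kernel th) <= kappa.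
Proof.
unfold kernel, kappa. rewrite Cmod_inv by apply denominator_neq.
pose proof d_rho. apply Rinv_le_contravar; [lra|apply denominator_bound].
Qed.

Let ratio_continuous th : curve_continuous ratio th.
Proof. apply curve_continuous_mult; [apply curve_continuous_const|apply inv_circle_continuous]. Qed.

Let kernel_continuous th : curve_continuous kernel th.
Proof.
apply (curve_continuous_inv (fun th => 1 - ratio th)%C); [apply denominator_neq|].
apply curve_continuous_minus; [apply curve_continuous_const|apply ratio_continuous].
Qed.

(** Finite geometric expansion of the kernel: the error is exactly the integral of
    [psi * ratio^N * kernel]. *)
Let kernel_integral_expansion (psi : R -> C) (Bpsi : R) (N : nat) :
  (forall th, curve_continuous psi th) -> (forall th, Cmod (psi th) <= Bpsi) ->
  Cmod (Cint (fun th => psi th * kernel th)%C 0 (2 * PI)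
    - Csum (fun n => RtoC (t ^ n) * Cint (fun th => psi th * inv_circle th ^ n) 0 (2 * PI)) N)%C
  <= 2 * PI * (Bpsi * ((t / rho) ^ N * kappa)).
Proof.
intros Hc Hb.
assert (Hsum : Cint (fun th => psi th * kernel th)%C 0 (2 * PI)
  = (Csum (fun n => RtoC (t ^ n) * Cint (fun th => psi th * inv_circle th ^ n) 0 (2 * PI)) N
     + Cint (fun th => psi th * (ratio th ^ N * kernel th)) 0 (2 * PI))%C).
{ induction N.
  - simpl. rewrite Cplus_0_l. apply Cint_ext. intros; ring.
  - simpl Csum. rewrite IHN.
    rewrite (Cint_ext (fun th => psi th * (ratio th ^ N * kernel th))%C
      (fun th => RtoC (t ^ N) * (psi th * inv_circle th ^ N) + psi th * (ratio th ^ S N * kernel th))%C).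
    + rewrite Cint_plus, Cint_scal.
      * ring.
      * intros. apply curve_continuous_mult; [apply Hc|]. apply curve_continuous_Cpow, inv_circle_continuous.
      * intros. apply curve_continuous_mult; [apply curve_continuous_const|].
        apply curve_continuous_mult; [apply Hc|]. apply curve_continuous_Cpow, inv_circle_continuous.
      * intros. apply curve_continuous_mult; [apply Hc|]. apply curve_continuous_mult; [|apply kernel_continuous].
        apply (curve_continuous_Cpow ratio (S N)), ratio_continuous.
    + intros th. rewrite RtoC_pow, Cpow_S.
      replace (kernel th) with (1 + ratio th * kernel th)%C at 1 by
        (unfold kernel; field; apply denominator_neq).
      assert (E : (ratio th ^ N)%C = (RtoC t ^ N * inv_circle th ^ N)%C)
        by (unfold ratio; apply Cpow_mult_l).
      rewrite E. ring. }
rewrite Hsum.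
match goal with |- Cmod (?a + ?b - ?a)%C <= _ => replace (a + b - a)%C with b by ring end.
replace (2 * PI * (Bpsi * ((t / rho) ^ N * kappa))) with ((2 * PI - 0) * (Bpsi * ((t / rho) ^ N * kappa))) by ring.
pose proof PI_RGT_0.
apply Cint_norm_le; [lra| |].
- intros. apply curve_continuous_mult; [apply Hc|]. apply curve_continuous_mult; [|apply kernel_continuous].
  apply curve_continuous_Cpow, ratio_continuous.
- intros th _. rewrite !Cmod_mult, Cmod_pow, Cmod_ratio.
  apply Rmult_le_compat; [apply Cmod_ge_0| |apply Hb|].
  + apply Rmult_le_pos; [|apply Cmod_ge_0]. apply pow_le. rewrite <- (Cmod_ratio th). apply Cmod_ge_0.
  + apply Rmult_le_compat_l; [|apply kernel_bound]. apply pow_le. rewrite <- (Cmod_ratio th). apply Cmod_ge_0.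
Qed.

(** The expansion with [psi = 1]: by orthogonality only the term of index 0 remains, and the error
    tends to 0. *)
Let kernel_integral : Cint kernel 0 (2 * PI) = RtoC (2 * PI).
Proof.
apply Ceq_minus, Cmod_eq_0. apply Rle_antisym; [|apply Cmod_ge_0]. apply Rnot_lt_le. intros Hpos.
set (x := Cmod (Cint kernel 0 (2 * PI) - RtoC (2 * PI))%C) in *.
assert (Hx : forall N, x <= 2 * PI * (1 * ((t / rho) ^ S N * kappa))).
{ intros N. pose proof (kernel_integral_expansion (fun _ => 1) 1 (S N)
    (fun th => curve_continuous_const 1 th) (fun th => Req_le _ _ Cmod_1)) as H.
  assert (E : Csum (fun n => RtoC (t ^ n) * Cint (fun th => 1 * inv_circle th ^ n) 0 (2 * PI))%C (S N)
    = RtoC (2 * PI)).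
  { rewrite (Csum_ext _ (fun n => RtoC (t ^ n) * (if Nat.eq_dec n 0 then RtoC (2 * PI) else 0))%C).
    - clear. induction N; [simpl; ring|].
      rewrite Csum_S, IHN. simpl. ring.
    - intros k _. f_equal. rewrite <- Cint_inv_circle_pow. apply Cint_ext. intros; ring. }
  cbv beta in H. rewrite E in H.
  rewrite (Cint_ext _ kernel) in H by (intros; ring). exact H. }
assert (Hk : 0 < kappa) by (unfold kappa; pose proof d_rho; apply Rinv_0_lt_compat; lra).
pose proof PI_RGT_0.
assert (Hpk : 0 < 2 * PI * kappa) by (apply Rmult_lt_0_compat; lra).
destruct (pow_lt_1_zero (t / rho)) with (y := x / (2 * PI * kappa)) as [N HN].
- rewrite <- (Cmod_ratio 0). rewrite Rabs_pos_eq by apply Cmod_ge_0.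
  pose proof (Cmod_ratio_le 0). pose proof d_rho. lra.
- apply Rdiv_lt_0_compat; [exact Hpos|]. exact Hpk.
- specialize (HN (S N) (Nat.le_succ_diag_r N)). specialize (Hx N).
  pose proof (Rle_abs ((t / rho) ^ S N)).
  assert (Hlt : (t / rho) ^ S N < x / (2 * PI * kappa)) by lra.
  apply Rmult_lt_compat_r with (r := 2 * PI * kappa) in Hlt; [|exact Hpk].
  replace (x / (2 * PI * kappa) * (2 * PI * kappa)) with x in Hlt
    by (unfold Rdiv; rewrite Rmult_assoc, Rinv_l by lra; ring).
  lra.
Qed.

(* [z] runs along the segment from [t] to the point of the circle at angle [th]. *)
Let z (la th : R) : C := (RtoC t + RtoC la * (circle th - RtoC t))%C.

Let Cmod_z la th : 0 <= la <= 1 -> Cmod (z la th) <= rho.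
Proof.
intros Hla. unfold z.
replace (RtoC t + RtoC la * (circle th - RtoC t))%C with (RtoC ((1 - la) * t) + RtoC la * circle th)%C
  by (rewrite RtoC_mult, RtoC_minus; ring).
eapply Rle_trans; [apply Cmod_triangle|]. rewrite Cmod_mult, Cmod_circle, !Cmod_R, !Rabs_pos_eq by nra. nra.
Qed.

Let z_derive la th : is_curve_derive (z la) th (RtoC la * (Ci * circle th))%C.
Proof.
unfold z.
replace (RtoC la * (Ci * circle th))%C with (0 + RtoC la * (Ci * circle th + - 0))%C by ring.
apply is_curve_derive_plus; [apply is_curve_derive_const|]. apply is_curve_derive_scal.
apply (is_curve_derive_plus circle (fun _ => - RtoC t)%C).
- unfold circle. replace (Ci * (RtoC rho * Cexp (Ci * RtoC th)))%C
    with (RtoC rho * (Ci * Cexp (Ci * RtoC th)))%C by ring.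
  apply is_curve_derive_scal. apply is_curve_derive_Cexp_lin.
- replace (- 0)%C with (RtoC 0) by ring. apply is_curve_derive_const.
Qed.

Let z_continuous la th : curve_continuous (z la) th.
Proof. eapply curve_derive_continuous, z_derive. Qed.

Let circle_periodic : circle (2 * PI) = circle 0.
Proof.
unfold circle. f_equal.
replace (Ci * RtoC (2 * PI))%C with ((0, 2 * PI) : C) by (apply C_eq; simpl; ring).
replace (Ci * RtoC 0)%C with ((0, 0) : C) by (apply C_eq; simpl; ring).
unfold Cexp. simpl Re. simpl Im. now rewrite cos_2PI, sin_2PI, cos_0, sin_0.
Qed.

(** Up to the factor [i la], the integrand is the derivative of [phi] along the closed curve [z la];
    dividing by that factor excludes [la = 0]. *)
Let contour_zero la : 0 < la <= 1 -> Cint (fun th => dphi (z la th) * circle th)%C 0 (2 * PI) = 0.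
Proof.
intros Hla.
assert (Hcont : forall th, curve_continuous (fun th => dphi (z la th) * circle th)%C th).
{ intros th. apply curve_continuous_mult; [|apply circle_continuous].
  apply curve_continuous_comp; [|apply z_continuous]. apply Hdphi, Cmod_z. lra. }
assert (Hc0 : (RtoC la * Ci)%C <> 0).
{ apply Cmult_neq_0; [|apply Ci_nz]. intros E. apply RtoC_inj in E. lra. }
assert (E : (RtoC la * Ci * Cint (fun th => dphi (z la th) * circle th) 0 (2 * PI))%C = 0).
{ rewrite <- Cint_scal by (intros; apply Hcont).
  transitivity (phi (z la (2 * PI)) - phi (z la 0))%C.
  - apply Cint_unique. apply (is_CRInt_derive (fun th => phi (z la th))).
    + intros th _. replace (RtoC la * Ci * (dphi (z la th) * circle th))%C
        with (RtoC la * (Ci * circle th) * dphi (z la th))%C by ring.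
      apply is_curve_derive_comp; [apply Hphi, Cmod_z; lra|apply z_derive].
    + intros th _. apply curve_continuous_mult; [apply curve_continuous_const|apply Hcont].
  - unfold z. rewrite circle_periodic. ring. }
replace (Cint (fun th => dphi (z la th) * circle th)%C 0 (2 * PI))
  with ((RtoC la * Ci * Cint (fun th => dphi (z la th) * circle th) 0 (2 * PI)) / (RtoC la * Ci))%C
  by (field; split; [apply Ci_nz|]; intros E'; apply RtoC_inj in E'; lra).
rewrite E. field. split; [apply Ci_nz|]. intros E'; apply RtoC_inj in E'; lra.
Qed.

(** Interpolates between Cauchy's integral at [la = 1] and [2 pi phi(t)] at [la = 0]; constancy in
    [la] is Cauchy's formula. *)
Let star_integral la : C := Cint (fun th => phi (z la th) * kernel th)%C 0 (2 * PI).

Let phi_z_continuous la th : 0 <= la <= 1 -> curve_continuous (fun th => phi (z la th)) th.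
Proof.
intros Hla. apply curve_continuous_comp; [|apply z_continuous]. eexists. apply Hphi, Cmod_z, Hla.
Qed.

Let star_integrand_continuous la th :
  0 <= la <= 1 -> curve_continuous (fun th => phi (z la th) * kernel th)%C th.
Proof. intros Hla. apply curve_continuous_mult; [now apply phi_z_continuous|apply kernel_continuous]. Qed.

(** The part linear in [y - x] is the contour integral just shown to vanish, so only the
    second-order error of [phi] is left. *)
Let star_increment x y : 0 < x <= 1 -> 0 <= y <= 1 ->
  Cmod (star_integral y - star_integral x)%C
  <= 2 * PI * (M * ((rho + d) * (rho + d)) * kappa) * ((y - x) * (y - x)).
Proof.
intros Hx Hy. pose proof PI_RGT_0.
assert (Hlin : Cint (fun th => RtoC (y - x) * (dphi (z x th) * circle th))%C 0 (2 * PI) = 0).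
{ rewrite Cint_scal, contour_zero by
   first [assumption | intros; apply curve_continuous_mult; [|apply circle_continuous];
    apply curve_continuous_comp; [apply Hdphi, Cmod_z; lra|apply z_continuous]]. ring. }
replace (star_integral y - star_integral x)%C with
  (Cint (fun th => (phi (z y th) * kernel th - phi (z x th) * kernel th)
     - RtoC (y - x) * (dphi (z x th) * circle th))%C 0 (2 * PI)).
2: { rewrite Cint_minus, Cint_minus, Hlin.
  - unfold star_integral. ring.
  - lra.
  - intros; apply star_integrand_continuous; lra.
  - intros; apply star_integrand_continuous; lra.
  - lra.
  - intros; apply curve_continuous_minus; apply star_integrand_continuous; lra.
  - intros; apply curve_continuous_mult; [apply curve_continuous_const|].
    apply curve_continuous_mult; [|apply circle_continuous].
    apply curve_continuous_comp; [apply Hdphi, Cmod_z; lra|apply z_continuous]. }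
replace (2 * PI * (M * ((rho + d) * (rho + d)) * kappa) * ((y - x) * (y - x)))
  with ((2 * PI - 0) * (M * ((rho + d) * (rho + d) * ((y - x) * (y - x))) * kappa)) by ring.
apply Cint_norm_le; [lra| |].
- intros; apply curve_continuous_minus.
  + apply curve_continuous_minus; apply star_integrand_continuous; lra.
  + apply curve_continuous_mult; [apply curve_continuous_const|].
    apply curve_continuous_mult; [|apply circle_continuous].
    apply curve_continuous_comp; [apply Hdphi, Cmod_z; lra|apply z_continuous].
- intros th _. set (h := (RtoC (y - x) * (circle th - RtoC t))%C).
  assert (Ez : z y th = (z x th + h)%C) by (unfold z, h; rewrite RtoC_minus; ring).
  (* This cancels the singular denominator of the kernel against the velocity of [z] in [la]. *)
  assert (Ek : ((circle th - RtoC t) * kernel th)%C = circle th).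
  { unfold kernel, ratio.
    assert (E1 : (circle th - RtoC t)%C = (circle th * (1 - RtoC t * inv_circle th))%C).
    { replace (circle th * (1 - RtoC t * inv_circle th))%C
       with (circle th - RtoC t * (inv_circle th * circle th))%C by ring. rewrite circle_inv. ring. }
    rewrite E1. field. apply denominator_neq. }
  replace (phi (z y th) * kernel th - phi (z x th) * kernel th
     - RtoC (y - x) * (dphi (z x th) * circle th))%C
   with ((phi (z x th + h) - phi (z x th) - h * dphi (z x th)) * kernel th)%C.
  2: { rewrite Ez. rewrite <- Ek. unfold h. ring. }
  rewrite Cmod_mult.
  assert (Hb : Cmod h * Cmod h <= (rho + d) * (rho + d) * ((y - x) * (y - x))).
  { unfold h. rewrite Cmod_mult, Cmod_R.
    assert (Hc : Cmod (circle th - RtoC t)%C <= rho + d).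
    { eapply Rle_trans; [apply Cmod_sub_le|]. rewrite Cmod_circle, Cmod_R, Rabs_pos_eq by lra. lra. }
    replace ((y - x) * (y - x)) with (Rabs (y - x) * Rabs (y - x))
      by (rewrite <- Rabs_mult; apply Rabs_pos_eq, Rle_0_sqr).
    pose proof (Cmod_ge_0 (circle th - RtoC t)%C). pose proof (Rabs_pos (y - x)).
    replace ((rho + d) * (rho + d) * (Rabs (y - x) * Rabs (y - x)))
     with ((Rabs (y - x) * (rho + d)) * (Rabs (y - x) * (rho + d))) by ring.
    apply Rmult_le_compat; try (apply Rmult_le_pos; assumption); apply Rmult_le_compat_l; assumption. }
  assert (HM' : Cmod (phi (z x th + h) - phi (z x th) - h * dphi (z x th))%C <= M * (Cmod h * Cmod h)).
  { apply HM; [apply Cmod_z; lra|rewrite <- Ez; apply Cmod_z; lra]. }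
  assert (HM0 : 0 <= M).
  { specialize (HM 0 (RtoC rho)). rewrite Cplus_0_l, Cmod_0, Cmod_R, Rabs_pos_eq in HM by lra.
    specialize (HM ltac:(lra) ltac:(lra)).
    apply Rmult_le_reg_r with (rho * rho); [apply Rmult_lt_0_compat; lra|].
    rewrite Rmult_0_l. eapply Rle_trans; [|exact HM]. apply Cmod_ge_0. }
  apply Rmult_le_compat; [apply Cmod_ge_0|apply Cmod_ge_0| |apply kernel_bound].
  eapply Rle_trans; [exact HM'|]. apply Rmult_le_compat_l; assumption.
Qed.

Lemma disc_taylor_point (N : nat) :
  Cmod (phi (RtoC t) - poly_sum (fun n => / RtoC (2 * PI)
     * Cint (fun th => phi (circle th) * inv_circle th ^ n) 0 (2 * PI))%C N t)%C
  <= B * kappa * (t / rho) ^ N.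
Proof.
pose proof PI_RGT_0 as Hpi.
pose proof (quadratic_increments_const star_integral _ star_increment) as E.
unfold star_integral in E.
rewrite (Cint_ext (fun th => phi (z 1 th) * kernel th)%C (fun th => phi (circle th) * kernel th)%C) in E.
2: { intros th. unfold z. do 2 f_equal. ring. }
rewrite (Cint_ext (fun th => phi (z 0 th) * kernel th)%C (fun th => phi (RtoC t) * kernel th)%C) in E.
2: { intros th. unfold z. do 2 f_equal. ring. }
rewrite Cint_scal in E by (intros; apply kernel_continuous). rewrite kernel_integral in E.
pose proof (kernel_integral_expansion (fun th => phi (circle th)) B N phi_circle_continuous
  (fun th => HB _ (Req_le _ _ (Cmod_circle th)))) as H. cbv beta in H.
rewrite E in H.
assert (H2 : RtoC (2 * PI) <> 0) by (intros E2; apply RtoC_inj in E2; lra).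
assert (Es : Csum (fun n => RtoC (t ^ n) * Cint (fun th => phi (circle th) * inv_circle th ^ n) 0 (2 * PI))%C N
  = (RtoC (2 * PI) * poly_sum (fun n => / RtoC (2 * PI)
     * Cint (fun th => phi (circle th) * inv_circle th ^ n) 0 (2 * PI)) N t)%C).
{ unfold poly_sum. rewrite <- Csum_scal. apply Csum_ext. intros k _. field. exact H2. }
rewrite Es in H.
match type of H with Cmod (?a * ?b - ?b * ?c)%C <= _ =>
  replace (a * b - b * c)%C with (b * (a - c))%C in H by ring end.
rewrite Cmod_mult, Cmod_R, Rabs_pos_eq in H by lra.
apply Rmult_le_reg_l with (2 * PI); [lra|].
replace (2 * PI * (B * kappa * (t / rho) ^ N)) with (2 * PI * (B * ((t / rho) ^ N * kappa))) by ring.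
exact H.
Qed.

End Point.

Lemma disc_taylor : exists (c : nat -> C) (K : R), forall N t, 0 <= t <= d ->
  Cmod (phi (RtoC t) - poly_sum c N t)%C <= K * (t / rho) ^ N.
Proof. do 2 eexists. intros N t Ht. apply disc_taylor_point. exact Ht. Qed.

End Disc.

(** * The generating functions *)

(** The squared distance from 1 to the ray is [(q - cos psi)^2 + sin^2 psi]; if [cos psi <= 0] it is
    at least 1, otherwise [cos psi <= cos e] applies. *)
Lemma Cmod_1_minus_polar_ge (q psi e : R) : 0 <= q -> 0 < e <= PI / 2 -> e <= psi <= 2 * PI - e ->
  sin e <= Cmod (1 - (q * cos psi, q * sin psi)%R)%C.
Proof.
intros Hq He Hpsi. pose proof PI_RGT_0.
assert (Hc : cos psi <= cos e).
{ destruct (Rle_lt_dec psi PI).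
  - apply cos_decr_1; lra.
  - replace (cos psi) with (cos (2 * PI - psi)).
    + apply cos_decr_1; lra.
    + rewrite cos_minus, cos_2PI, sin_2PI. ring. }
assert (Hs : 0 <= sin e) by (apply sin_ge_0; lra).
rewrite <- (sqrt_Rsqr (sin e)) by exact Hs. unfold Cmod. apply sqrt_le_1_alt. simpl.
pose proof (sin2_cos2 psi) as E1. pose proof (sin2_cos2 e) as E2. unfold Rsqr in *.
replace ((1 + - (q * cos psi)) * ((1 + - (q * cos psi)) * 1)
  + (0 + - (q * sin psi)) * ((0 + - (q * sin psi)) * 1))
  with (1 - 2 * q * cos psi + q * q * (sin psi * sin psi + cos psi * cos psi)) by ring.
rewrite E1.
destruct (Rle_lt_dec (cos psi) 0).
- assert (0 <= q * (- cos psi)) by (apply Rmult_le_pos; lra).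
  assert (0 <= q * q) by apply Rle_0_sqr. assert (0 <= cos e * cos e) by apply Rle_0_sqr. lra.
- assert (cos psi * cos psi <= cos e * cos e) by (apply Rmult_le_compat; lra).
  assert (0 <= (q - cos psi) * (q - cos psi)) by apply Rle_0_sqr. lra.
Qed.

Lemma is_Cseries_of_bound (a : nat -> C) (l : C) (e : nat -> R) :
  (forall N, Cmod (l - Csum a (S N))%C <= e N) -> is_lim_seq e 0 -> is_Cseries a l.
Proof.
intros He Hlim.
assert (Hs : forall N, sum_n (G := C_AbelianGroup) a N = Csum a (S N)).
{ induction N.
  - rewrite sum_O. simpl. now rewrite Cplus_0_l.
  - rewrite sum_Sn, IHN. reflexivity. }
unfold is_Cseries, is_series.
intros P HP. apply (locally_norm_le_locally (V := C_NormedModule)) in HP.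
destruct HP as [eps HP].
destruct (Hlim _ (locally_ball (T := R_UniformSpace) 0 eps)) as [N HN].
exists N. intros n Hn. apply HP. specialize (HN n Hn).
change (Rabs (e n - 0) < eps) in HN. rewrite Rminus_0_r in HN.
change (Cmod (sum_n (G := C_AbelianGroup) a n - l)%C < eps).
rewrite Hs. rewrite <- Cmod_opp. replace (- (Csum a (S n) - l))%C with (l - Csum a (S n))%C by ring.
eapply Rle_lt_trans; [apply He|]. pose proof (Rle_abs (e n)). lra.
Qed.

Lemma is_Cseries_unique (a : nat -> C) (l l' : C) : is_Cseries a l -> is_Cseries a l' -> l = l'.
Proof. apply (filterlim_locally_unique (V := C_NormedModule)). Qed.

Lemma is_Cseries_ext (a b : nat -> C) (l : C) : (forall n, a n = b n) -> is_Cseries a l -> is_Cseries b l.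
Proof. apply (is_series_ext (V := C_NormedModule)). Qed.

Lemma is_Cseries_scal (c : C) (a : nat -> C) (l : C) :
  is_Cseries a l -> is_Cseries (fun n => c * a n)%C (c * l)%C.
Proof. apply (is_series_scal (V := C_NormedModule)). Qed.

Lemma is_lim_seq_scal_inv_S (K : R) : is_lim_seq (fun N => K * / INR (S N)) 0.
Proof.
replace (Finite 0) with (Rbar_mult K 0) by (simpl; f_equal; ring).
apply (is_lim_seq_scal_l _ K 0).
apply is_lim_seq_inv with (l := p_infty); [|discriminate].
apply -> is_lim_seq_incr_1. apply is_lim_seq_INR.
Qed.

Lemma Cmod_pow_1 (w : C) (n : nat) : Cmod w = 1 -> Cmod (w ^ n)%C = 1.
Proof. intros H. now rewrite Cmod_pow, H, pow1. Qed.

Section Unit.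

Variable beta : R.
Hypothesis Hbeta : 0 < beta < 2 * PI.

Definition phase : C := Cexp (RtoC beta * Ci)%C.

Lemma Cmod_phase : Cmod phase = 1.
Proof.
unfold phase. rewrite Cmod_Cexp. simpl. replace (beta * 0 - 0 * 1) with 0 by ring. apply exp_0.
Qed.

Lemma phase_mult_Cexp (z : C) :
  (phase * Cexp (- z))%C = (exp (- Re z) * cos (beta - Im z), exp (- Re z) * sin (beta - Im z)).
Proof.
unfold phase. rewrite <- Cexp_plus.
replace (RtoC beta * Ci + - z)%C with ((- Re z, beta - Im z) : C) by (apply C_eq; unfold Re, Im; simpl; ring).
reflexivity.
Qed.

(** The argument [beta - Im z] of [phase * exp(-z)] stays at distance [e] from 0 and from [2 pi],
    whatever [Re z]. *)
Lemma strip_bound (rho : R) : 0 <= rho -> rho < beta -> rho < 2 * PI - beta ->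
  exists k, 0 < k /\ forall z, Rabs (Im z) <= rho -> k <= Cmod (1 - phase * Cexp (- z))%C.
Proof.
intros H0 H1 H2. set (e := Rmin (PI / 2) (Rmin (beta - rho) (2 * PI - beta - rho))).
pose proof PI_RGT_0.
assert (He1 : e <= PI / 2) by apply Rmin_l.
assert (He2 : e <= beta - rho) by (eapply Rle_trans; [apply Rmin_r|apply Rmin_l]).
assert (He3 : e <= 2 * PI - beta - rho) by (eapply Rle_trans; [apply Rmin_r|apply Rmin_r]).
assert (He : 0 < e) by (repeat apply Rmin_pos; lra).
exists (sin e). split; [apply sin_gt_0; lra|].
intros z Hz. rewrite phase_mult_Cexp. apply Cmod_1_minus_polar_ge.
- left; apply exp_pos.
- lra.
- apply Rabs_le_between in Hz. lra.
Qed.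

Lemma segment_bound : exists k, 0 < k /\ forall v, 0 <= v -> k <= Cmod (1 - phase * RtoC v)%C.
Proof.
set (e := Rmin (PI / 2) (Rmin beta (2 * PI - beta))).
pose proof PI_RGT_0.
assert (He1 : e <= PI / 2) by apply Rmin_l.
assert (He2 : e <= beta) by (eapply Rle_trans; [apply Rmin_r|apply Rmin_l]).
assert (He3 : e <= 2 * PI - beta) by (eapply Rle_trans; [apply Rmin_r|apply Rmin_r]).
assert (He : 0 < e) by (repeat apply Rmin_pos; lra).
exists (sin e). split; [apply sin_gt_0; lra|].
intros v Hv. replace (phase * RtoC v)%C with ((v * cos beta, v * sin beta) : C).
- apply Cmod_1_minus_polar_ge; lra.
- unfold phase, Cexp. simpl.
  replace (beta * 0 - 0 * 1) with 0 by ring. replace (beta * 1 + 0 * 0) with beta by ring.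
  rewrite exp_0. apply C_eq; simpl; ring.
Qed.

Lemma segment_neq (v : R) : 0 <= v -> (1 - phase * RtoC v <> 0)%C.
Proof.
intros Hv. destruct segment_bound as (k & Hk & H). apply Cmod_gt_0. specialize (H v Hv). lra.
Qed.

(** Closed form of the sum over [n >= 1] of [phase^n exp(-n z)], meaningful on a disc around 0 where
    the series itself may diverge. *)
Definition geom (z : C) : C := (phase * Cexp (- z) / (1 - phase * Cexp (- z)))%C.

Lemma geom_taylor (d rho : R) : 0 <= d < rho -> rho < beta -> rho < 2 * PI - beta ->
  exists (c : nat -> C) (K : R), forall N t, 0 <= t <= d ->
    Cmod (geom (RtoC t) - poly_sum c N t)%C <= K * (t / rho) ^ N.
Proof.
intros Hd H1 H2. destruct (strip_bound rho) as (k & Hk & Hlow); try lra.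
assert (Hlow' : forall z, Cmod z <= rho -> k <= Cmod (1 - phase * Cexp (- z))%C).
{ intros z Hz. apply Hlow. eapply Rle_trans; [apply im_le_Cmod|exact Hz]. }
assert (Hne : forall z, Cmod z <= rho -> (1 - phase * Cexp (- z) <> 0)%C).
{ intros z Hz. apply Cmod_gt_0. specialize (Hlow' z Hz). lra. }
set (Y := exp rho).
assert (HY : forall z, Cmod z <= rho -> Cmod (phase * Cexp (- z))%C <= Y).
{ intros z Hz. rewrite Cmod_mult, Cmod_phase, Cmod_Cexp, Rmult_1_l. apply exp_le.
  rewrite re_opp. pose proof (re_le_Cmod z). pose proof (Rle_abs (- Re z)). rewrite Rabs_Ropp in H0. lra. }
assert (HY0 : 0 < Y) by apply exp_pos.
assert (Hinv : forall z, Cmod z <= rho -> Cmod (/ (1 - phase * Cexp (- z)))%C <= / k).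
{ intros z Hz. rewrite Cmod_inv by now apply Hne. apply Rinv_le_contravar; [exact Hk|now apply Hlow']. }
assert (Hy : forall z, is_Cderive (fun z => phase * Cexp (- z))%C z (- (phase * Cexp (- z)))%C).
{ intros z.
  pose proof (is_Cderive_mult _ _ z _ _ (is_Cderive_const phase z)
    (is_Cderive_comp Cexp (fun z => 0 - z)%C z _ _ (is_Cderive_Cexp _)
      (is_Cderive_minus _ _ z _ _ (is_Cderive_const 0 z) (is_Cderive_id z)))) as H.
  cbv beta in H.
  apply (is_derive_ext (V := C_NormedModule) (fun z => phase * Cexp (0 - z))%C).
  { intros w. simpl. replace (0 - w)%C with (- w)%C by ring. reflexivity. }
  replace (- (phase * Cexp (- z)))%C with (0 * Cexp (0 - z) + phase * ((0 - 1) * Cexp (0 - z)))%C.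
  - exact H.
  - replace (0 - z)%C with (- z)%C by ring. ring. }
set (E := 5 * exp (2 * rho)).
assert (HE : 0 < E) by (unfold E; pose proof (exp_pos (2 * rho)); lra).
apply (disc_taylor geom
  (fun z => - (phase * Cexp (- z)) / ((1 - phase * Cexp (- z)) * (1 - phase * Cexp (- z))))%C
  rho d ((Y * E * (1 + Y) + Y * Y + 2 * rho * (Y * Y) * E) * (/ k * / k * / k)) (Y * / k)); try lra.
- intros z Hz. specialize (Hne z Hz).
  pose proof (is_Cderive_mult _ _ z _ _ (Hy z)
    (is_Cderive_comp Cinv (fun z => 1 - phase * Cexp (- z))%C z _ _ (is_Cderive_inv _ Hne)
      (is_Cderive_minus _ _ z _ _ (is_Cderive_const 1 z) (Hy z)))) as H.
  cbv beta in H. unfold geom, Cdiv.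
  match type of H with is_derive _ _ ?l =>
    replace l with (- (phase * Cexp (- z)) * / ((1 - phase * Cexp (- z)) * (1 - phase * Cexp (- z))))%C in H
     by (field; exact Hne) end.
  exact H.
- intros z Hz. specialize (Hne z Hz).
  assert (Hyd : Cderivable (fun z => phase * Cexp (- z))%C z) by (eexists; apply Hy).
  assert (Hyd' : Cderivable (fun z => 1 - phase * Cexp (- z))%C z)
    by (apply Cderivable_minus; [apply Cderivable_const|exact Hyd]).
  apply Cderivable_div.
  + apply (Cderivable_ext (fun z => 0 - phase * Cexp (- z))%C); [intros; ring|].
    apply Cderivable_minus; [apply Cderivable_const|exact Hyd].
  + apply Cderivable_mult; exact Hyd'.
  + apply Cmult_neq_0; exact Hne.
- intros z h Hz Hzh.
  assert (Hh : Cmod h <= 2 * rho).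
  { replace h with ((z + h) - z)%C by ring. eapply Rle_trans; [apply Cmod_sub_le|]. lra. }
  pose proof (Hinv z Hz) as I1. pose proof (Hinv _ Hzh) as I2.
  pose proof (HY z Hz) as Y1. pose proof (Hne z Hz) as N1. pose proof (Hne _ Hzh) as N2.
  (* In terms of [e] the remainder is a fraction in which each term of the numerator carries [h^2]
     or [e]; this produces the constant [M] passed to [disc_taylor]. *)
  set (e := (Cexp (- h) - 1 - - h)%C).
  assert (He : Cmod e <= E * (Cmod h * Cmod h)).
  { unfold e, E. eapply Rle_trans; [apply Cexp_taylor2_bound|]. rewrite Cmod_opp.
    assert (exp (Cmod h) <= exp (2 * rho)) by now apply exp_le.
    replace (5 * exp (2 * rho) * (Cmod h * Cmod h)) with (5 * (Cmod h * Cmod h) * exp (2 * rho)) by ring.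
    apply Rmult_le_compat_l; [|assumption]. pose proof (Cmod_ge_0 h). nra. }
  assert (Ey : (phase * Cexp (- (z + h)))%C = (phase * Cexp (- z) * (1 - h + e))%C).
  { replace (- (z + h))%C with (- z + - h)%C by ring. rewrite Cexp_plus. unfold e. ring. }
  unfold geom. rewrite Ey in N2, I2 |- *.
  set (y := (phase * Cexp (- z))%C) in *.
  replace (y * (1 - h + e) / (1 - y * (1 - h + e)) - y / (1 - y) - h * (- y / ((1 - y) * (1 - y))))%C
    with ((y * e * (1 - y) + h * h * (y * y) - h * (y * y) * e)
      * (/ (1 - y) * / (1 - y) * / (1 - y * (1 - h + e))))%C.
  2: { field. split; assumption. }
  rewrite Cmod_mult.
  pose proof (Cmod_ge_0 h) as P1. pose proof (Cmod_ge_0 e) as P2. pose proof (Cmod_ge_0 y) as P3.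
  assert (Hnum : Cmod (y * e * (1 - y) + h * h * (y * y) - h * (y * y) * e)%C
    <= (Y * E * (1 + Y) + Y * Y + 2 * rho * (Y * Y) * E) * (Cmod h * Cmod h)).
  { assert (Q1 : Cmod (1 - y)%C <= 1 + Y).
    { eapply Rle_trans; [apply Cmod_sub_le|]. rewrite Cmod_1. lra. }
    eapply Rle_trans; [apply Cmod_sub_le|]. eapply Rle_trans; [apply Rplus_le_compat_r, Cmod_triangle|].
    rewrite !Cmod_mult.
    assert (Hyy : Cmod y * Cmod y <= Y * Y) by (apply Rmult_le_compat; assumption).
    assert (Hyy0 : 0 <= Cmod y * Cmod y) by (apply Rmult_le_pos; assumption).
    assert (Hhh0 : 0 <= Cmod h * Cmod h) by (apply Rmult_le_pos; assumption).
    assert (B1 : Cmod y * Cmod e * Cmod (1 - y)%C <= Y * (E * (Cmod h * Cmod h)) * (1 + Y)).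
    { apply Rmult_le_compat; [apply Rmult_le_pos; assumption|apply Cmod_ge_0| |exact Q1].
      apply Rmult_le_compat; assumption. }
    assert (B2 : Cmod h * Cmod h * (Cmod y * Cmod y) <= Cmod h * Cmod h * (Y * Y)).
    { apply Rmult_le_compat_l; assumption. }
    assert (B3 : Cmod h * (Cmod y * Cmod y) * Cmod e <= 2 * rho * (Y * Y) * (E * (Cmod h * Cmod h))).
    { apply Rmult_le_compat; [apply Rmult_le_pos; assumption|assumption| |exact He].
      apply Rmult_le_compat; assumption. }
    lra. }
  assert (Hden : Cmod (/ (1 - y) * / (1 - y) * / (1 - y * (1 - h + e)))%C <= / k * / k * / k).
  { rewrite !Cmod_mult. apply Rmult_le_compat; [apply Rmult_le_pos; apply Cmod_ge_0|apply Cmod_ge_0| |exact I2].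
    apply Rmult_le_compat; try apply Cmod_ge_0; exact I1. }
  eapply Rle_trans.
  + apply Rmult_le_compat; [apply Cmod_ge_0|apply Cmod_ge_0|exact Hnum|exact Hden].
  + right. ring.
- intros z Hz. unfold geom, Cdiv. rewrite Cmod_mult.
  apply Rmult_le_compat; try apply Cmod_ge_0; [now apply HY|now apply Hinv].
Qed.

Definition geom_real (t : R) : C := (phase * RtoC (exp (- t)) / (1 - phase * RtoC (exp (- t))))%C.

Lemma geom_RtoC (t : R) : geom (RtoC t) = geom_real t.
Proof. unfold geom, geom_real. now rewrite <- RtoC_opp, Cexp_RtoC. Qed.

Lemma exp_opp_continuous (t : R) : curve_continuous (fun t => RtoC (exp (- t))) t.
Proof. apply curve_continuous_RtoC, (ex_derive_continuous (V := R_NormedModule)). auto_derive. exact I. Qed.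

Lemma geom_real_continuous (t : R) : curve_continuous geom_real t.
Proof.
assert (H : curve_continuous (fun t => phase * RtoC (exp (- t)))%C t).
{ apply curve_continuous_mult; [apply curve_continuous_const|apply exp_opp_continuous]. }
apply curve_continuous_mult; [exact H|].
apply (curve_continuous_inv (fun t => 1 - phase * RtoC (exp (- t)))%C).
- apply segment_neq. left; apply exp_pos.
- apply curve_continuous_minus; [apply curve_continuous_const|exact H].
Qed.

Lemma geom_real_decays : decays geom_real.
Proof.
split; [intros; apply geom_real_continuous|].
destruct segment_bound as (k & Hk & Hlow).
exists (/ k), 1. split; [lra|]. intros t _. rewrite Rmult_1_l.
assert (He : 0 <= exp (- t)) by (left; apply exp_pos).
unfold geom_real, Cdiv. rewrite !Cmod_mult, Cmod_phase, Cmod_R, Rabs_pos_eq, Rmult_1_l by exact He.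
rewrite Cmod_inv by now apply segment_neq. rewrite Rmult_comm.
apply Rmult_le_compat_r; [exact He|]. apply Rinv_le_contravar; [exact Hk|now apply Hlow].
Qed.

Lemma geom_remainder : exists K, 0 < K /\ forall N t,
  Cmod (geom_real t - Csum (fun n => phase ^ S n * RtoC (exp (- (INR (S n) * t)))) N)%C
  <= K * exp (- (INR (S N) * t)).
Proof.
destruct segment_bound as (k & Hk & Hlow).
exists (/ k). split; [now apply Rinv_0_lt_compat|]. intros N t.
set (v := exp (- t)). assert (Hv : 0 <= v) by (left; apply exp_pos).
assert (Hp : forall n, exp (- (INR n * t)) = v ^ n).
{ intros n. replace (- (INR n * t)) with (INR n * - t) by ring. rewrite <- Rpower_pow by apply exp_pos.
  unfold Rpower, v. now rewrite ln_exp. }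
pose proof (segment_neq v Hv) as Hne.
assert (E : (geom_real t - Csum (fun n => phase ^ S n * RtoC (exp (- (INR (S n) * t)))) N)%C
   = (phase ^ S N * RtoC (v ^ S N) * / (1 - phase * RtoC v))%C).
{ induction N.
  - unfold geom_real. fold v. simpl Csum. rewrite Cpow_1_r, pow_1. unfold Cdiv. ring.
  - rewrite Csum_S, Hp.
    match goal with |- (?g - (?s + ?x))%C = _ => replace (g - (s + x))%C with ((g - s) - x)%C by ring end.
    rewrite IHN. rewrite (Cpow_S phase (S N)). change (v ^ S (S N)) with (v * v ^ S N). rewrite RtoC_mult.
    field. exact Hne. }
rewrite E, !Cmod_mult, Cmod_pow_1, Cmod_R, Rabs_pos_eq, Rmult_1_l, Hp by
  first [apply Cmod_phase | apply pow_le; exact Hv].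
rewrite Cmod_inv by exact Hne. rewrite Rmult_comm.
apply Rmult_le_compat_r; [now apply pow_le|]. apply Rinv_le_contravar; [exact Hk|now apply Hlow].
Qed.

(* [-log (1 - phase * exp (-t))], written as the integral of [phase / (1 - phase u)]
   over [0 <= u <= exp (-t)]. *)
Definition log_integral (v : R) : C := Cint (fun u => phase / (1 - phase * RtoC u))%C 0 v.
Definition polylog (t : R) : C := log_integral (exp (- t)).

Let integrand_continuous (u : R) : 0 <= u -> curve_continuous (fun u => phase / (1 - phase * RtoC u))%C u.
Proof.
intros Hu. apply curve_continuous_mult; [apply curve_continuous_const|].
apply (curve_continuous_inv (fun u => 1 - phase * RtoC u)%C); [now apply segment_neq|].
apply curve_continuous_minus; [apply curve_continuous_const|].
apply curve_continuous_mult; [apply curve_continuous_const|].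
apply curve_continuous_RtoC, continuous_id.
Qed.

(** Integrating the remainder [phase^(M+1) u^M / (1 - phase u)] gains a factor [1/(M+1)], so the
    series is controlled even at [v = 1], where it converges only conditionally. *)
Lemma log_integral_remainder : exists K, 0 < K /\ forall M v, 0 <= v ->
  Cmod (log_integral v - Csum (fun m => phase ^ S m * RtoC (v ^ S m / INR (S m))) M)%C
  <= K * (v ^ S M * / INR (S M)).
Proof.
destruct segment_bound as (k & Hk & Hlow).
exists (/ k). split; [now apply Rinv_0_lt_compat|]. intros M v Hv.
set (rem := fun M u => (phase ^ S M * RtoC (u ^ M) * / (1 - phase * RtoC u))%C).
assert (Hremc : forall M u, 0 <= u -> curve_continuous (rem M) u).
{ intros m u Hu. apply curve_continuous_mult.
  - apply curve_continuous_mult; [apply curve_continuous_const|apply curve_continuous_pow].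
  - apply (curve_continuous_inv (fun u => 1 - phase * RtoC u)%C); [now apply segment_neq|].
    apply curve_continuous_minus; [apply curve_continuous_const|].
    apply curve_continuous_mult; [apply curve_continuous_const|].
    apply curve_continuous_RtoC, continuous_id. }
assert (Hpow : forall m, is_CRInt (fun u => phase ^ S m * RtoC (u ^ m))%C 0 v
   (phase ^ S m * RtoC (v ^ S m / INR (S m)))%C).
{ intros m. apply is_CRInt_scal, is_CRInt_RtoC.
  assert (Hm : INR (S m) <> 0) by (apply not_0_INR; lia).
  replace (v ^ S m / INR (S m)) with (minus (v ^ S m / INR (S m)) (0 ^ S m / INR (S m))).
  - apply (is_RInt_derive (fun u => u ^ S m / INR (S m))).
    + intros u _. auto_derive; [exact I|]. simpl pred. field. exact Hm.
    + intros u _. apply (ex_derive_continuous (V := R_NormedModule)). auto_derive. exact I.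
  - change (v ^ S m / INR (S m) - 0 ^ S m / INR (S m) = v ^ S m / INR (S m)). simpl pow. field. exact Hm. }
assert (Hrem : forall m, is_CRInt (rem m) 0 v
  (log_integral v - Csum (fun m => phase ^ S m * RtoC (v ^ S m / INR (S m))) m)%C).
{ induction m.
  - simpl Csum. replace (log_integral v - 0)%C with (log_integral v) by ring.
    apply (is_RInt_ext (V := C_R_NormedModule) (fun u => phase / (1 - phase * RtoC u))%C).
    + intros u _. unfold rem. rewrite Cpow_1_r. simpl. unfold Cdiv. ring.
    + apply Cint_correct. intros u Hu. rewrite Rmin_left in Hu by exact Hv. apply integrand_continuous. lra.
  - rewrite Csum_S.
    match goal with |- is_CRInt _ _ _ (?g - (?s + ?x))%C => replace (g - (s + x))%C with ((g - s) - x)%C by ring end.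
    pose proof (is_RInt_minus (V := C_R_NormedModule) _ _ _ _ _ _ IHm (Hpow m)) as H.
    revert H. apply (is_RInt_ext (V := C_R_NormedModule)).
    intros u Hu. rewrite Rmin_left in Hu by exact Hv.
    change (rem m u - phase ^ S m * RtoC (u ^ m) = rem (S m) u)%C. unfold rem.
    rewrite (Cpow_S phase (S m)). change (u ^ S m) with (u * u ^ m). rewrite RtoC_mult.
    field. apply segment_neq. lra. }
rewrite <- norm_C_R.
apply (norm_RInt_le (V := C_R_NormedModule) (rem M) (fun u => / k * u ^ M) 0 v _ _ Hv).
- intros u Hu. rewrite norm_C_R. unfold rem.
  rewrite !Cmod_mult, Cmod_pow_1, Cmod_R, Rabs_pos_eq, Rmult_1_l by
    first [apply Cmod_phase | apply pow_le; lra].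
  rewrite Cmod_inv by (apply segment_neq; lra). rewrite Rmult_comm.
  apply Rmult_le_compat_r; [apply pow_le; lra|]. apply Rinv_le_contravar; [exact Hk|apply Hlow; lra].
- apply Hrem.
- apply (is_RInt_scal (V := R_NormedModule)).
  assert (Hm : INR (S M) <> 0) by (apply not_0_INR; lia).
  replace (v ^ S M * / INR (S M)) with (minus (v ^ S M / INR (S M)) (0 ^ S M / INR (S M))).
  + apply (is_RInt_derive (fun u => u ^ S M / INR (S M))).
    * intros u _. auto_derive; [exact I|]. simpl pred. field. exact Hm.
    * intros u _. apply (ex_derive_continuous (V := R_NormedModule)). auto_derive. exact I.
  + change (v ^ S M / INR (S M) - 0 ^ S M / INR (S M) = v ^ S M * / INR (S M)). simpl pow. field. exact Hm.
Qed.

Lemma polylog_remainder : exists K, 0 < K /\ forall M t,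
  Cmod (polylog t - Csum (fun m => phase ^ S m * RtoC (exp (- (INR (S m) * t)) / INR (S m))) M)%C
  <= K * (exp (- (INR (S M) * t)) * / INR (S M)).
Proof.
destruct log_integral_remainder as (K & HK & H).
exists K. split; [exact HK|]. intros M t.
assert (Hp : forall n, exp (- (INR n * t)) = exp (- t) ^ n).
{ intros n. replace (- (INR n * t)) with (INR n * - t) by ring. rewrite <- Rpower_pow by apply exp_pos.
  unfold Rpower. now rewrite ln_exp. }
rewrite (Csum_ext _ (fun m => phase ^ S m * RtoC (exp (- t) ^ S m / INR (S m)))%C).
- rewrite Hp. apply H. left; apply exp_pos.
- intros; now rewrite Hp.
Qed.

Lemma polylog_derive (t : R) : is_curve_derive polylog t (- geom_real t)%C.
Proof.
unfold polylog.
assert (Hv : is_curve_derive log_integral (exp (- t)) (phase / (1 - phase * RtoC (exp (- t))))%C).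
{ apply (is_derive_RInt (V := C_R_CompleteNormedModule)
    (fun u => phase / (1 - phase * RtoC u))%C log_integral 0 (exp (- t))).
  - exists (mkposreal _ (exp_pos (- t))). intros v Hv. apply Cint_correct.
    change (Rabs (v - exp (- t)) < exp (- t)) in Hv. apply Rabs_lt_between in Hv.
    intros u Hu. rewrite Rmin_left in Hu by lra. apply integrand_continuous. lra.
  - apply integrand_continuous. left; apply exp_pos. }
pose proof (is_derive_comp (V := C_R_NormedModule) log_integral (fun t => exp (- t)) t _ (- exp (- t)) Hv) as H.
assert (Hd : is_derive (fun t => exp (- t)) t (- exp (- t))) by (auto_derive; [exact I|ring]).
specialize (H Hd).
change (scal (- exp (- t)) (phase / (1 - phase * RtoC (exp (- t))))%C)
  with (scal (V := C_R_ModuleSpace) (- exp (- t)) (phase / (1 - phase * RtoC (exp (- t))))%C) in H.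
rewrite scal_R_Cmult in H.
replace (- geom_real t)%C with (RtoC (- exp (- t)) * (phase / (1 - phase * RtoC (exp (- t)))))%C; [exact H|].
unfold geom_real. rewrite RtoC_opp. unfold Cdiv. ring.
Qed.

Lemma polylog_continuous (t : R) : curve_continuous polylog t.
Proof. eapply curve_derive_continuous, polylog_derive. Qed.

Lemma polylog_bound : exists K, 0 < K /\ forall t, Cmod (polylog t) <= K * exp (- t).
Proof.
destruct polylog_remainder as (K & HK & H). exists K. split; [exact HK|]. intros t.
specialize (H O t). simpl in H. rewrite Rinv_1, Rmult_1_r, Rmult_1_l in H.
replace (polylog t - 0)%C with (polylog t) in H by ring. exact H.
Qed.

(** Integrates [- geom_real] coefficientwise, since that is the derivative of [polylog]. *)
Definition primitive_coef (c : nat -> C) (u : nat) : C :=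
  match u with
  | O => polylog 0
  | S n => (- c n / RtoC (INR (S n)))%C
  end.

Lemma polylog_taylor (c : nat -> C) (K d rho : R) : 0 < rho ->
  (forall N t, 0 <= t <= d -> Cmod (geom_real t - poly_sum c N t)%C <= K * (t / rho) ^ N) ->
  exists K', forall N t, 0 <= t <= d ->
    Cmod (polylog t - poly_sum (primitive_coef c) N t)%C <= K' * (t / rho) ^ N.
Proof.
intros Hrho HK. destruct polylog_bound as (K0 & HK0 & Hb).
(* [K0] serves [N = 0]. For [S N], integrating over [[0, t]] yields a factor [t = rho (t/rho)],
   which raises the exponent by one. *)
exists (K0 + Rabs K * rho). intros N t Ht.
assert (Hr : forall n, 0 <= (t / rho) ^ n).
{ intros n. apply pow_le, Rmult_le_pos; [lra|left; now apply Rinv_0_lt_compat]. }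
assert (HKr : 0 <= Rabs K * rho) by (apply Rmult_le_pos; [apply Rabs_pos|lra]).
destruct N as [|N].
- unfold poly_sum; simpl. replace (polylog t - 0)%C with (polylog t) by ring.
  specialize (Hb t). assert (exp (- t) <= 1) by (rewrite <- exp_0; apply exp_le; lra). nra.
- assert (Hint : is_CRInt (fun u => - (geom_real u - poly_sum c N u))%C 0 t
     (polylog t - poly_sum (primitive_coef c) (S N) t)%C).
  { set (P := fun u => (polylog u + - poly_sum (primitive_coef c) (S N) u)%C).
    replace (polylog t - poly_sum (primitive_coef c) (S N) t)%C with (P t - P 0)%C.
    - apply (is_CRInt_derive P).
      + intros u _. replace (- (geom_real u - poly_sum c N u))%C
          with (- geom_real u + - (1) * - poly_sum c N u)%C by ring.
        apply is_curve_derive_plus; [apply polylog_derive|].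
        apply (is_derive_ext (V := C_R_NormedModule) (fun u => - (1) * poly_sum (primitive_coef c) (S N) u)%C).
        { intros; simpl; ring. }
        apply is_curve_derive_scal. clear. induction N.
        * unfold poly_sum; simpl. replace (- 0)%C with (0 + 0)%C by ring.
          apply is_curve_derive_plus; [apply is_curve_derive_const|].
          apply (is_derive_ext (V := C_R_NormedModule) (fun _ => polylog 0 * 1)%C); [reflexivity|].
          apply is_curve_derive_const.
        * replace (- poly_sum c (S N) u)%C with (- poly_sum c N u + - c N * RtoC (u ^ N))%C
            by (unfold poly_sum; rewrite Csum_S; ring).
          apply (is_curve_derive_plus (poly_sum (primitive_coef c) (S N))
            (fun u => primitive_coef c (S N) * RtoC (u ^ S N))%C); [exact IHN|].
          assert (Hn : RtoC (INR (S N)) <> 0).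
          { intros E. apply RtoC_inj in E. apply (not_0_INR (S N)) in E; [exact E|lia]. }
          replace (- c N * RtoC (u ^ N))%C with (primitive_coef c (S N) * RtoC (INR (S N) * u ^ N))%C.
          -- apply is_curve_derive_scal, is_curve_derive_RtoC.
             pose proof (is_derive_pow (fun v => v) (S N) u 1 (is_derive_id (K := R_AbsRing) u)) as H.
             rewrite Rmult_1_r in H. exact H.
          -- unfold primitive_coef. rewrite RtoC_mult. field. exact Hn.
      + intros u _. apply curve_continuous_opp, curve_continuous_minus;
          [apply geom_real_continuous|apply curve_continuous_poly_sum].
    - unfold P. assert (E0 : poly_sum (primitive_coef c) (S N) 0 = polylog 0).
      { clear. unfold poly_sum. induction N.
        - simpl. ring.
        - rewrite Csum_S, IHN.
          rewrite pow_i by lia. ring. }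
      rewrite E0. ring. }
  assert (Hle : Cmod (polylog t - poly_sum (primitive_coef c) (S N) t)%C
    <= (t - 0) * (Rabs K * (t / rho) ^ N)).
  { refine (is_CRInt_norm_const _ 0 t _ _ _ _ Hint); [lra|].
    intros u Hu. rewrite Cmod_opp. eapply Rle_trans; [apply HK; lra|].
    assert (Hu0 : 0 <= (u / rho) ^ N).
    { apply pow_le, Rmult_le_pos; [lra|left; now apply Rinv_0_lt_compat]. }
    assert (Hut : (u / rho) ^ N <= (t / rho) ^ N).
    { apply pow_incr. split; [apply Rmult_le_pos; [lra|left; now apply Rinv_0_lt_compat]|].
      apply Rmult_le_compat_r; [left; now apply Rinv_0_lt_compat|lra]. }
    pose proof (Rle_abs K). pose proof (Rabs_pos K). nra. }
  eapply Rle_trans; [exact Hle|]. rewrite Rminus_0_r.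
  replace (t * (Rabs K * (t / rho) ^ N)) with (Rabs K * rho * (t / rho) ^ S N) by (simpl; field; lra).
  apply Rmult_le_compat_r; [apply Hr|lra].
Qed.

End Unit.

(** * Termwise integration *)

(** The interchange rests on integrating bounds for the remainders of partial sums rather than on
    absolute convergence, which fails for the periodic zeta series when [0 < Re s <= 1]. *)
Lemma is_Cseries_termwise {Fa Fb : (R -> Prop) -> Prop} {D : R -> Prop} (HR : positive_range Fa Fb D)
  (s : C) (G : R -> C) (g : nat -> R -> C) (a : nat -> C) (l : C) (b : nat -> R -> R) (e : nat -> R) :
  is_CRInt_gen (fun t => cpow t (s - 1) * G t)%C Fa Fb l ->
  (forall n, is_CRInt_gen (fun t => cpow t (s - 1) * g n t)%C Fa Fb (a n)) ->
  (forall N t, D t -> Rpower t (Re s - 1) * Cmod (G t - Csum (fun n => g n t) (S N))%C <= b N t) ->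
  (forall N, is_RInt_gen (b N) Fa Fb (e N)) -> is_lim_seq e 0 ->
  is_Cseries a l.
Proof.
intros HG Hg Hb He Hlim. apply (is_Cseries_of_bound a l e); [|exact Hlim].
assert (Hpart : forall N, is_CRInt_gen (fun t => cpow t (s - 1) * (G t - Csum (fun n => g n t) N))%C Fa Fb
   (l - Csum a N)%C).
{ induction N.
  - simpl. replace (l - 0)%C with l by ring. revert HG. apply (is_CRInt_gen_ext HR). intros; ring.
  - rewrite Csum_S. replace (l - (Csum a N + a N))%C with ((l - Csum a N) - a N)%C by ring.
    pose proof (is_CRInt_gen_minus HR _ _ _ _ IHN (Hg N)) as H. revert H.
    apply (is_CRInt_gen_ext HR). intros; rewrite Csum_S; ring. }
intros N. refine (is_CRInt_gen_norm HR _ _ _ _ _ (Hpart (S N)) (He N)).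
intros t Ht. rewrite Cmod_mult, Cmod_cpow. unfold Cminus at 1. rewrite re_plus, re_opp, re_RtoC.
now apply Hb.
Qed.

Lemma phase_pow (beta : R) (n : nat) : (phase beta ^ n)%C = Cexp (RtoC (INR n * beta) * Ci)%C.
Proof.
unfold phase. rewrite <- Cexp_nat. f_equal. rewrite RtoC_mult. ring.
Qed.

Lemma Rpower_opp_lim_seq (a : R) : 0 < a -> is_lim_seq (fun N => Rpower (INR (S (S N))) (- a)) 0.
Proof.
intros Ha. unfold Rpower.
assert (H1 : is_lim_seq (fun N => INR (S (S N))) p_infty).
{ apply -> (is_lim_seq_incr_1 (fun N => INR (S N))). apply -> is_lim_seq_incr_1. apply is_lim_seq_INR. }
apply (filterlim_comp _ _ _ (fun N => - a * ln (INR (S (S N)))) exp _ (Rbar_locally m_infty)).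
- apply (filterlim_comp _ _ _ (fun N => ln (INR (S (S N)))) (fun u => - a * u) _ (Rbar_locally p_infty)).
  + eapply filterlim_comp; [exact H1|apply is_lim_ln_p].
  + assert (E : Rbar_mult (- a) p_infty = m_infty).
    { simpl. destruct (Rle_dec 0 (- a)) as [H|H]; [exfalso; lra|reflexivity]. }
    pose proof (filterlim_Rbar_mult_l (- a) p_infty) as H. rewrite E in H. exact H.
- apply is_lim_exp_m.
Qed.

Lemma real_gamma_dilate (a k : R) : 0 < a -> 0 < k ->
  is_RInt_gen (fun t => Rpower t (a - 1) * exp (- (k * t))) (at_right 0) (Rbar_locally p_infty)
    (Rpower k (- a) * real_gamma a).
Proof.
intros Ha Hk.
assert (HRf : Filter (at_right 0)) by typeclasses eauto.
pose proof (is_RInt_gen_dilate R_NormedModule _ _ _ _ _ k _ (filterlim_dilate_right k Hk)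
  (filterlim_dilate_infty k Hk) (real_gamma_correct a Ha)) as H.
apply (is_RInt_gen_scal (V := R_NormedModule) _ (Rpower k (- a))) in H.
revert H. apply (is_RInt_gen_ext (V := R_NormedModule)).
generalize (range_prod range_half_line). apply filter_imp. intros [u v] [Hu Hv] t Ht; simpl in Hu, Hv.
assert (Ht0 : 0 < t) by (apply (range_between range_half_line u v t Hu Hv); simpl in Ht; lra).
unfold scal; simpl; unfold mult; simpl.
rewrite Rmult_1_l.
replace (Rpower (k * t) (a - 1)) with (Rpower k (a - 1) * Rpower t (a - 1))
  by (apply Rpower_mult_distr; assumption).
replace (Rpower k (- a) * (k * (Rpower k (a - 1) * Rpower t (a - 1) * exp (- (k * t)))))
  with ((Rpower k (- a) * Rpower k (a - 1) * k) * (Rpower t (a - 1) * exp (- (k * t)))) by ring.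
rewrite <- (Rpower_1 k Hk) at 3. rewrite <- !Rpower_plus.
replace (- a + (a - 1) + 1) with 0 by ring. rewrite Rpower_O by exact Hk. ring.
Qed.

(** The geometric remainder is bounded by a single exponential, so the integrated error is a
    multiple of the next index to the power [-Re s] and tends to 0 for every [Re s > 0]. *)
Lemma mellin_geom_series (beta : R) (s : C) : 0 < beta < 2 * PI -> 0 < Re s ->
  is_Cseries (fun n => phase beta ^ S n * (cpow (INR (S n)) (- s) * Gamma_integral s))%C
    (mellin (at_right 0) (Rbar_locally p_infty) (geom_real beta) s).
Proof.
intros Hb Hs. destruct (geom_remainder beta Hb) as (K & HK & Hrem).
assert (Hn : forall n, 0 < INR (S n)) by (intros; apply lt_0_INR; lia).
apply (is_Cseries_termwise range_half_line s (geom_real beta)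
  (fun n t => phase beta ^ S n * RtoC (exp (- (INR (S n) * t))))%C _ _
  (fun N t => K * (Rpower t (Re s - 1) * exp (- (INR (S (S N)) * t))))
  (fun N => K * (Rpower (INR (S (S N))) (- Re s) * real_gamma (Re s)))).
- apply mellin_correct_half_line; [now apply geom_real_decays|exact Hs].
- intros n. pose proof (is_CRInt_gen_scal range_half_line (phase beta ^ S n)%C _ _
    (Gamma_integral_dilate s (INR (S n)) Hs (Hn n))) as H.
  revert H. apply (is_CRInt_gen_ext range_half_line). intros; ring.
- intros N t Ht. replace (K * (Rpower t (Re s - 1) * exp (- (INR (S (S N)) * t))))
    with (Rpower t (Re s - 1) * (K * exp (- (INR (S (S N)) * t)))) by ring.
  apply Rmult_le_compat_l; [left; apply Rpower_pos|apply Hrem].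
- intros N. apply (is_RInt_gen_scal (V := R_NormedModule)). apply real_gamma_dilate; [exact Hs|apply Hn].
- replace (Finite 0) with (Rbar_mult (K * real_gamma (Re s)) 0) by (simpl; f_equal; ring).
  apply (is_lim_seq_ext (fun N => K * real_gamma (Re s) * Rpower (INR (S (S N))) (- Re s))).
  + intros; ring.
  + apply (is_lim_seq_scal_l _ (K * real_gamma (Re s)) 0). now apply Rpower_opp_lim_seq.
Qed.

(** * The periodic zeta function *)

Lemma e2pi_phase (n : nat) (a : R) : e2pi (INR n * a) = (phase (2 * PI * a) ^ n)%C.
Proof. rewrite phase_pow. unfold e2pi. do 3 f_equal. ring. Qed.

Section Zeta.

Variable a : R.
Hypothesis Ha : 0 < a < 1.
Let beta := 2 * PI * a.

Let Hbeta : 0 < beta < 2 * PI.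
Proof. unfold beta. pose proof PI_RGT_0. split; nra. Qed.

Lemma is_periodic_zeta_continuation (L : C -> C) : entire L ->
  (forall s, 0 < Re s -> (L s * Gamma_integral s)%C
     = mellin (at_right 0) (Rbar_locally p_infty) (geom_real beta) s) ->
  is_periodic_zeta a L.
Proof.
intros HL HM. split; [exact HL|]. intros s Hs.
pose proof (Gamma_integral_neq_0 s Hs) as Hg.
pose proof (is_Cseries_scal (/ Gamma_integral s)%C _ _ (mellin_geom_series beta s Hbeta Hs)) as H.
rewrite <- HM in H by exact Hs.
replace (/ Gamma_integral s * (L s * Gamma_integral s))%C with (L s) in H by (field; exact Hg).
revert H. apply is_Cseries_ext. intros n.
rewrite e2pi_phase, cpow_opp. fold beta. field. split; [apply cpow_neq_0|exact Hg].
Qed.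

Lemma is_periodic_zeta_unique (L L' : C -> C) :
  is_periodic_zeta a L -> is_periodic_zeta a L' -> forall s, L s = L' s.
Proof.
intros [H1 H2] [H1' H2']. apply entire_identity; try assumption.
intros s Hs. eapply is_Cseries_unique; [now apply H2|now apply H2'].
Qed.

(** The [epsilon] is meaningful once some function qualifies; the continued Mellin transform of
    [geom_real] is that witness. *)
Lemma periodic_zeta_spec : is_periodic_zeta a (periodic_zeta a).
Proof.
unfold periodic_zeta. apply epsilon_spec.
(* The singularities of [geom] nearest to 0 lie at distances [beta] and [2 pi - beta]; any smaller
   radius will do. *)
set (rho := Rmin beta (2 * PI - beta) / 2).
assert (Hm : 0 < Rmin beta (2 * PI - beta)) by (apply Rmin_pos; lra).
pose proof (Rmin_l beta (2 * PI - beta)). pose proof (Rmin_r beta (2 * PI - beta)).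
destruct (geom_taylor beta Hbeta (rho / 2) rho) as (c & K & HK); try (unfold rho; lra).
destruct (mellin_continuation (geom_real beta) c (rho / 2)) as (L & HL & HM & _).
- now apply geom_real_decays.
- unfold rho; lra.
- intros N. exists (K * / rho ^ N). intros t Ht. rewrite <- geom_RtoC.
  eapply Rle_trans; [apply HK; lra|]. right. unfold Rdiv. rewrite Rpow_mult_distr, pow_inv. ring.
- exists L. now apply is_periodic_zeta_continuation.
Qed.

(** The value of a continued Mellin transform at a pole of Gamma, transported to [periodic_zeta] by
    uniqueness. *)
Lemma periodic_zeta_opp_INR (c : nat -> C) (K d rho : R) (n : nat) : 0 < d ->
  (forall N t, 0 <= t <= d -> Cmod (geom_real beta t - poly_sum c N t)%C <= K * (t / rho) ^ N) ->
  periodic_zeta a (RtoC (- INR n)) = (RtoC ((-1) ^ n * INR (fact n)) * c n)%C.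
Proof.
intros Hd HK.
destruct (mellin_continuation (geom_real beta) c d) as (L & HL & HM & _ & Hv).
- now apply geom_real_decays.
- exact Hd.
- intros N. exists (K * / rho ^ N). intros t Ht.
  eapply Rle_trans; [apply HK; lra|]. right. unfold Rdiv. rewrite Rpow_mult_distr, pow_inv. ring.
- rewrite <- Hv. apply is_periodic_zeta_unique; [apply periodic_zeta_spec|].
  now apply is_periodic_zeta_continuation.
Qed.

(** At [s = 1] the defining series still converges, and the remainder bound for [polylog] at [t = 0]
    sums the same series. *)
Lemma periodic_zeta_1 : periodic_zeta a 1 = polylog beta 0.
Proof.
destruct periodic_zeta_spec as [_ H]. specialize (H 1 ltac:(simpl; lra)).
refine (is_Cseries_unique _ _ _ H _).
destruct (polylog_remainder beta Hbeta) as (K & HK & Hrem).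
apply (is_Cseries_of_bound _ _ (fun N => K * / INR (S (S N)))).
- intros N. specialize (Hrem (S N) 0).
  rewrite Rmult_0_r, Ropp_0, exp_0, Rmult_1_l in Hrem.
  rewrite (Csum_ext _ (fun m => phase beta ^ S m * RtoC (exp (- (INR (S m) * 0)) / INR (S m)))%C).
  + exact Hrem.
  + intros k _. rewrite e2pi_phase. fold beta.
    assert (Hk : 0 < INR (S k)) by (apply lt_0_INR; lia).
    rewrite cpow_1 by exact Hk. rewrite Rmult_0_r, Ropp_0, exp_0, RtoC_div by lra.
    field. intros E. apply RtoC_inj in E. lra.
- apply -> (is_lim_seq_incr_1 (fun N => K * / INR (S N))). apply is_lim_seq_scal_inv_S.
Qed.

End Zeta.

(** * The double series *)

Lemma is_double_series_unique (a : nat -> nat -> C) (l l' : C) :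
  is_double_series a l -> is_double_series a l' -> l = l'.
Proof.
intros [b [Hb H]] [b' [Hb' H']].
eapply is_Cseries_unique; [exact H|]. revert H'. apply is_Cseries_ext.
intros n. eapply is_Cseries_unique; [apply Hb'|apply Hb].
Qed.

Lemma double_series_eq (a : nat -> nat -> C) (l : C) : is_double_series a l -> double_series a = l.
Proof.
intros H. unfold double_series. apply (iota_unique (V := C_CompleteNormedModule)); [|exact H].
intros y Hy. eapply is_double_series_unique; [exact Hy|exact H].
Qed.

Lemma is_double_series_ext (a b : nat -> nat -> C) (l : C) :
  (forall n m, a n m = b n m) -> is_double_series a l -> is_double_series b l.
Proof.
intros H [c [Hc Hl]]. exists c. split; [|exact Hl].
intros n. apply (is_Cseries_ext (a n)); [apply H|apply Hc].
Qed.

Lemma is_double_series_scal (k : C) (a : nat -> nat -> C) (l : C) :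
  is_double_series a l -> is_double_series (fun n m => k * a n m)%C (k * l)%C.
Proof.
intros [c [Hc Hl]]. exists (fun n => k * c n)%C. split.
- intros n. apply is_Cseries_scal, Hc.
- now apply is_Cseries_scal.
Qed.

Section PolylogProduct.

Variables (bc bd x : R).
Hypotheses (Hbc : 0 < bc < 2 * PI) (Hbd : 0 < bd < 2 * PI) (Hx : 0 < x).

Definition polylog_product (t : R) : C := (polylog bc (x * t) * polylog bd t)%C.

Lemma polylog_dilate_continuous (t : R) : curve_continuous (fun t => polylog bc (x * t)) t.
Proof.
apply (continuous_comp (V := R_UniformSpace) (fun t => x * t) (polylog bc)).
- apply (continuous_scal_r (V := R_NormedModule) x (fun t => t)). apply continuous_id.
- now apply polylog_continuous.
Qed.

Lemma polylog_product_continuous (t : R) : curve_continuous polylog_product t.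
Proof. apply curve_continuous_mult; [apply polylog_dilate_continuous|now apply polylog_continuous]. Qed.

Lemma polylog_dilate_bound : exists K, 0 < K /\ forall t, 0 <= t -> Cmod (polylog bc (x * t)) <= K.
Proof.
destruct (polylog_bound bc Hbc) as (K & HK & H). exists K. split; [exact HK|].
intros t Ht. eapply Rle_trans; [apply H|].
assert (exp (- (x * t)) <= 1) by (rewrite <- exp_0; apply exp_le; nra). nra.
Qed.

Lemma polylog_product_decays : decays polylog_product.
Proof.
split; [intros; apply polylog_product_continuous|].
destruct polylog_dilate_bound as (K & HK & H). destruct (polylog_bound bd Hbd) as (K' & HK' & H').
exists (K * K'), 1. split; [lra|]. intros t Ht. unfold polylog_product.
rewrite Cmod_mult, Rmult_1_l, Rmult_assoc.
apply Rmult_le_compat; try apply Cmod_ge_0; [apply H; lra|apply H'].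
Qed.

(** Stated for an arbitrary range and family [I] because it is used twice: on the half-line it
    yields the series of [W], on [delta, oo) the series of incomplete Gamma values. *)
Lemma polylog_product_double_series {Fa Fb : (R -> Prop) -> Prop} {D : R -> Prop}
  (HR : positive_range Fa Fb D) (s l : C) (I : R -> C) :
  (forall k, 0 < k -> exists l, is_RInt_gen (fun t => Rpower t (Re s - 1) * exp (- (k * t))) Fa Fb l) ->
  (forall k, 0 < k -> is_CRInt_gen (fun t => cpow t (s - 1) * RtoC (exp (- (k * t))))%C Fa Fb (I k)) ->
  is_CRInt_gen (fun t => cpow t (s - 1) * polylog_product t)%C Fa Fb l ->
  is_double_series (fun n m => phase bc ^ S m * phase bd ^ S n / (RtoC (INR (S m)) * RtoC (INR (S n)))
     * I (INR (S n) + INR (S m) * x)%R)%C l.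
Proof.
intros Hex HI Hl.
assert (Hn : forall n, 0 < INR (S n)) by (intros; apply lt_0_INR; lia).
assert (HnC : forall n, RtoC (INR (S n)) <> 0).
{ intros n E. apply RtoC_inj in E. specialize (Hn n). lra. }
destruct (polylog_remainder bc Hbc) as (Kc & HKc & Hc).
destruct (polylog_remainder bd Hbd) as (Kd & HKd & Hd).
destruct polylog_dilate_bound as (K & HK & HA).
(* The outer sum expands only [polylog bd]; for fixed [n] the inner sum then expands [polylog bc]
   inside [G n]. *)
set (G := fun n t => (phase bd ^ S n / RtoC (INR (S n)) * (polylog bc (x * t) * RtoC (exp (- (INR (S n) * t)))))%C).
assert (HGc : forall n t, curve_continuous (G n) t).
{ intros n t. apply curve_continuous_mult; [apply curve_continuous_const|].
  apply curve_continuous_mult; [apply polylog_dilate_continuous|apply curve_continuous_exp]. }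
assert (HGn : forall n, Cmod (phase bd ^ S n / RtoC (INR (S n)))%C = / INR (S n)).
{ intros n. rewrite Cmod_div by apply HnC. rewrite Cmod_pow_1 by apply Cmod_phase.
  rewrite Cmod_R, Rabs_pos_eq by (left; apply Hn). unfold Rdiv. ring. }
assert (HGi : forall n, is_CRInt_gen (fun t => cpow t (s - 1) * G n t)%C Fa Fb (mellin Fa Fb (G n) s)).
{ intros n. destruct (Hex (INR (S n)) (Hn n)) as [l0 Hl0].
  apply (mellin_correct HR (G n) s
    (fun t => / INR (S n) * K * (Rpower t (Re s - 1) * exp (- (INR (S n) * t)))) (/ INR (S n) * K * l0)).
  - intros; apply HGc.
  - intros t Ht. apply (continuous_scal_r (V := R_NormedModule)).
    apply continuous_gamma_integrand. now apply HR.
  - intros t Ht. unfold G. rewrite !Cmod_mult, HGn, Cmod_R, Rabs_pos_eq by (left; apply exp_pos).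
    replace (/ INR (S n) * K * (Rpower t (Re s - 1) * exp (- (INR (S n) * t))))
      with (Rpower t (Re s - 1) * (/ INR (S n) * (K * exp (- (INR (S n) * t))))) by ring.
    apply Rmult_le_compat_l; [left; apply Rpower_pos|].
    apply Rmult_le_compat_l; [left; apply Rinv_0_lt_compat, Hn|].
    apply Rmult_le_compat_r; [left; apply exp_pos|]. apply HA. left. now apply HR.
  - apply (range_RInt_gen_scal HR); exact Hl0. }
exists (fun n => mellin Fa Fb (G n) s). split.
- intros n. destruct (Hex (INR (S n)) (Hn n)) as [l0 Hl0].
  apply (is_Cseries_termwise HR s (G n)
    (fun m t => phase bc ^ S m * phase bd ^ S n / (RtoC (INR (S m)) * RtoC (INR (S n)))
       * RtoC (exp (- ((INR (S n) + INR (S m) * x)%R * t))))%C _ _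
    (fun M t => (/ INR (S n) * Kc * / INR (S (S M))) * (Rpower t (Re s - 1) * exp (- (INR (S n) * t))))
    (fun M => (/ INR (S n) * Kc * / INR (S (S M))) * l0)).
  + apply HGi.
  + intros m. assert (Hk : 0 < INR (S n) + INR (S m) * x).
    { pose proof (Hn n). pose proof (Rmult_lt_0_compat _ _ (Hn m) Hx). lra. }
    pose proof (is_CRInt_gen_scal HR
      (phase bc ^ S m * phase bd ^ S n / (RtoC (INR (S m)) * RtoC (INR (S n))))%C _ _ (HI _ Hk)) as H.
    revert H. apply (is_CRInt_gen_ext HR). intros; ring.
  + intros M t Ht. assert (Ht0 : 0 < t) by now apply HR.
    replace (G n t - Csum (fun m => phase bc ^ S m * phase bd ^ S n / (RtoC (INR (S m)) * RtoC (INR (S n)))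
       * RtoC (exp (- ((INR (S n) + INR (S m) * x)%R * t)))) (S M))%C
     with ((phase bd ^ S n / RtoC (INR (S n))) * ((polylog bc (x * t)
        - Csum (fun m => phase bc ^ S m * RtoC (exp (- (INR (S m) * (x * t))%R) / INR (S m))) (S M))
        * RtoC (exp (- (INR (S n) * t)))))%C.
    2: { unfold G.
      rewrite (Csum_ext (fun m => phase bc ^ S m * phase bd ^ S n / (RtoC (INR (S m)) * RtoC (INR (S n)))
         * RtoC (exp (- ((INR (S n) + INR (S m) * x)%R * t))))%C
        (fun m => (phase bd ^ S n / RtoC (INR (S n)) * RtoC (exp (- (INR (S n) * t))))
          * (phase bc ^ S m * RtoC (exp (- (INR (S m) * (x * t))%R) / INR (S m))))%C).
      - rewrite Csum_scal. ring.
      - intros m _. replace (- ((INR (S n) + INR (S m) * x) * t)) with (- (INR (S n) * t) + - (INR (S m) * (x * t))) by ring.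
        rewrite exp_plus, RtoC_mult, RtoC_div by (apply Rgt_not_eq, Hn). field. split; apply HnC. }
    rewrite !Cmod_mult, HGn, Cmod_R, Rabs_pos_eq by (left; apply exp_pos).
    replace (/ INR (S n) * Kc * / INR (S (S M)) * (Rpower t (Re s - 1) * exp (- (INR (S n) * t))))
      with (Rpower t (Re s - 1) * (/ INR (S n) * (Kc * / INR (S (S M)) * exp (- (INR (S n) * t))))) by ring.
    apply Rmult_le_compat_l; [left; apply Rpower_pos|].
    apply Rmult_le_compat_l; [left; apply Rinv_0_lt_compat, Hn|].
    apply Rmult_le_compat_r; [left; apply exp_pos|].
    (* The exponential in the remainder is discarded: its factor [1/(M+2)] gives convergence, and
       the weight [exp(-(n+1)t)] from [G n] keeps the integral finite. *)
    eapply Rle_trans; [apply Hc|]. apply Rmult_le_compat_l; [lra|].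
    rewrite <- (Rmult_1_l (/ INR (S (S M)))) at 2.
    apply Rmult_le_compat_r; [left; apply Rinv_0_lt_compat, Hn|].
    rewrite <- exp_0. apply exp_le.
    pose proof (Rmult_lt_0_compat _ _ (Hn (S M)) (Rmult_lt_0_compat _ _ Hx Ht0)). lra.
  + intros M. apply (range_RInt_gen_scal HR); exact Hl0.
  + apply (is_lim_seq_ext (fun M => (/ INR (S n) * Kc * l0) * / INR (S (S M)))); [intros; ring|].
    apply -> (is_lim_seq_incr_1 (fun N => (/ INR (S n) * Kc * l0) * / INR (S N))). apply is_lim_seq_scal_inv_S.
- destruct (Hex 1 Rlt_0_1) as [l0 Hl0].
  apply (is_Cseries_termwise HR s polylog_product G _ _
    (fun N t => (K * Kd * / INR (S (S N))) * (Rpower t (Re s - 1) * exp (- (1 * t))))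
    (fun N => (K * Kd * / INR (S (S N))) * l0)).
  + exact Hl.
  + exact HGi.
  + intros N t Ht. assert (Ht0 : 0 < t) by now apply HR.
    replace (polylog_product t - Csum (fun n => G n t) (S N))%C
     with (polylog bc (x * t) * (polylog bd t
        - Csum (fun m => phase bd ^ S m * RtoC (exp (- (INR (S m) * t)) / INR (S m))) (S N)))%C.
    2: { unfold polylog_product, G.
      rewrite (Csum_ext (fun n => phase bd ^ S n / RtoC (INR (S n)) * (polylog bc (x * t) * RtoC (exp (- (INR (S n) * t)))))%C
        (fun m => polylog bc (x * t) * (phase bd ^ S m * RtoC (exp (- (INR (S m) * t)) / INR (S m))))%C).
      - rewrite Csum_scal. ring.
      - intros m _. rewrite RtoC_div by (apply Rgt_not_eq, Hn). field. apply HnC. }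
    rewrite Cmod_mult.
    replace (K * Kd * / INR (S (S N)) * (Rpower t (Re s - 1) * exp (- (1 * t))))
      with (Rpower t (Re s - 1) * (K * (Kd * (exp (- (1 * t)) * / INR (S (S N)))))) by ring.
    apply Rmult_le_compat_l; [left; apply Rpower_pos|].
    apply Rmult_le_compat; try apply Cmod_ge_0; [apply HA; lra|].
    eapply Rle_trans; [apply Hd|]. apply Rmult_le_compat_l; [lra|].
    apply Rmult_le_compat_r; [left; apply Rinv_0_lt_compat, Hn|].
    (* All remainders share the integrable weight [exp(-t)]; the smallness comes from [1/(N+2)]
       alone. *)
    apply exp_le. rewrite S_INR. pose proof (Rmult_lt_0_compat _ _ (Hn N) Ht0). lra.
  + intros N. apply (range_RInt_gen_scal HR); exact Hl0.
  + apply (is_lim_seq_ext (fun M => (K * Kd * l0) * / INR (S (S M)))); [intros; ring|].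
    apply -> (is_lim_seq_incr_1 (fun N => (K * Kd * l0) * / INR (S N))). apply is_lim_seq_scal_inv_S.
Qed.

End PolylogProduct.

(** * Products of power series near the origin *)

Lemma is_Cseries_of_eventual_bound (a : nat -> C) (l : C) (e : nat -> R) (N0 : nat) :
  (forall N, (N0 <= N)%nat -> Cmod (l - Csum a N)%C <= e N) -> is_lim_seq e 0 -> is_Cseries a l.
Proof.
intros He Hlim.
(* Before [N0] the actual error serves as its own bound. *)
apply (is_Cseries_of_bound a l (fun N => if le_dec N0 (S N) then e (S N) else Cmod (l - Csum a (S N))%C)).
- intros N. destruct (le_dec N0 (S N)) as [H|H]; [now apply He|apply Rle_refl].
- apply is_lim_seq_incr_1 in Hlim.
  refine (is_lim_seq_ext_loc _ _ _ _ Hlim). exists N0. intros n Hn.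
  destruct (le_dec N0 (S n)); [reflexivity|lia].
Qed.

Lemma is_lim_seq_geom_scal (K q : R) : 0 <= q < 1 -> is_lim_seq (fun n => K * q ^ n) 0.
Proof.
intros Hq. replace (Finite 0) with (Rbar_mult K 0) by (simpl; f_equal; ring).
apply (is_lim_seq_scal_l _ K 0). apply is_lim_seq_geom. rewrite Rabs_pos_eq; lra.
Qed.

Lemma poly_sum_plus (p q : nat -> C) (N : nat) (t : R) :
  poly_sum (fun k => p k + q k)%C N t = (poly_sum p N t + poly_sum q N t)%C.
Proof. unfold poly_sum. rewrite <- Csum_plus. apply Csum_ext. intros; ring. Qed.

Lemma poly_sum_scal (c : C) (p : nat -> C) (N : nat) (t : R) :
  poly_sum (fun k => c * p k)%C N t = (c * poly_sum p N t)%C.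
Proof. unfold poly_sum. rewrite <- Csum_scal. apply Csum_ext. intros; ring. Qed.

Lemma poly_sum_ext (p q : nat -> C) (N : nat) (t : R) :
  (forall k, (k < N)%nat -> p k = q k) -> poly_sum p N t = poly_sum q N t.
Proof. intros H. apply Csum_ext. intros k Hk. now rewrite H. Qed.

(* Coefficients of [c * t^u * sum_k b_k t^k]. *)
Definition shift_coef (c : C) (u : nat) (b : nat -> C) (k : nat) : C :=
  if lt_dec k u then 0 else (c * b (k - u)%nat)%C.

Lemma poly_sum_shift (c : C) (u : nat) (b : nat -> C) (N : nat) (t : R) :
  poly_sum (shift_coef c u b) N t = (c * RtoC (t ^ u) * poly_sum b (N - u) t)%C.
Proof.
induction N.
- unfold poly_sum; simpl. ring.
- unfold poly_sum in *. rewrite Csum_S, IHN. unfold shift_coef at 1.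
  destruct (lt_dec N u) as [H|H].
  + replace (S N - u)%nat with O by lia. replace (N - u)%nat with O by lia. simpl. ring.
  + replace (S N - u)%nat with (S (N - u)) by lia. rewrite Csum_S.
    replace N with (u + (N - u))%nat at 3 by lia. rewrite pow_add, RtoC_mult. ring.
Qed.

(** * Finite parts as a linear functional *)

Section FinitePart.

Variables (d : R) (s : C) (N : nat).
Hypotheses (Hd : 0 < d) (HN : 0 < Re s + INR N).

(** A single order [N] is enough for the finite part at the fixed [s], because [Re s > -N]. *)
Definition taylor_bounded (f : R -> C) (p : nat -> C) : Prop :=
  (forall t, 0 < t <= d -> curve_continuous f t) /\
  exists K, forall t, 0 < t <= d -> Cmod (f t - poly_sum p N t)%C <= K * t ^ N.

Let part (f : R -> C) (p : nat -> C) : C := mellin_finite_part f p d N s.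

Lemma taylor_bounded_plus (f g : R -> C) (p q : nat -> C) :
  taylor_bounded f p -> taylor_bounded g q ->
  taylor_bounded (fun t => f t + g t)%C (fun k => p k + q k)%C.
Proof.
intros [Hf [K HK]] [Hg [K' HK']]. split.
- intros t Ht. apply curve_continuous_plus; [now apply Hf|now apply Hg].
- exists (K + K'). intros t Ht. rewrite poly_sum_plus.
  replace (f t + g t - (poly_sum p N t + poly_sum q N t))%C
    with ((f t - poly_sum p N t) + (g t - poly_sum q N t))%C by ring.
  eapply Rle_trans; [apply Cmod_triangle|]. specialize (HK t Ht). specialize (HK' t Ht). lra.
Qed.

Lemma taylor_bounded_scal (c : C) (f : R -> C) (p : nat -> C) :
  taylor_bounded f p -> taylor_bounded (fun t => c * f t)%C (fun k => c * p k)%C.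
Proof.
intros [Hf [K HK]]. split.
- intros t Ht. apply curve_continuous_mult; [apply curve_continuous_const|now apply Hf].
- exists (Cmod c * K). intros t Ht. rewrite poly_sum_scal.
  replace (c * f t - c * poly_sum p N t)%C with (c * (f t - poly_sum p N t))%C by ring.
  rewrite Cmod_mult, Rmult_assoc. apply Rmult_le_compat_l; [apply Cmod_ge_0|now apply HK].
Qed.

Lemma finite_part_correct (f : R -> C) (p : nat -> C) : taylor_bounded f p ->
  is_CRInt_gen (fun t => cpow t (s - 1) * (f t - poly_sum p N t))%C (at_right 0) (at_point d)
    (mellin_remainder f p d N s).
Proof.
intros [Hf [K HK]]. apply (is_CRInt_gen_left_bound _ s d K N Hd HN); [|exact HK].
intros t Ht. apply curve_continuous_minus; [now apply Hf|apply curve_continuous_poly_sum].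
Qed.

Lemma finite_part_ext (f g : R -> C) (p q : nat -> C) :
  taylor_bounded f p ->
  (forall t, 0 < t <= d -> f t = g t) -> (forall k, (k < N)%nat -> p k = q k) -> part f p = part g q.
Proof.
intros Hf Hfg Hpq. unfold part, mellin_finite_part. f_equal.
- symmetry. apply (mellin_unique (range_left d Hd)).
  generalize (finite_part_correct f p Hf). apply (is_CRInt_gen_ext (range_left d Hd)).
  intros t Ht. rewrite (Hfg t Ht), (poly_sum_ext p q N t Hpq). reflexivity.
- apply Csum_ext. intros k Hk. now rewrite Hpq.
Qed.

Lemma finite_part_minus (f g : R -> C) (p q : nat -> C) :
  taylor_bounded f p -> taylor_bounded g q ->
  part (fun t => f t - g t)%C (fun k => p k - q k)%C = (part f p - part g q)%C.
Proof.
intros Hf Hg. unfold part, mellin_finite_part.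
assert (E1 : mellin_remainder (fun t => f t - g t)%C (fun k => p k - q k)%C d N s
  = (mellin_remainder f p d N s - mellin_remainder g q d N s)%C).
{ apply (mellin_unique (range_left d Hd)).
  generalize (is_CRInt_gen_minus (range_left d Hd) _ _ _ _ (finite_part_correct f p Hf) (finite_part_correct g q Hg)).
  apply (is_CRInt_gen_ext (range_left d Hd)). intros t Ht.
  assert (E : poly_sum (fun k => p k - q k)%C N t = (poly_sum p N t - poly_sum q N t)%C).
  { unfold Cminus. rewrite poly_sum_plus.
    rewrite (poly_sum_ext (fun k => - q k)%C (fun k => - (1) * q k)%C) by (intros; ring).
    rewrite poly_sum_scal. ring. }
  rewrite E. ring. }
rewrite E1.
rewrite (Csum_ext (fun k => (p k - q k) * (cpow d (s + RtoC (INR k)) / (s + RtoC (INR k))))%C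
  (fun k => p k * (cpow d (s + RtoC (INR k)) / (s + RtoC (INR k)))
     + - (1) * (q k * (cpow d (s + RtoC (INR k)) / (s + RtoC (INR k)))))%C) by (intros; ring).
rewrite Csum_plus, Csum_scal. ring.
Qed.

(** With no coefficients below [N] the finite part is a convergent integral; this is the only way in
    which it is estimated. *)
Lemma finite_part_bound (f : R -> C) (p : nat -> C) (K : R) :
  (forall t, 0 < t <= d -> curve_continuous f t) ->
  (forall k, (k < N)%nat -> p k = 0) -> (forall t, 0 < t <= d -> Cmod (f t) <= K * t ^ N) ->
  Cmod (part f p) <= K * (Rpower d (Re s + INR N) / (Re s + INR N)).
Proof.
intros Hf Hp HK. unfold part, mellin_finite_part.
rewrite Csum_0 by (intros k Hk; rewrite Hp by exact Hk; ring). rewrite Cplus_0_r.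
apply (is_CRInt_gen_left_bound _ s d K N Hd HN).
- intros t Ht. apply curve_continuous_minus; [now apply Hf|apply curve_continuous_poly_sum].
- intros t Ht. assert (E : poly_sum p N t = 0).
  { apply Csum_0. intros k Hk. rewrite Hp by exact Hk. ring. }
  rewrite E. replace (f t - 0)%C with (f t) by ring. now apply HK.
Qed.

Definition unit_coef (j k : nat) : C := if Nat.eq_dec k j then 1 else 0.

Lemma Csum_unit_coef (j n : nat) (g : nat -> C) :
  Csum (fun k => unit_coef j k * g k)%C n = if lt_dec j n then g j else 0.
Proof.
induction n.
- simpl. reflexivity.
- rewrite Csum_S, IHn. unfold unit_coef.
  destruct (Nat.eq_dec n j) as [E|E].
  + subst n. destruct (lt_dec j j); [lia|]. destruct (lt_dec j (S j)); [ring|lia].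
  + destruct (lt_dec j n); destruct (lt_dec j (S n)); try lia; ring.
Qed.

Lemma taylor_bounded_monomial (j : nat) : taylor_bounded (fun t => RtoC (t ^ j)) (unit_coef j).
Proof.
split; [intros; apply curve_continuous_pow|].
(* For [j < N] the subtraction truncates to 0 and the remainder is zero anyway; otherwise the
   [j - N] surplus powers of [t] are bounded by those of [d]. *)
exists (d ^ (j - N)). intros t Ht. unfold poly_sum. rewrite Csum_unit_coef.
destruct (lt_dec j N) as [H|H].
- replace (RtoC (t ^ j) - RtoC (t ^ j))%C with (RtoC 0) by ring. rewrite Cmod_0.
  apply Rmult_le_pos; apply pow_le; lra.
- replace (RtoC (t ^ j) - 0)%C with (RtoC (t ^ j)) by ring.
  rewrite Cmod_R, Rabs_pos_eq by (apply pow_le; lra).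
  replace j with ((j - N) + N)%nat at 1 by lia. rewrite pow_add.
  apply Rmult_le_compat_r; [apply pow_le; lra|]. apply pow_incr. lra.
Qed.

(** One formula covers both cases: below [N] it is the regularized term, from [N] on it is a genuine
    integral. *)
Lemma finite_part_monomial (j : nat) :
  part (fun t => RtoC (t ^ j)) (unit_coef j) = (cpow d (s + RtoC (INR j)) / (s + RtoC (INR j)))%C.
Proof.
unfold part, mellin_finite_part. rewrite Csum_unit_coef.
destruct (lt_dec j N) as [H|H].
- replace (mellin_remainder (fun t => RtoC (t ^ j)) (unit_coef j) d N s) with (RtoC 0); [ring|].
  symmetry. apply (mellin_unique (range_left d Hd)).
  pose proof (is_CRInt_gen_scal (range_left d Hd) 0 _ _ (is_CRInt_gen_monomial s N d Hd HN)) as H0.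
  rewrite Cmult_0_l in H0. revert H0. apply (is_CRInt_gen_ext (range_left d Hd)).
  intros t Ht. unfold poly_sum. rewrite Csum_unit_coef. destruct (lt_dec j N); [ring|lia].
- rewrite Cplus_0_r. apply (mellin_unique (range_left d Hd)).
  assert (Hj : 0 < Re s + INR j).
  { assert (INR N <= INR j) by (apply le_INR; lia). lra. }
  generalize (is_CRInt_gen_monomial s j d Hd Hj). apply (is_CRInt_gen_ext (range_left d Hd)).
  intros t Ht. unfold poly_sum. rewrite Csum_unit_coef. destruct (lt_dec j N); [lia|ring].
Qed.

Lemma finite_part_scal (c : C) (f : R -> C) (p : nat -> C) : taylor_bounded f p ->
  part (fun t => c * f t)%C (fun k => c * p k)%C = (c * part f p)%C.
Proof.
intros Hf. unfold part, mellin_finite_part.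
assert (E1 : mellin_remainder (fun t => c * f t)%C (fun k => c * p k)%C d N s
  = (c * mellin_remainder f p d N s)%C).
{ apply (mellin_unique (range_left d Hd)).
  generalize (is_CRInt_gen_scal (range_left d Hd) c _ _ (finite_part_correct f p Hf)).
  apply (is_CRInt_gen_ext (range_left d Hd)). intros t Ht. rewrite poly_sum_scal. ring. }
rewrite E1.
rewrite (Csum_ext (fun k => c * p k * (cpow d (s + RtoC (INR k)) / (s + RtoC (INR k))))%C
  (fun k => c * (p k * (cpow d (s + RtoC (INR k)) / (s + RtoC (INR k)))))%C) by (intros; ring).
rewrite Csum_scal. ring.
Qed.

(** From [n = N] on, the partial sums have the coefficients of [f] below [N], so the difference
    vanishes to order [N] and its finite part is at most a constant times [e n]. *)
Lemma finite_part_series (f : R -> C) (p : nat -> C) (g : nat -> R -> C) (q : nat -> nat -> C) (e : nat -> R) :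
  taylor_bounded f p -> (forall n, taylor_bounded (g n) (q n)) ->
  (forall n k, (k < N)%nat -> (N <= n)%nat -> p k = Csum (fun n => q n k) n) ->
  (forall n t, (N <= n)%nat -> 0 < t <= d -> Cmod (f t - Csum (fun n => g n t) n)%C <= e n * t ^ N) ->
  is_lim_seq e 0 ->
  is_Cseries (fun n => part (g n) (q n)) (part f p).
Proof.
intros Hf Hg Hpq He Hlim.
assert (Hrem : forall n,
  taylor_bounded (fun t => f t - Csum (fun n => g n t) n)%C (fun k => p k - Csum (fun n => q n k) n)%C /\
  part (fun t => f t - Csum (fun n => g n t) n)%C (fun k => p k - Csum (fun n => q n k) n)%C
   = (part f p - Csum (fun n => part (g n) (q n)) n)%C).
{ assert (Hext : forall f f' p p', (forall t, f t = f' t) -> (forall k, p k = p' k) ->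
    taylor_bounded f p -> taylor_bounded f' p').
  { intros h h' w w' Eh Ew [Hh [K HK]]. split.
    - intros t Ht. apply (continuous_ext (U := C_R_NormedModule) h); [exact Eh|now apply Hh].
    - exists K. intros t Ht. rewrite <- Eh, <- (poly_sum_ext w w') by (intros; apply Ew). now apply HK. }
  induction n as [|n [IH1 IH2]].
  - assert (H0 : taylor_bounded (fun t => f t - Csum (fun n => g n t) 0)%C (fun k => p k - Csum (fun n => q n k) 0)%C).
    { apply (Hext f _ p); [intros; simpl; ring|intros; simpl; ring|exact Hf]. }
    split; [exact H0|].
    rewrite <- (finite_part_ext f (fun t => f t - Csum (fun n => g n t) 0)%C p (fun k => p k - Csum (fun n => q n k) 0)%C);
      [simpl; ring|exact Hf|intros; simpl; ring|intros; simpl; ring].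
  - split.
    + apply (Hext (fun t => (f t - Csum (fun n => g n t) n) + - (1) * g n t)%C _
        (fun k => (p k - Csum (fun n => q n k) n) + - (1) * q n k)%C).
      * intros t. rewrite Csum_S. ring.
      * intros k. rewrite Csum_S. ring.
      * apply taylor_bounded_plus; [exact IH1|]. now apply taylor_bounded_scal.
    + rewrite Csum_S.
      replace (part f p - (Csum (fun n => part (g n) (q n)) n + part (g n) (q n)))%C
        with ((part f p - Csum (fun n => part (g n) (q n)) n) - part (g n) (q n))%C by ring.
      rewrite <- IH2, <- finite_part_minus by first [exact IH1 | apply Hg].
      symmetry. apply finite_part_ext.
      * apply (Hext (fun t => (f t - Csum (fun n => g n t) n) + - (1) * g n t)%C _
        (fun k => (p k - Csum (fun n => q n k) n) + - (1) * q n k)%C).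
        -- intros t. ring.
        -- intros k. ring.
        -- apply taylor_bounded_plus; [exact IH1|]. now apply taylor_bounded_scal.
      * intros t _. rewrite Csum_S. ring.
      * intros k _. rewrite Csum_S. ring. }
set (C0 := Rpower d (Re s + INR N) / (Re s + INR N)).
apply (is_Cseries_of_eventual_bound _ _ (fun n => e n * C0) N).
- intros n Hn. destruct (Hrem n) as [[Hc _] E]. rewrite <- E.
  apply finite_part_bound; [exact Hc| |].
  + intros k Hk. rewrite (Hpq n k Hk Hn). ring.
  + intros t Ht. now apply He.
- replace (Finite 0) with (Rbar_mult C0 0) by (simpl; f_equal; ring).
  apply (is_lim_seq_ext (fun n => C0 * e n)); [intros; ring|]. now apply (is_lim_seq_scal_l _ C0 0).
Qed.

Section Product.

Variables (A B : R -> C) (a b : nat -> C) (KA KB ra rb : R).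
Hypotheses (Hra : d < ra) (Hrb : d < rb).
Hypothesis HAc : forall t, 0 < t <= d -> curve_continuous A t.
Hypothesis HBc : forall t, 0 < t <= d -> curve_continuous B t.
Hypothesis HA : forall n t, 0 <= t <= d -> Cmod (A t - poly_sum a n t)%C <= KA * (t / ra) ^ n.
Hypothesis HB : forall n t, 0 <= t <= d -> Cmod (B t - poly_sum b n t)%C <= KB * (t / rb) ^ n.

(** The Cauchy product, organised by rows [a_u t^u B(t)], as in the outer sum. *)
Definition cauchy_coef (k : nat) : C := Csum (fun u => shift_coef (a u) u b k) (S k).

(** Keeps [N] powers of [t] for integrability at 0 and converts the others into the geometric factor
    [(d/r)^n]. *)
Lemma ratio_pow_le (r t : R) (n : nat) : d < r -> 0 < t <= d -> (N <= n)%nat ->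
  (t / r) ^ n <= / d ^ N * (d / r) ^ n * t ^ N.
Proof.
intros Hr Ht Hn. replace n with (N + (n - N))%nat by lia. rewrite !pow_add.
assert (E : / d ^ N * ((d / r) ^ N * (d / r) ^ (n - N)) * t ^ N = (t / r) ^ N * (d / r) ^ (n - N)).
{ unfold Rdiv. rewrite !Rpow_mult_distr. field. apply pow_nonzero; lra. }
rewrite E. apply Rmult_le_compat_l.
- apply pow_le, Rmult_le_pos; [lra|left; apply Rinv_0_lt_compat; lra].
- apply pow_incr. split; [apply Rmult_le_pos; [lra|left; apply Rinv_0_lt_compat; lra]|].
  apply Rmult_le_compat_r; [left; apply Rinv_0_lt_compat; lra|lra].
Qed.

Lemma ratio_lt_1 (r : R) : d < r -> 0 <= d / r < 1.
Proof.
intros Hr. split; [apply Rmult_le_pos; [lra|left; apply Rinv_0_lt_compat; lra]|].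
apply Rmult_lt_reg_r with r; [lra|]. unfold Rdiv. rewrite Rmult_assoc, Rinv_l by lra. lra.
Qed.

Lemma taylor_bounded_shift (c : C) (u : nat) :
  taylor_bounded (fun t => c * RtoC (t ^ u) * B t)%C (shift_coef c u b).
Proof.
split.
- intros t Ht. apply curve_continuous_mult; [|now apply HBc].
  apply curve_continuous_mult; [apply curve_continuous_const|apply curve_continuous_pow].
(* Truncated subtraction makes [u + m >= N] in every case; the surplus powers of [t] are bounded by
   powers of [d]. *)
- set (m := (N - u)%nat). exists (Cmod c * (Rabs KB * / rb ^ m) * d ^ (u + m - N)).
  intros t Ht. rewrite poly_sum_shift. fold m.
  replace (c * RtoC (t ^ u) * B t - c * RtoC (t ^ u) * poly_sum b m t)%C
    with (c * RtoC (t ^ u) * (B t - poly_sum b m t))%C by ring.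
  rewrite !Cmod_mult, Cmod_R, Rabs_pos_eq by (apply pow_le; lra).
  assert (Hr : 0 < rb ^ m) by (apply pow_lt; lra).
  assert (Hm : Cmod (B t - poly_sum b m t)%C <= Rabs KB * / rb ^ m * t ^ m).
  { eapply Rle_trans; [apply HB; lra|]. unfold Rdiv. rewrite Rpow_mult_distr, pow_inv.
    pose proof (Rle_abs KB). assert (0 <= t ^ m) by (apply pow_le; lra).
    assert (0 < / rb ^ m) by now apply Rinv_0_lt_compat.
    replace (Rabs KB * / rb ^ m * t ^ m) with (Rabs KB * (t ^ m * / rb ^ m)) by ring.
    apply Rmult_le_compat_r; [apply Rmult_le_pos; lra|assumption]. }
  apply Rle_trans with (Cmod c * t ^ u * (Rabs KB * / rb ^ m * t ^ m)).
  + apply Rmult_le_compat_l; [|exact Hm]. apply Rmult_le_pos; [apply Cmod_ge_0|apply pow_le; lra].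
  + replace (Cmod c * t ^ u * (Rabs KB * / rb ^ m * t ^ m))
      with (Cmod c * (Rabs KB * / rb ^ m) * t ^ (u + m)) by (rewrite pow_add; ring).
    rewrite !Rmult_assoc. do 3 (apply Rmult_le_compat_l;
      [first [apply Cmod_ge_0 | apply Rabs_pos | left; now apply Rinv_0_lt_compat]|]).
    replace (u + m)%nat with ((u + m - N) + N)%nat at 1 by (unfold m; lia). rewrite pow_add.
    apply Rmult_le_compat_r; [apply pow_le; lra|]. apply pow_incr. lra.
Qed.

Lemma shift_coef_Csum (n k : nat) : (k < n)%nat ->
  Csum (fun u => shift_coef (a u) u b k) n = cauchy_coef k.
Proof.
unfold cauchy_coef. intros H. induction n; [lia|].
destruct (Nat.eq_dec n k) as [->|Hn]; [reflexivity|].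
rewrite Csum_S, IHn by lia.
assert (E : shift_coef (a n) n b k = 0) by (unfold shift_coef; destruct (lt_dec k n); [reflexivity|lia]).
rewrite E. ring.
Qed.

Lemma HA_eventual (n : nat) (t : R) : (N <= n)%nat -> 0 < t <= d ->
  Cmod (A t * B t - Csum (fun u => a u * RtoC (t ^ u) * B t) n)%C
  <= Rabs KA * Rabs KB * / d ^ N * (d / ra) ^ n * t ^ N.
Proof.
intros Hn Ht.
replace (A t * B t - Csum (fun u => a u * RtoC (t ^ u) * B t) n)%C
  with ((A t - poly_sum a n t) * B t)%C.
2: { rewrite (Csum_ext _ (fun u => B t * (a u * RtoC (t ^ u)))%C) by (intros; ring).
  rewrite Csum_scal. unfold poly_sum. ring. }
rewrite Cmod_mult.
assert (H1 : Cmod (A t - poly_sum a n t)%C <= Rabs KA * (/ d ^ N * (d / ra) ^ n * t ^ N)).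
{ eapply Rle_trans; [apply HA; lra|]. apply Rle_trans with (Rabs KA * (t / ra) ^ n).
  - apply Rmult_le_compat_r; [|apply Rle_abs].
    apply pow_le, Rmult_le_pos; [lra|left; apply Rinv_0_lt_compat; lra].
  - apply Rmult_le_compat_l; [apply Rabs_pos|now apply ratio_pow_le]. }
assert (H2 : Cmod (B t) <= Rabs KB).
{ specialize (HB O t ltac:(lra)). unfold poly_sum in HB; simpl in HB.
  replace (B t - 0)%C with (B t) in HB by ring. pose proof (Rle_abs KB). lra. }
replace (Rabs KA * Rabs KB * / d ^ N * (d / ra) ^ n * t ^ N)
  with (Rabs KA * (/ d ^ N * (d / ra) ^ n * t ^ N) * Rabs KB) by ring.
apply Rmult_le_compat; try apply Cmod_ge_0; assumption.
Qed.

Lemma taylor_bounded_Csum (h : nat -> R -> C) (w : nat -> nat -> C) (n : nat) :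
  (forall u, taylor_bounded (h u) (w u)) ->
  taylor_bounded (fun t => Csum (fun u => h u t) n) (fun k => Csum (fun u => w u k) n).
Proof.
intros Hh. induction n.
- split; [intros; apply curve_continuous_const|]. exists 0. intros t Ht. simpl.
  unfold poly_sum. rewrite Csum_0 by (intros; simpl; ring).
  replace (0 - 0)%C with (RtoC 0) by ring. rewrite Cmod_0. lra.
- apply (taylor_bounded_plus _ (h n) _ (w n) IHn (Hh n)).
Qed.

Lemma taylor_bounded_product : taylor_bounded (fun t => A t * B t)%C cauchy_coef.
Proof.
destruct (taylor_bounded_Csum (fun u t => a u * RtoC (t ^ u) * B t)%C (fun u => shift_coef (a u) u b) N
  (fun u => taylor_bounded_shift (a u) u)) as [Hc [K HK]].
split.
- intros t Ht. apply curve_continuous_mult; [now apply HAc|now apply HBc].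
- exists (Rabs KA * Rabs KB * / d ^ N * (d / ra) ^ N + K). intros t Ht.
  rewrite (poly_sum_ext cauchy_coef (fun k => Csum (fun u => shift_coef (a u) u b k) N)).
  2: { intros k Hk. symmetry. now apply shift_coef_Csum. }
  replace (A t * B t - poly_sum (fun k => Csum (fun u => shift_coef (a u) u b k) N) N t)%C
   with ((A t * B t - Csum (fun u => a u * RtoC (t ^ u) * B t) N)
     + (Csum (fun u => a u * RtoC (t ^ u) * B t) N
        - poly_sum (fun k => Csum (fun u => shift_coef (a u) u b k) N) N t))%C by ring.
  eapply Rle_trans; [apply Cmod_triangle|].
  pose proof (HA_eventual N t (Nat.le_refl N) Ht). specialize (HK t Ht). lra.
Qed.

(** [finite_part_series] applied twice: to the powers of [B] in a row with [u] fixed, then to the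
    rows. *)
Lemma finite_part_double_series :
  is_double_series (fun u v => a u * b v * (cpow d (s + RtoC (INR (u + v))) / (s + RtoC (INR (u + v)))))%C
    (part (fun t => A t * B t)%C cauchy_coef).
Proof.
exists (fun u => part (fun t => a u * RtoC (t ^ u) * B t)%C (shift_coef (a u) u b)). split.
- intros u.
  apply (is_Cseries_ext (fun v => part (fun t => (a u * b v) * RtoC (t ^ (u + v)))%C
    (fun k => (a u * b v) * unit_coef (u + v) k)%C)).
  { intros v. rewrite finite_part_scal by apply taylor_bounded_monomial.
    now rewrite finite_part_monomial. }
  apply (finite_part_series _ _ (fun v t => (a u * b v) * RtoC (t ^ (u + v)))%C
    (fun v k => (a u * b v) * unit_coef (u + v) k)%C
    (fun n => (Cmod (a u) * d ^ u * Rabs KB * / d ^ N) * (d / rb) ^ n)).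
  + apply taylor_bounded_shift.
  + intros v. apply taylor_bounded_scal, taylor_bounded_monomial.
  + intros n k Hk Hn. unfold shift_coef.
    destruct (lt_dec k u) as [H|H].
    * symmetry. apply Csum_0. intros v Hv. unfold unit_coef. destruct (Nat.eq_dec k (u + v)); [lia|ring].
    * rewrite (Csum_ext _ (fun v => unit_coef (k - u) v * (a u * b v))%C).
      -- rewrite Csum_unit_coef. destruct (lt_dec (k - u) n); [reflexivity|lia].
      -- intros v _. unfold unit_coef.
         destruct (Nat.eq_dec k (u + v)); destruct (Nat.eq_dec v (k - u)); try lia; ring.
  + intros n t Hn Ht.
    replace (a u * RtoC (t ^ u) * B t - Csum (fun v => a u * b v * RtoC (t ^ (u + v))) n)%C
     with (a u * RtoC (t ^ u) * (B t - poly_sum b n t))%C.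
    2: { rewrite (Csum_ext _ (fun v => (a u * RtoC (t ^ u)) * (b v * RtoC (t ^ v)))%C).
      - rewrite Csum_scal. unfold poly_sum. ring.
      - intros v _. rewrite pow_add, RtoC_mult. ring. }
    rewrite !Cmod_mult, Cmod_R, Rabs_pos_eq by (apply pow_le; lra).
    assert (H1 : Cmod (B t - poly_sum b n t)%C <= Rabs KB * (/ d ^ N * (d / rb) ^ n * t ^ N)).
    { eapply Rle_trans; [apply HB; lra|]. apply Rle_trans with (Rabs KB * (t / rb) ^ n).
      - apply Rmult_le_compat_r; [|apply Rle_abs].
        apply pow_le, Rmult_le_pos; [lra|left; apply Rinv_0_lt_compat; lra].
      - apply Rmult_le_compat_l; [apply Rabs_pos|now apply ratio_pow_le]. }
    replace (Cmod (a u) * d ^ u * Rabs KB * / d ^ N * (d / rb) ^ n * t ^ N)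
      with (Cmod (a u) * d ^ u * (Rabs KB * (/ d ^ N * (d / rb) ^ n * t ^ N))) by ring.
    apply Rmult_le_compat; [apply Rmult_le_pos; [apply Cmod_ge_0|apply pow_le; lra]|apply Cmod_ge_0| |exact H1].
    apply Rmult_le_compat_l; [apply Cmod_ge_0|apply pow_incr; lra].
  + apply is_lim_seq_geom_scal. now apply ratio_lt_1.
- apply (finite_part_series _ _ (fun u t => a u * RtoC (t ^ u) * B t)%C (fun u => shift_coef (a u) u b)
    (fun n => (Rabs KA * Rabs KB * / d ^ N) * (d / ra) ^ n)).
  + apply taylor_bounded_product.
  + intros u. apply taylor_bounded_shift.
  + intros n k Hk Hn. symmetry. apply shift_coef_Csum. lia.
  + intros n t Hn Ht. now apply HA_eventual.
  + apply is_lim_seq_geom_scal. now apply ratio_lt_1.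
Qed.

End Product.

End FinitePart.

(** * The continuation of the double series *)

Definition zeta_coef (a : R) (u : nat) : C :=
  (RtoC ((-1) ^ u) * periodic_zeta a (RtoC (1 - INR u)) / RtoC (INR (fact u)))%C.

Lemma zeta_coef_0 (a : R) : zeta_coef a 0 = periodic_zeta a 1.
Proof. unfold zeta_coef. simpl. rewrite Rminus_0_r. field. Qed.

Lemma INR_C_neq_0 (n : nat) : (0 < n)%nat -> RtoC (INR n) <> 0.
Proof. intros H E. apply RtoC_inj in E. apply (not_0_INR n) in E; [exact E|lia]. Qed.

(** The coefficients of [polylog] are those of [geom_real] integrated, and the latter are zeta
    values at the nonpositive integers; the constant term is the value at 1. *)
Lemma polylog_zeta_taylor (a d rho : R) : 0 < a < 1 -> 0 < d < rho ->
  rho < 2 * PI * a -> rho < 2 * PI - 2 * PI * a ->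
  exists K, forall n t, 0 <= t <= d ->
    Cmod (polylog (2 * PI * a) t - poly_sum (zeta_coef a) n t)%C <= K * (t / rho) ^ n.
Proof.
intros Ha Hd H1 H2. pose proof PI_RGT_0.
assert (Hb : 0 < 2 * PI * a < 2 * PI) by (split; nra).
destruct (geom_taylor (2 * PI * a) Hb d rho) as (c & K & HK); try lra.
assert (HK' : forall N t, 0 <= t <= d ->
  Cmod (geom_real (2 * PI * a) t - poly_sum c N t)%C <= K * (t / rho) ^ N).
{ intros N t Ht. rewrite <- geom_RtoC. now apply HK. }
destruct (polylog_taylor (2 * PI * a) Hb c K d rho) as [K' HK2]; [lra|exact HK'|].
exists K'. intros n t Ht.
rewrite (poly_sum_ext (zeta_coef a) (primitive_coef (2 * PI * a) c)); [now apply HK2|].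
intros [|k] _; unfold zeta_coef, primitive_coef.
- change (zeta_coef a 0 = polylog (2 * PI * a) 0). rewrite zeta_coef_0. now apply periodic_zeta_1.
- replace (1 - INR (S k)) with (- INR k) by (rewrite S_INR; ring).
  rewrite (periodic_zeta_opp_INR a Ha c K d rho k) by first [lra | exact HK'].
  (* The sign [(-1)^(k+1)] of [zeta_coef] meets the [(-1)^k] of the zeta value, leaving the minus
     sign of the primitive; [k!/(k+1)!] leaves its denominator. *)
  rewrite fact_simpl, mult_INR. simpl pow. rewrite !RtoC_mult.
  assert (E : (RtoC ((-1) ^ k) * RtoC ((-1) ^ k))%C = 1).
  { rewrite <- RtoC_mult, <- Rpow_mult_distr. replace (-1 * -1) with 1 by ring. now rewrite pow1. }
  transitivity (RtoC (-1) * (RtoC ((-1) ^ k) * RtoC ((-1) ^ k)) * c k / RtoC (INR (S k)))%C.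
  + field. split; apply INR_C_neq_0; first [lia | apply lt_O_fact].
  + rewrite E. field. apply INR_C_neq_0; lia.
Qed.

Lemma Gamma_pole_exceptional (z : C) : exceptional z <-> Gamma_pole (z - 1)%C.
Proof.
split; intros [k Hk]; exists k.
- rewrite Hk, RtoC_minus, RtoC_opp. ring.
- replace z with (z - 1 + 1)%C by ring. rewrite Hk, RtoC_minus, RtoC_opp. ring.
Qed.

(** Exceptional points are integers, so a punctured disc of radius below 1 around one of them
    contains no other; there [f] equals the continuous [W]. *)
Lemma limiting_value_entire (f W : C -> C) (z : C) : entire W ->
  (forall w, ~ exceptional w -> W w = f w) -> exceptional z -> is_limiting_value f z (W z).
Proof.
intros HW Hf Hz.
destruct (Cderive_lipschitz W z (HW z)) as (del & M & Hdel & HM & Hlip).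
intros P [eps HP]. unfold filtermap, locally', within.
(* Balls of [C_UniformSpace] constrain real and imaginary part separately; halving the radius brings
   [Cmod] below the minimum. *)
assert (Heta : 0 < Rmin (Rmin del 1) (eps / M) / 2).
{ assert (0 < eps / M) by (apply Rdiv_lt_0_compat; [apply cond_pos|exact HM]).
  assert (0 < Rmin (Rmin del 1) (eps / M)) by (repeat apply Rmin_pos; lra). lra. }
exists (mkposreal _ Heta). intros w Hw Hwz. destruct Hw as [Hw1 Hw2]. simpl in Hw1, Hw2.
set (m := Rmin (Rmin del 1) (eps / M)) in *.
assert (M1 : m <= del) by (eapply Rle_trans; [apply Rmin_l|apply Rmin_l]).
assert (M2 : m <= 1) by (eapply Rle_trans; [apply Rmin_l|apply Rmin_r]).
assert (M3 : m <= eps / M) by apply Rmin_r.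
assert (Hdist : Cmod (w - z)%C < m).
{ eapply Rle_lt_trans; [apply Cmod_ReIm|]. unfold Cminus. rewrite re_plus, im_plus, re_opp, im_opp.
  change (Rabs (Re w - Re z) < m / 2) in Hw1. change (Rabs (Im w - Im z) < m / 2) in Hw2.
  unfold Rminus in Hw1, Hw2. lra. }
assert (Hne : ~ exceptional w).
{ intros [j Hj]. destruct Hz as [k Hk]. apply Hwz. rewrite Hj, Hk. do 2 f_equal.
  rewrite Hj, Hk in Hdist.
  rewrite <- RtoC_minus, Cmod_R in Hdist. replace (1 - INR j - (1 - INR k)) with (INR k - INR j) in Hdist by ring.
  f_equal. destruct (lt_eq_lt_dec j k) as [[Hlt|Heq]|Hlt]; [|exact Heq|]; exfalso.
  - assert (H1 : INR j + 1 <= INR k) by (rewrite <- S_INR; apply le_INR; lia).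
    pose proof (Rle_abs (INR k - INR j)). lra.
  - assert (H1 : INR k + 1 <= INR j) by (rewrite <- S_INR; apply le_INR; lia).
    pose proof (Rle_abs (- (INR k - INR j))). rewrite Rabs_Ropp in H. lra. }
apply HP. rewrite <- (Hf w Hne).
assert (Hb : Cmod (W w - W z)%C < eps).
{ eapply Rle_lt_trans; [apply Hlip; lra|].
  apply Rlt_le_trans with (M * (eps / M)); [apply Rmult_lt_compat_l; lra|]. right. field. lra. }
split.
- change (Rabs (Re (W w) - Re (W z)) < eps). eapply Rle_lt_trans; [|exact Hb].
  replace (Re (W w) - Re (W z)) with (Re (W w - W z)%C) by (unfold Cminus; rewrite re_plus, re_opp; ring).
  apply re_le_Cmod.
- change (Rabs (Im (W w) - Im (W z)) < eps). eapply Rle_lt_trans; [|exact Hb].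
  replace (Im (W w) - Im (W z)) with (Im (W w - W z)%C) by (unfold Cminus; rewrite im_plus, im_opp; ring).
  apply im_le_Cmod.
Qed.

Section Main.

Variables (c d r : nat) (x : R).
Hypotheses (hc : (1 <= c)%nat) (hcr : (c < r)%nat) (hd : (1 <= d)%nat) (hdr : (d < r)%nat) (hx : 0 < x).

Let ac : R := INR c / INR r.
Let ad : R := INR d / INR r.

(** Both [2 pi k/r] and [2 pi - 2 pi k/r] are positive integer multiples of [2 pi/r]; they are the
    distances from 0 to the nearest singularities. *)
Lemma fraction_bounds (k : nat) : (1 <= k)%nat -> (k < r)%nat ->
  0 < INR k / INR r < 1 /\ 2 * PI / INR r <= 2 * PI * (INR k / INR r)
  /\ 2 * PI / INR r <= 2 * PI - 2 * PI * (INR k / INR r).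
Proof.
intros H1 H2. pose proof PI_RGT_0.
assert (Hr : 0 < INR r) by (apply lt_0_INR; lia).
assert (Hk : 1 <= INR k) by (apply (le_INR 1); lia).
assert (Hkr : INR k + 1 <= INR r) by (rewrite <- S_INR; apply le_INR; lia).
assert (Hi : 0 < / INR r) by now apply Rinv_0_lt_compat.
assert (E : INR r * / INR r = 1) by (apply Rinv_r; lra).
unfold Rdiv. split; [split|split].
- apply Rmult_lt_0_compat; lra.
- rewrite <- E. apply Rmult_lt_compat_r; lra.
- rewrite !Rmult_assoc. apply Rmult_le_compat_l; [lra|]. apply Rmult_le_compat_l; [lra|].
  rewrite <- (Rmult_1_l (/ INR r)) at 1. apply Rmult_le_compat_r; lra.
- replace (2 * PI - 2 * PI * (INR k * / INR r)) with (2 * PI * ((INR r - INR k) * / INR r)).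
  + rewrite !Rmult_assoc. apply Rmult_le_compat_l; [lra|]. apply Rmult_le_compat_l; [lra|].
    rewrite <- (Rmult_1_l (/ INR r)) at 1. apply Rmult_le_compat_r; lra.
  + replace ((INR r - INR k) * / INR r) with (INR r * / INR r - INR k * / INR r) by ring. rewrite E. ring.
Qed.

Let Hac := fraction_bounds c hc hcr.
Let Had := fraction_bounds d hd hdr.

Let beta_bounds (a : R) : 0 < a < 1 -> 0 < 2 * PI * a < 2 * PI.
Proof. intros Ha. pose proof PI_RGT_0. split; nra. Qed.

Let F : R -> C := polylog_product (2 * PI * ac) (2 * PI * ad) x.

Definition coef_c (u : nat) : C := (zeta_coef ac u * RtoC (x ^ u))%C.
Definition coef_d (v : nat) : C := zeta_coef ad v.

Lemma continuation_exists (delta : R) :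
  0 < delta < Rmin (2 * PI / INR r) (2 * PI / (INR r * x)) ->
  exists L : C -> C, entire L /\
    (forall s, 0 < Re s -> (L s * Gamma_integral s)%C = mellin (at_right 0) (Rbar_locally p_infty) F s) /\
    L 0 = (periodic_zeta ac 1 * periodic_zeta ad 1)%C /\
    (forall s, ~ Gamma_pole s -> exists S2,
       is_double_series (fun u v => coef_c u * coef_d v
          * (cpow delta (s + RtoC (INR (u + v))) / (s + RtoC (INR (u + v)))))%C S2 /\
       (L s * Gamma s)%C = (S2 + mellin_upper F delta s)%C).
Proof.
intros [Hd0 Hd1]. pose proof PI_RGT_0.
assert (Hr : 0 < INR r) by (apply lt_0_INR; lia).
assert (Hda : delta < 2 * PI / INR r) by (eapply Rlt_le_trans; [exact Hd1|apply Rmin_l]).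
assert (Hdx : x * delta < 2 * PI / INR r).
{ apply Rlt_le_trans with (x * (2 * PI / (INR r * x))).
  - apply Rmult_lt_compat_l; [exact hx|]. eapply Rlt_le_trans; [exact Hd1|apply Rmin_r].
  - right. field. lra. }
(* As [t] runs over [[0, delta]] the arguments of the two factors reach [delta] and [x delta]; one
   radius [rho] strictly between [m] and [2 pi/r] serves both expansions. *)
set (m := Rmax delta (x * delta)).
assert (Hm : m < 2 * PI / INR r) by (apply Rmax_lub_lt; assumption).
assert (Hm1 : delta <= m) by apply Rmax_l. assert (Hm2 : x * delta <= m) by apply Rmax_r.
set (rho := (m + 2 * PI / INR r) / 2).
assert (Hrho : m < rho < 2 * PI / INR r) by (unfold rho; lra).
destruct Hac as (Ac1 & Ac2 & Ac3). destruct Had as (Ad1 & Ad2 & Ad3). fold ac in Ac1, Ac2, Ac3. fold ad in Ad1, Ad2, Ad3.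
destruct (polylog_zeta_taylor ac m rho Ac1) as [Kc HKc]; try lra.
destruct (polylog_zeta_taylor ad m rho Ad1) as [Kd HKd]; try lra.
set (A := fun t => polylog (2 * PI * ac) (x * t)). set (B := polylog (2 * PI * ad)).
(* In the variable [t], the expansion of [polylog (x t)] has its radius divided by [x]. *)
assert (Hra : delta < rho / x).
{ apply Rmult_lt_reg_r with x; [exact hx|]. unfold Rdiv. rewrite Rmult_assoc, Rinv_l by lra. lra. }
assert (Hrb : delta < rho) by lra.
assert (HAc : forall t, 0 < t <= delta -> curve_continuous A t).
{ intros t _. exact (polylog_dilate_continuous (2 * PI * ac) x (beta_bounds _ Ac1) t). }
assert (HBc : forall t, 0 < t <= delta -> curve_continuous B t).
{ intros t _. apply polylog_continuous. now apply beta_bounds. }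
assert (HA : forall n t, 0 <= t <= delta -> Cmod (A t - poly_sum coef_c n t)%C <= Kc * (t / (rho / x)) ^ n).
{ intros n t Ht. replace (t / (rho / x)) with (x * t / rho) by (field; lra).
  replace (poly_sum coef_c n t) with (poly_sum (zeta_coef ac) n (x * t)).
  - apply HKc. split; [apply Rmult_le_pos; lra|]. apply Rle_trans with (x * delta); [|exact Hm2].
    apply Rmult_le_compat_l; lra.
  - apply Csum_ext. intros k _. unfold coef_c. rewrite Rpow_mult_distr, RtoC_mult. ring. }
assert (HB : forall n t, 0 <= t <= delta -> Cmod (B t - poly_sum coef_d n t)%C <= Kd * (t / rho) ^ n).
{ intros n t Ht. apply HKd. lra. }
set (p := cauchy_coef coef_c coef_d).
assert (Hp : forall N, taylor_bounded delta N F p).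
{ intros N. apply (taylor_bounded_product delta N Hd0 A B coef_c coef_d Kc Kd (rho / x) rho); assumption. }
destruct (mellin_continuation F p delta) as (L & HL & HM & Hfp & Hv).
- apply polylog_product_decays; [now apply beta_bounds|now apply beta_bounds|exact hx].
- exact Hd0.
- intros N. apply (Hp N).
- exists L. split; [exact HL|]. split; [exact HM|]. split.
  (* The pole of Gamma at [s = 0] selects the constant term of the product, which is the value of
     [W] at 1. *)
  + specialize (Hv O). replace (- INR 0) with 0 in Hv by (simpl; ring). rewrite Hv.
    unfold p, cauchy_coef. rewrite Csum_S. unfold shift_coef.
    destruct (lt_dec 0 0) as [H0|_]; [lia|]. unfold coef_c, coef_d. rewrite Nat.sub_0_r, !zeta_coef_0.
    simpl. rewrite Rmult_1_l. ring.
  + intros s Hs. destruct (INR_unbounded (- Re s)) as [N HN].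
    assert (HN' : 0 < Re s + INR N) by lra.
    exists (mellin_finite_part F p delta N s). split.
    * exact (finite_part_double_series delta s N Hd0 HN' A B coef_c coef_d Kc Kd (rho / x) rho
        Hra Hrb HAc HBc HA HB).
    * now apply Hfp.
Qed.

Lemma W_term_phase (z : C) (n m : nat) : W_term c d r x z (S n) (S m)
  = (phase (2 * PI * ac) ^ S m * phase (2 * PI * ad) ^ S n / (RtoC (INR (S m)) * RtoC (INR (S n)))
     * cpow (INR (S n) + INR (S m) * x) (- (z - 1)))%C.
Proof.
unfold W_term. rewrite cpow_opp.
replace (INR (S m) * INR c / INR r) with (INR (S m) * ac) by (unfold ac, Rdiv; ring).
replace (INR (S n) * INR d / INR r) with (INR (S n) * ad) by (unfold ad, Rdiv; ring).
rewrite !e2pi_phase. field.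
repeat split; first [apply cpow_neq_0 | apply INR_C_neq_0; lia].
Qed.

Lemma W_double_series (L : C -> C) :
  (forall s, 0 < Re s -> (L s * Gamma_integral s)%C = mellin (at_right 0) (Rbar_locally p_infty) F s) ->
  forall z, 1 < Re z -> is_double_series (fun n m => W_term c d r x z (S n) (S m)) (L (z - 1)%C).
Proof.
intros HM z Hz. set (s := (z - 1)%C).
assert (Hs : 0 < Re s) by (unfold s, Cminus; rewrite re_plus, re_opp, re_RtoC; lra).
pose proof (Gamma_integral_neq_0 s Hs) as Hg.
destruct Hac as (Ac1 & _). destruct Had as (Ad1 & _).
pose proof (polylog_product_double_series _ _ x (beta_bounds _ Ac1) (beta_bounds _ Ad1) hx range_half_line s
  (mellin (at_right 0) (Rbar_locally p_infty) F s) (fun k => cpow k (- s) * Gamma_integral s)%C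
  (fun k Hk => ex_gamma_integral (Re s) k Hs Hk) (fun k Hk => Gamma_integral_dilate s k Hs Hk)
  (mellin_correct_half_line F s (polylog_product_decays _ _ x (beta_bounds _ Ac1) (beta_bounds _ Ad1) hx) Hs)) as H.
apply (is_double_series_scal (/ Gamma_integral s)%C) in H.
rewrite <- HM in H by exact Hs.
replace (/ Gamma_integral s * (L s * Gamma_integral s))%C with (L s) in H by (field; exact Hg).
revert H. apply is_double_series_ext. intros n m. rewrite W_term_phase. fold s ac ad.
field. repeat split; first [exact Hg | apply INR_C_neq_0; lia].
Qed.

Lemma rhs_term1_double_series (z : C) (delta : R) : 0 < delta ->
  is_double_series (fun n m => rhs_term1 c d r x delta z (S n) (S m)) (mellin_upper F delta (z - 1)%C).
Proof.
intros Hdel. set (s := (z - 1)%C). destruct Hac as (Ac1 & _). destruct Had as (Ad1 & _).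
pose proof (polylog_product_double_series _ _ x (beta_bounds _ Ac1) (beta_bounds _ Ad1) hx (range_right delta Hdel) s
  (mellin_upper F delta s) (fun k => cpow k (- s) * upper_Gamma s (k * delta))%C
  (fun k Hk => ex_gamma_integral_right (Re s - 1) k delta Hk Hdel) (fun k Hk => upper_Gamma_dilate s k delta Hk Hdel)
  (mellin_correct_right F s delta (polylog_product_decays _ _ x (beta_bounds _ Ac1) (beta_bounds _ Ad1) hx) Hdel)) as H.
revert H. apply is_double_series_ext. intros n m. unfold rhs_term1. rewrite W_term_phase. fold s ac ad. ring.
Qed.

Lemma rhs_term2_coef (z : C) (delta : R) (u v : nat) : ~ exceptional z ->
  (coef_c u * coef_d v * (cpow delta ((z - 1) + RtoC (INR (u + v))) / ((z - 1) + RtoC (INR (u + v)))))%C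
  = rhs_term2 c d r x delta z u v.
Proof.
intros Hz. unfold rhs_term2, coef_c, coef_d, zeta_coef. fold ac ad.
rewrite Gamma_pole_exceptional in Hz.
pose proof (Gamma_pole_neq _ Hz (u + v)) as Hne.
rewrite plus_INR in *. rewrite pow_add, RtoC_mult.
replace (RtoC (INR u + INR v) + z - 1)%C with (z - 1 + RtoC (INR u + INR v))%C by ring.
field. repeat split; try exact Hne; apply INR_C_neq_0, lt_O_fact.
Qed.

Lemma rhs_correct (L : C -> C) (delta : R) (z : C) : 0 < delta ->
  (forall s, ~ Gamma_pole s -> exists S2,
     is_double_series (fun u v => coef_c u * coef_d v
        * (cpow delta (s + RtoC (INR (u + v))) / (s + RtoC (INR (u + v)))))%C S2 /\
     (L s * Gamma s)%C = (S2 + mellin_upper F delta s)%C) ->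
  ~ exceptional z ->
  ex_double_series (fun n m => rhs_term1 c d r x delta z (S n) (S m))
  /\ ex_double_series (rhs_term2 c d r x delta z)
  /\ L (z - 1)%C = rhs c d r x delta z.
Proof.
intros Hdel HL Hz. pose proof Hz as Hp. rewrite Gamma_pole_exceptional in Hp.
destruct (HL _ Hp) as (S2 & H2 & E).
pose proof (rhs_term1_double_series z delta Hdel) as H1.
assert (H2' : is_double_series (rhs_term2 c d r x delta z) S2).
{ revert H2. apply is_double_series_ext. intros u v. now apply rhs_term2_coef. }
split; [exists (mellin_upper F delta (z - 1)%C); exact H1|]. split; [exists S2; exact H2'|].
unfold rhs. rewrite (double_series_eq _ _ H1), (double_series_eq _ _ H2').
pose proof (Gamma_neq_0 _ Hp) as Hg.
transitivity (L (z - 1) * Gamma (z - 1) / Gamma (z - 1))%C; [field; exact Hg|].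
rewrite E. field. exact Hg.
Qed.

End Main.

Theorem proposition5p2 (c d r : nat) (x : R)
  (hc : (1 <= c)%nat) (hcr : (c < r)%nat)
  (hd : (1 <= d)%nat) (hdr : (d < r)%nat)
  (hx : 0 < x) :
  exists W : C -> C,
    is_W c d r x W
    /\ (forall (z : C) (delta : R),
          0 < delta < Rmin (2 * PI / INR r) (2 * PI / (INR r * x)) ->
          (~ exceptional z ->
             ex_double_series (fun n m => rhs_term1 c d r x delta z (S n) (S m))
             /\ ex_double_series (rhs_term2 c d r x delta z)
             /\ W z = rhs c d r x delta z)
          /\ (exceptional z ->
                is_limiting_value (rhs c d r x delta) z (W z)))
    /\ W (RtoC 1) = (periodic_zeta (INR c / INR r) (RtoC 1)
                     * periodic_zeta (INR d / INR r) (RtoC 1))%C.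
Proof.
set (b := Rmin (2 * PI / INR r) (2 * PI / (INR r * x))).
assert (Hb : 0 < b).
{ pose proof PI_RGT_0. assert (Hr : 0 < INR r) by (apply lt_0_INR; lia).
  apply Rmin_pos; apply Rdiv_lt_0_compat; try lra. now apply Rmult_lt_0_compat. }
(* [W] must not depend on [delta], so it is built once from an arbitrary admissible value. *)
destruct (continuation_exists c d r x hc hcr hd hdr hx (b / 2)) as (L & HL & HM & H0 & _); [fold b; lra|].
assert (HW : entire (fun z => L (z - 1)%C)).
{ intros z. apply (Cderivable_comp L (fun z => z - 1)%C); [apply HL|].
  apply Cderivable_minus; [apply Cderivable_id|apply Cderivable_const]. }
exists (fun z => L (z - 1)%C). split; [split; [exact HW|]|split].
- now apply W_double_series.
- intros z delta Hdelta. fold b in Hdelta.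
  destruct (continuation_exists c d r x hc hcr hd hdr hx delta Hdelta) as (L' & HL' & HM' & _ & Hrhs).
  (* The continuation built from [delta] has the same Mellin transform for [Re s > 0], so the
     identity theorem makes it coincide with the fixed [L]. *)
  assert (E : forall s, L' s = L s).
  { apply entire_identity; try assumption. intros s Hs. pose proof (Gamma_integral_neq_0 s Hs) as Hg.
    transitivity (L' s * Gamma_integral s / Gamma_integral s)%C; [field; exact Hg|].
    rewrite HM', <- HM by exact Hs. field. exact Hg. }
  assert (Hcorr : forall w, ~ exceptional w ->
     ex_double_series (fun n m => rhs_term1 c d r x delta w (S n) (S m))
     /\ ex_double_series (rhs_term2 c d r x delta w)
     /\ L (w - 1)%C = rhs c d r x delta w).
  { intros w Hw. rewrite <- E. now apply rhs_correct. }
  split; [apply Hcorr|].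
  intros Hz. apply (limiting_value_entire (rhs c d r x delta) (fun z => L (z - 1)%C)); try assumption.
  intros w Hw. now apply Hcorr.
- replace (RtoC 1 - 1)%C with (RtoC 0) by ring. exact H0.
Qed.
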